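(* Let $q\in(0,1)$, let $0\le m\le N-1$ be integers, $\lambda\in\mathbb{GT}^+_N$ and $a\in\mathbb C$. Then $$\frac{\chi_\lambda^B(q^{\frac12},\ldots,q^{m-\frac12},q^a,q^{m+\frac32},\ldots,q^{N-\frac12})}{\chi_\lambda^B(q^{\frac12},q^{\frac32},\ldots,q^{N-\frac12})}=\frac{q^{\frac12(m+\frac12)}-q^{-\frac12(m+\frac12)}}{q^{\frac a2}-q^{-\frac a2}}\cdot\frac{(q^{m+1},q^{-m};q)_m(q,q^{2m+2};q)_{N-m-1}}{(q^{\frac12+a},q^{\frac12-a};q)_m(q^{m+\frac32+a},q^{m+\frac32-a};q)_{N-m-1}}$$ $$\times\oint\frac{dz}{2\pi\mathrm i}\oint\frac{dw}{2\pi\mathrm i}\frac{z^{a+N-\frac12}(z-w^{2m+2})}{w^{N+m+2}(w-z)}\frac{w-1}{z-1}\prod_{i=1}^N\frac{(w-q^{\lambda_i+N+\frac12-i})(w-q^{-(\lambda_i+N+\frac12-i)})}{(z-q^{\lambda_i+N+\frac12-i})(z-q^{-(\lambda_i+N+\frac12-i)})};$$ $$\frac{\chi_\lambda^C(q,\ldots,q^m,q^a,q^{m+2},\ldots,q^N)}{\chi_\lambda^C(q,q^2,\ldots,q^N)}=\frac{(q^{m+1}-q^{-(m+1)})(q^{m+2},q^{-m};q)_m(q,q^{2m+3};q)_{N-m-1}}{(q^a-q^{-a})(q^{1+a},q^{1-a};q)_m(q^{m+2+a},q^{m+2-a};q)_{N-m-1}}$$ $$\times\oint\frac{dz}{2\pi\mathrm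 i}\oint\frac{dw}{2\pi\mathrm i}\frac{z^{a+N-1}(1-w^{2m+2})}{w^{N+m+1}(w-z)}\prod_{i=1}^N\frac{(w-q^{\lambda_i+N+1-i})(w-q^{-(\lambda_i+N+1-i)})}{(z-q^{\lambda_i+N+1-i})(z-q^{-(\lambda_i+N+1-i)})};$$ $$\frac{\chi_\lambda^D(1,\ldots,q^{m-1},q^a,q^{m+1},\ldots,q^{N-1})}{\chi_\lambda^D(1,q,\ldots,q^{N-1})}=\frac{(2-\mathbf 1_{\{m=0\}})(q^m,q^{-m};q)_m(q,q^{2m+1};q)_{N-m-1}}{2(q^a,q^{-a};q)_m(q^{m+1+a},q^{m+1-a};q)_{N-m-1}}$$ $$\times\oint\frac{dz}{2\pi\mathrm i}\oint\frac{dw}{2\pi\mathrm i}\frac{z^{a+N-1}(z+w^{2m+1})}{w^{N+m+1}(w-z)}\prod_{i=1}^N\frac{(w-q^{\lambda_i+N-i})(w-q^{-(\lambda_i+N-i)})}{(z-q^{\lambda_i+N-i})(z-q^{-(\lambda_i+N-i)})}.$$ In each right-hand side, the $z$-contour encloses the smallest closed interval $I\subseteq\mathbb R$ containing all the points $\{q^{\pm(\lambda_i+N-i+\epsilon)}\}_{1\le i\le N}$ (with $\epsilon=\frac12,1,0$ for types $B,C,D$, respectively) but does not enclose the origin, and the $w$-contour encloses the $z$-contour and the origin.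
   Context: $\mathrm i=\sqrt{-1}$. $\mathbb{GT}^+_N$ is the set of $\lambda=(\lambda_1\ge\cdots\ge\lambda_N\ge0)\in\mathbb Z^N$. $(a;q)_n=\prod_{i=1}^n(1-aq^{i-1})$ and $(a_1,\ldots,a_r;q)_n=\prod_l(a_l;q)_n$. $V^s(z_1,\ldots,z_N)=\prod_{1\le i<j\le N}(z_i+z_i^{-1}-z_j-z_j^{-1})$, and $\chi^G_\lambda$ is the Laurent polynomial $$\chi^G_\lambda(z_1,\ldots,z_N)=\frac{1}{V^s(z_1,\ldots,z_N)}\times\begin{cases}\det_{1\le i,j\le N}\Big[\frac{z_j^{\lambda_i+N-i+1/2}-z_j^{-(\lambda_i+N-i+1/2)}}{z_j^{1/2}-z_j^{-1/2}}\Big],&G=B,\\ \det_{1\le i,j\le N}\Big[\frac{z_j^{\lambda_i+N-i+1}-z_j^{-(\lambda_i+N-i+1)}}{z_j-z_j^{-1}}\Big],&G=C,\\ \det_{1\le i,j\le N}\big[z_j^{\lambda_i+N-i}+z_j^{-(\lambda_i+N-i)}\big],&G=D.\end{cases}$$ $\mathbf 1_{\{\cdot\}}$ is an indicator. Contours are positively (counterclockwise) oriented, $q^a=e^{a\ln q}$, the power $z^a$ is the principal branch, and the $z$-contour is taken in $\mathbb C\setminus(-\infty,0]$. The values of $a$ at which the prefactor on the right is singular are apparent singularities (the left-hand sides are entire in $a$); there the right-hand side is understood by continuity in $a$. *)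

(* Defs.v *)
From HB Require Import structures.
From mathcomp Require Import all_boot all_order all_algebra.
From mathcomp Require Import complex.
From mathcomp Require Import all_classical all_reals all_analysis.

Set Implicit Arguments.
Unset Strict Implicit.
Unset Printing Implicit Defensive.

Import Order.TTheory GRing.Theory Num.Theory numFieldNormedType.Exports.

Local Open Scope classical_set_scope.
Local Open Scope complex_scope.
Local Open Scope ring_scope.

Section ComplexFunctions.
Context {R : realType}.
Implicit Types (q : R) (z a : R[i]).

Definition cexp z : R[i] :=
  (expR (complex.Re z) * cos (complex.Im z))
    +i* (expR (complex.Re z) * sin (complex.Im z)).

Definition cmod z : R := Num.sqrt (complex.Re z ^+ 2 + complex.Im z ^+ 2).

(* the principal argument, in ]-pi, pi] for z != 0 *)
Definition carg z : R :=
  if 0 <= complex.Im z then acos (complex.Re z / cmod z)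
  else - acos (complex.Re z / cmod z).

Definition clog z : R[i] := ln (cmod z) +i* carg z.

Definition cpow z a : R[i] := cexp (a * clog z).

Definition qpow q a : R[i] := cexp (a * (ln q)%:C).

Definition qpoch (x : R[i]) q (n : nat) : R[i] :=
  \prod_(i < n) (1 - x * (q ^+ i)%:C).

Definition qpochs (s : seq R[i]) q (n : nat) : R[i] :=
  \prod_(x <- s) qpoch x q n.

End ComplexFunctions.

Section Contours.
Context {R : realType}.
Implicit Types (g : R -> R[i]) (f : R[i] -> R[i]) (p : R[i]).

Definition C1_curve g : Prop :=
  [/\ forall t, derivable (fun u => complex.Re (g u)) t 1,
      forall t, derivable (fun u => complex.Im (g u)) t 1,
      continuous (derive1 (fun u => complex.Re (g u)))
    & continuous (derive1 (fun u => complex.Im (g u)))].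

(* Piecewise C^1 on [0, 1]: on each closed subinterval of a subdivision, g is
   the restriction of a C^1 curve.  Continuity at the breakpoints follows. *)
Definition piecewise_C1 g : Prop :=
  exists (n : nat) (s : nat -> R),
    [/\ s 0%N = 0, s n = 1 &
      forall k, (k < n)%N ->
        s k < s k.+1 /\
        exists2 h, C1_curve h & {in `[s k, s k.+1], g =1 h}].

(* The value at the finitely many breakpoints and at the end points 0 and 1 is
   irrelevant below, as it is only used under an integral sign. *)
Definition velocity g (t : R) : R[i] :=
  derive1 (fun u => complex.Re (g u)) t +i* derive1 (fun u => complex.Im (g u)) t.

Definition cintegral (h : R -> R[i]) : R[i] :=
  (\int[lebesgue_measure]_(t in `[0, 1]) complex.Re (h t))
    +i* (\int[lebesgue_measure]_(t in `[0, 1]) complex.Im (h t)).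

(* the integral along g of f(z) dz / (2 pi i) *)
Definition oint g f : R[i] :=
  cintegral (fun t => f (g t) * velocity g t) / (0 +i* (2 * pi)).

Definition off_curve g p : Prop := forall t, t \in `[0, 1] -> g t != p.

Definition winding g p : R[i] := oint g (fun z => (z - p)^-1).

(* A simple closed piecewise C^1 curve, parametrized by [0, 1].  For such a curve
   the winding number is 0 outside and constantly 1 or -1 inside, so the last
   clause is the counterclockwise orientation. *)
Record contour g : Prop := Contour {
  contour_C1 : piecewise_C1 g;
  contour_closed : g 0 = g 1;
  contour_simple : {in `[0, 1[ &, injective g};
  contour_positive :
    forall p, off_curve g p -> winding g p = 0 \/ winding g p = 1 }.

Definition encloses g p : Prop := off_curve g p /\ winding g p = 1.

Definition in_slit_plane (z : R[i]) : Prop :=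
  ~ (complex.Im z = 0 /\ complex.Re z <= 0).

Definition closed_interval_hull (A : set R) : set R :=
  [set x | forall a b, A `<=` `[a, b] -> x \in `[a, b]].

End Contours.

Section Characters.

Inductive lie_type := TypeB | TypeC | TypeD.

Definition is_GT N (lam : 'I_N -> nat) : Prop :=
  forall i j : 'I_N, (i <= j)%N -> (lam j <= lam i)%N.

Context {R : realType}.
Implicit Types (G : lie_type) (q : R).

(* a Laurent polynomial in z_1, ..., z_N as a finite list of terms (c, k), with
   k in Z^N, each standing for c * z_1 ^ k_1 * ... * z_N ^ k_N *)
Definition laurent N : Type := seq (R[i] * {ffun 'I_N -> int}).

Definition laurent_eval N (P : laurent N) (z : 'I_N -> R[i]) : R[i] :=
  \sum_(t <- P) t.1 * \prod_(i < N) z i ^ t.2 i.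

(* In type B the half-integer powers are powers of a square root of x; the
   quotient num / den does not depend on which one. *)
Definition entry_num G (k : nat) (x : R[i]) : R[i] :=
  match G with
  | TypeB => sqrtC x ^+ (2 * k + 1) - sqrtC x ^- (2 * k + 1)
  | TypeC => x ^+ (k + 1) - x ^- (k + 1)
  | TypeD => x ^+ k + x ^- k
  end.

Definition entry_den G (x : R[i]) : R[i] :=
  match G with
  | TypeB => sqrtC x - (sqrtC x)^-1
  | TypeC => x - x^-1
  | TypeD => 1
  end.

Definition Vs N (z : 'I_N -> R[i]) : R[i] :=
  \prod_(i < N) \prod_(j < N | (i < j)%N)
    (z i + (z i)^-1 - z j - (z j)^-1).

(* indices start from 0, so that N - i becomes N - i.+1 *)
Definition character_quotient G N (lam : 'I_N -> nat) (z : 'I_N -> R[i]) :=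
  (\det (\matrix_(i < N, j < N)
     (entry_num G (lam i + (N - i.+1)) (z j) / entry_den G (z j)))) / Vs z.

Definition is_character G N (lam : 'I_N -> nat) (P : laurent N) : Prop :=
  forall z : 'I_N -> R[i],
    (forall i, z i != 0) -> (forall i, entry_den G (z i) != 0) -> Vs z != 0 ->
    laurent_eval P z = character_quotient G lam z.

(* The Laurent polynomial that the determinantal quotient defines.  Its values at
   points with nonzero coordinates are determined by is_character; at the zeros of
   the denominators of the quotient they are not given by the quotient itself. *)
Definition character_laurent G N (lam : 'I_N -> nat) : laurent N :=
  xget [::] [set P | is_character G lam P].

Definition chi G N (lam : 'I_N -> nat) (z : 'I_N -> R[i]) : R[i] :=
  laurent_eval (character_laurent G lam) z.

Definition eps G : R :=
  match G with TypeB => 1 / 2 | TypeC => 1 | TypeD => 0 end.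

(* the point (q^eps, q^(1 + eps), ..., q^(N - 1 + eps)) *)
Definition base_point G q N : 'I_N -> R[i] :=
  fun j => qpow q (j%:R + eps G)%:C.

(* the same point with its entry q^(m + eps) replaced by q^a *)
Definition shifted_point G q N (m : nat) (a : R[i]) : 'I_N -> R[i] :=
  fun j => if j == m :> nat then qpow q a else base_point G q j.

Definition normalized_chi G q N (lam : 'I_N -> nat) (m : nat) (a : R[i]) :=
  chi G lam (shifted_point G q m a) / chi G lam (base_point G q (N := N)).

Definition ell G N (lam : 'I_N -> nat) (i : 'I_N) : R :=
  (lam i + (N - i.+1))%:R + eps G.

Definition nodes G q N (lam : 'I_N -> nat) : set R :=
  [set x | exists i, x = q `^ ell G lam i \/ x = q `^ (- ell G lam i)].

Definition node_factor G q N (lam : 'I_N -> nat) (i : 'I_N) (x : R[i]) :=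
  (x - (q `^ ell G lam i)%:C) * (x - (q `^ (- ell G lam i))%:C).

Record admissible_contours G q N (lam : 'I_N -> nat) (gz gw : R -> R[i]) :
    Prop := AdmissibleContours {
  adm_z : contour gz;
  adm_w : contour gw;
  adm_z_slit : forall t, t \in `[0, 1] -> in_slit_plane (gz t);
  adm_z_nodes :
    forall x, closed_interval_hull (nodes G q lam) x -> encloses gz x%:C;
  adm_z_origin : ~ encloses gz 0;
  adm_w_z : forall t, t \in `[0, 1] -> encloses gw (gz t);
  adm_w_origin : encloses gw 0 }.

End Characters.

(* v is the value at a of rhs, whose denominator is den: the plain value where den
   does not vanish, and otherwise the limit at a of rhs. *)
Definition value_by_continuity (K : numFieldType) (den rhs : K -> K) (a v : K) :
    Prop :=
  if den a == 0 then rhs x @[x --> a^'] --> v else v = rhs a.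

Section Formulas.
Context {R : realType}.
Implicit Types (q : R) (m : nat) (a z w : R[i]).

Definition numB q N m : R[i] :=
  (qpow q (1 / 2 * (m%:R + 1 / 2)) - qpow q (- (1 / 2 * (m%:R + 1 / 2))))
  * qpochs [:: qpow q (m%:R + 1); qpow q (- m%:R)] q m
  * qpochs [:: qpow q 1; qpow q (2 * m%:R + 2)] q (N - m - 1).

Definition denB q N m a : R[i] :=
  (qpow q (a / 2) - qpow q (- (a / 2)))
  * qpochs [:: qpow q (1 / 2 + a); qpow q (1 / 2 - a)] q m
  * qpochs [:: qpow q (m%:R + 3 / 2 + a); qpow q (m%:R + 3 / 2 - a)] q
      (N - m - 1).

Definition integrandB q N (lam : 'I_N -> nat) m a z w : R[i] :=
  (cpow z (a + N%:R - 1 / 2) * (z - w ^+ (2 * m + 2)))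
    / (w ^+ (N + m + 2) * (w - z))
  * ((w - 1) / (z - 1))
  * \prod_(i < N) (node_factor TypeB q lam i w / node_factor TypeB q lam i z).

Definition numC q N m : R[i] :=
  (qpow q (m%:R + 1) - qpow q (- (m%:R + 1)))
  * qpochs [:: qpow q (m%:R + 2); qpow q (- m%:R)] q m
  * qpochs [:: qpow q 1; qpow q (2 * m%:R + 3)] q (N - m - 1).

Definition denC q N m a : R[i] :=
  (qpow q a - qpow q (- a))
  * qpochs [:: qpow q (1 + a); qpow q (1 - a)] q m
  * qpochs [:: qpow q (m%:R + 2 + a); qpow q (m%:R + 2 - a)] q (N - m - 1).

Definition integrandC q N (lam : 'I_N -> nat) m a z w : R[i] :=
  (cpow z (a + N%:R - 1) * (1 - w ^+ (2 * m + 2)))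
    / (w ^+ (N + m + 1) * (w - z))
  * \prod_(i < N) (node_factor TypeC q lam i w / node_factor TypeC q lam i z).

Definition numD q N m : R[i] :=
  (2 - (m == 0%N)%:R)
  * qpochs [:: qpow q m%:R; qpow q (- m%:R)] q m
  * qpochs [:: qpow q 1; qpow q (2 * m%:R + 1)] q (N - m - 1).

Definition denD q N m a : R[i] :=
  2 * qpochs [:: qpow q a; qpow q (- a)] q m
  * qpochs [:: qpow q (m%:R + 1 + a); qpow q (m%:R + 1 - a)] q (N - m - 1).

Definition integrandD q N (lam : 'I_N -> nat) m a z w : R[i] :=
  (cpow z (a + N%:R - 1) * (z + w ^+ (2 * m + 1)))
    / (w ^+ (N + m + 1) * (w - z))
  * \prod_(i < N) (node_factor TypeD q lam i w / node_factor TypeD q lam i z).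

End Formulas.

(* Main.v *)
Require Import Defs.
From mathcomp Require Import all_boot all_order all_algebra.
From mathcomp Require Import complex.
From mathcomp Require Import all_classical all_reals all_analysis.
From mathcomp Require Import measurable_realfun zify ring lra.
Set Implicit Arguments.
Unset Strict Implicit.
Unset Printing Implicit Defensive.

Import Order.TTheory GRing.Theory Num.Theory numFieldNormedType.Exports.
Local Open Scope classical_set_scope.
Local Open Scope complex_scope.
Local Open Scope ring_scope.

(** Write x_i = q^(l_i) with l_i the exponents of the determinant, s = 1 in
type D and s = -1 in types B and C, and v_i(b) = x_i^b + s x_i^(-b).  At the
point with coordinates q^(b_j) the character is det [v_i(b_j)] divided by
explicit factors: a Vandermonde product in the variables q^b + q^(-b), and in
types B and C one denominator per coordinate.  The two points of the theorem
differ in one coordinate only.  Hence the quotient of the explicit factors is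
a product of q-Pochhammer symbols, which is the prefactor of the formula
(normalized_chiE), and what remains is to show that det [v_i(k_j)], with
k_j = j + eps, changes by the factor J(a) / w when k_m is replaced by a, where
J(a) is the double integral and w = 1, except that w = 2 in type D for m = 0.

By Cramer's rule this holds for every family of functions J_m of the form
J_m(a) = sum_i c_i v_i(a) such that J_m(k_j) = w_m if j = m and 0 otherwise;
such a family also shows that the determinant is not zero (det_dual_neq0,
det_replace_column).  So the integral is never compared with the determinant:
it is only shown to have these two properties.

The inner integrand is a polynomial in w divided by w^c (w - z), with 0 and z
inside the contour.  Its integral is the value at z of the polynomial part of
the quotient by w^c (oint_drop_poly).  The outer integrand is then
z^b G(z) / P(z), where P is a product of linear factors over the nodes x_i and
1 / x_i and over the node 1 in type B.  In type D a node l_i = 0 makes 1 a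
double root of P, and then G and P have a common factor z - 1
(inner_polyD_double).  So there are only simple poles, and the integral is the
sum over the nodes of x^b G(x) / P'(x) (residue_cpow).

P is palindromic up to sign.  The truncations of P from which G is built are
therefore exchanged by x -> 1 / x at the roots of P, so that the weights of x
and 1 / x are equal up to the sign s, and the sum has the form
sum_i c_i v_i(a) (residue_sum_basis).  At a = k_j the powers x^b are
polynomial in x, and summing Q(x) / P'(x) over all roots of P extracts one
coefficient of the remainder of Q modulo P.  This gives the values at k_j
(residue_sum_node).

The residue theorem is needed only for a power z^b times a polynomial.
A function with a primitive integrates to 0 along a closed
curve.  The quotient (z^b - x^b) / (z - x) also integrates to 0, by
contracting the curve to x along segments, which stay in the slit plane
(oint_cpow_sub); the rest is the definition of the winding number.

Two facts about the characters remain.  The determinantal quotient is a Laurent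
polynomial: its entries are polynomials in the variables z + 1 / z, and
Newton interpolation splits off the Vandermonde factor (exists_character).
The zeros of the prefactor in a are isolated and the left-hand side is
continuous in a, which settles the apparent singularities
(value_by_continuity_chi). *)

(** * Derivatives along plane curves *)

Section Curves.
Context {R : realType}.
Implicit Types (g h : R -> R[i]) (t : R) (z w d : R[i]) (U : set R[i]).

Local Notation Re := complex.Re.
Local Notation Im := complex.Im.

Lemma cReM z w : Re (z * w) = Re z * Re w - Im z * Im w.
Proof. by case: z w => [a b] [c e]. Qed.

Lemma cImM z w : Im (z * w) = Re z * Im w + Im z * Re w.
Proof. by case: z w => [a b] [c e]. Qed.

Lemma cReD z w : Re (z + w) = Re z + Re w.
Proof. by case: z w => [a b] [c e]. Qed.

Lemma cImD z w : Im (z + w) = Im z + Im w.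
Proof. by case: z w => [a b] [c e]. Qed.

Lemma cReN z : Re (- z) = - Re z.
Proof. by case: z. Qed.

Lemma cImN z : Im (- z) = - Im z.
Proof. by case: z. Qed.

Lemma complex_ext z w : Re z = Re w -> Im z = Im w -> z = w.
Proof. by case: z w => [a b] [c e] /= -> ->. Qed.

Lemma sqnorm_gt0 z : z != 0 -> 0 < Re z ^+ 2 + Im z ^+ 2.
Proof.
case: z => a b; rewrite eq_complex /= negb_and => /orP[] H.
  by rewrite ltr_pwDl ?sqr_ge0// exprn_even_gt0.
by rewrite ltr_wpDl ?sqr_ge0// exprn_even_gt0.
Qed.

(** The derivative of a plane curve, taken componentwise, as the velocity of a
contour is. *)
Definition cderiv g t d : Prop :=
  is_derive t 1 (fun u => Re (g u)) (Re d) /\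
  is_derive t 1 (fun u => Im (g u)) (Im d).

Lemma cderiv_eq g t d d' : cderiv g t d -> d = d' -> cderiv g t d'.
Proof. by move=> ? <-. Qed.

Lemma cderiv_cst z t : cderiv (cst z) t 0.
Proof. by split; exact: is_derive_cst. Qed.

Lemma cderivD g h t d d' :
  cderiv g t d -> cderiv h t d' -> cderiv (fun u => g u + h u) t (d + d').
Proof.
move=> [g1 g2] [h1 h2]; split.
  under eq_fun do rewrite cReD.
  by apply: is_derive_eq; rewrite cReD.
under eq_fun do rewrite cImD.
by apply: is_derive_eq; rewrite cImD.
Qed.

Lemma cderivM g h t d d' : cderiv g t d -> cderiv h t d' ->
  cderiv (fun u => g u * h u) t (d * h t + g t * d').
Proof.
move=> [g1 g2] [h1 h2]; split.
  under eq_fun do rewrite cReM.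
  apply: is_derive_eq; rewrite cReD !cReM /GRing.scale /=; ring.
under eq_fun do rewrite cImM.
apply: is_derive_eq; rewrite cImD !cImM /GRing.scale /=; ring.
Qed.

Lemma cReV z : Re z^-1 = Re z / (Re z ^+ 2 + Im z ^+ 2).
Proof. by case: z. Qed.

Lemma cImV z : Im z^-1 = - Im z / (Re z ^+ 2 + Im z ^+ 2).
Proof. by case: z => a b /=; rewrite mulNr. Qed.

Lemma cderivV g t d : g t != 0 -> cderiv g t d ->
  cderiv (fun u => (g u)^-1) t (- d / g t ^+ 2).
Proof.
move=> /sqnorm_gt0 g0 [g1 g2]; have g0' := lt0r_neq0 g0.
have nD : is_derive t 1 (fun u => (Re (g u) ^+ 2 + Im (g u) ^+ 2)^-1)
    (- (2 * (Re (g t) * Re d + Im (g t) * Im d))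
      / (Re (g t) ^+ 2 + Im (g t) ^+ 2) ^+ 2).
  pose D u := Re (g u) ^+ 2 + Im (g u) ^+ 2.
  have dD : is_derive t 1 D (2 * (Re (g t) * Re d + Im (g t) * Im d)).
    rewrite /D; apply: is_derive_eq.
    by rewrite /GRing.scale /=; ring.
  apply: (is_derive_eq (@is_deriveV _ D _ _ _ g0' dD)).
  by rewrite /GRing.scale /= /D; field.
have dE : - d / g t ^+ 2 = - d * (g t)^-1 * (g t)^-1.
  by rewrite [g t ^+ 2]expr2 invfM mulrA.
split.
  under eq_fun do rewrite cReV.
  apply: is_derive_eq.
  rewrite dE !cReM !cImM !cReV !cImV !cReN !cImN /GRing.scale /=.
  by field.
under eq_fun do rewrite cImV.
apply: is_derive_eq.
rewrite dE !cImM !cReM !cReV !cImV !cReN !cImN /GRing.scale /=.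
by field.
Qed.

Lemma cderiv_continuous g t d : cderiv g t d ->
  {for t, continuous (fun u => Re (g u))} /\ {for t, continuous (fun u => Im (g u))}.
Proof.
by move=> [[g1 _] [g2 _]]; split; apply/differentiable_continuous/derivable1_diffP.
Qed.

End Curves.

(** * Integrals over adjacent intervals *)

Section RealIntegrals.
Context {R : realType}.
Local Notation mu := (@lebesgue_measure R).
Implicit Types (a b c : R) (f g : R -> R).

(** The end points are negligible.  This is how the velocity of a piecewise C^1
curve is replaced on each piece by that of a C^1 curve: at the break points
the two may differ. *)
Lemma integrable_itv_eq_oo a b f g : {in `]a, b[, f =1 g} ->
  mu.-integrable `[a, b] (EFin \o g) ->
  mu.-integrable `[a, b] (EFin \o f) /\
  \int[mu]_(t in `[a, b]) f t = \int[mu]_(t in `[a, b]) g t.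
Proof.
move=> fg ig.
have mg : measurable_fun `]a, b[ g.
  apply: measurable_funS (measurable_itv `[a, b]) _ _.
    exact: subset_itv_oo_cc.
  by apply/measurable_EFinP; exact: (measurable_int mu).
have mf : measurable_fun `]a, b[ f.
  by apply: eq_measurable_fun mg => x; rewrite inE /= => xab; rewrite fg.
split; last by congr fine; exact: eq_integral_itv_bounded.
apply/integrableP; split.
  by apply/measurable_EFinP; exact: measurable_fun_itv_cc mf.
have /integrableP[_] := ig; congr (_ < _)%E.
apply: (@eq_integral_itv_bounded _ _ _ (fun x => `|f x|) (fun x => `|g x|)).
- exact: measurableT_comp.
- exact: measurableT_comp.
- by move=> x xab /=; rewrite fg.
Qed.

Lemma integrable_itv_cat a b c f : a <= b -> b <= c ->
  mu.-integrable `[a, b] (EFin \o f) -> mu.-integrable `[b, c] (EFin \o f) ->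
  mu.-integrable `[a, c] (EFin \o f) /\
  \int[mu]_(t in `[a, c]) f t
    = \int[mu]_(t in `[a, b]) f t + \int[mu]_(t in `[b, c]) f t.
Proof.
move=> ab bc i1 i2.
have i2' : mu.-integrable `]b, c] (EFin \o f).
  by apply: integrableS i2 => //; exact: subset_itv_oc_cc.
have acE : `[a, c]%classic = `[a, b] `|` `]b, c] :> set R.
  by rewrite -itv_bndbnd_setU ?bnd_simp.
have disj : [disjoint `[a, b]%classic & `]b, c]%classic].
  apply/disj_setPS => y [/=]; rewrite 2!in_itv/= => /andP[_ yx] /andP[].
  by rewrite ltNge yx.
have [/integrableP[m1 f1] /integrableP[m2 f2]] := (i1, i2').
have iac : mu.-integrable `[a, c] (EFin \o f).
  have mac : measurable_fun `[a, c] (EFin \o f).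
    by rewrite acE; apply/measurable_funU.
  apply/integrableP; split=> //.
  rewrite acE ge0_integral_setU//; first exact: lte_add_pinfty.
  by rewrite -acE; exact: measurableT_comp.
split=> //; rewrite acE Rintegral_setU -?acE//.
by rewrite (@Rintegral_itv_obnd_cbnd _ b (BRight c)).
Qed.

End RealIntegrals.

(** * Differentiability along curves *)

Section Holo.
Context {R : realType}.
Implicit Types (g h : R -> R[i]) (t : R) (z w d : R[i]) (U : set R[i]).
Implicit Types (f : R[i] -> R[i]).
Local Notation Re := complex.Re.
Local Notation Im := complex.Im.

(** Complex differentiability with derivative f', tested along curves: the chain
rule holds for every differentiable curve at the points where it is in U.
In this form it is stable under composition and is exactly what integration
along a contour uses. *)
Definition holo U f f' : Prop := forall g t d, U (g t) -> cderiv g t d ->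
  cderiv (fun u => f (g u)) t (f' (g t) * d).

Lemma holo_eq U f f1 f2 : holo U f f1 -> (forall z, U z -> f1 z = f2 z) -> holo U f f2.
Proof. by move=> H e g t d Ug gd; rewrite -e//; exact: H. Qed.

Lemma holo_sub U U' f f1 : holo U f f1 -> (forall z, U' z -> U z) -> holo U' f f1.
Proof. by move=> H s g t d /s; exact: H. Qed.

Lemma holo_cst U z : holo U (cst z) (cst 0).
Proof. by move=> g t d _ _; rewrite mul0r; exact: cderiv_cst. Qed.

Lemma holo_id U : holo U id (cst 1).
Proof. by move=> g t d _; rewrite mul1r. Qed.

Lemma holoD U f1 f2 f1' f2' : holo U f1 f1' -> holo U f2 f2' ->
  holo U (fun z => f1 z + f2 z) (fun z => f1' z + f2' z).
Proof.
by move=> H1 H2 g t d Ug gd; rewrite mulrDl; apply: cderivD; [exact: H1|exact: H2].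
Qed.

Lemma holoM U f1 f2 f1' f2' : holo U f1 f1' -> holo U f2 f2' ->
  holo U (fun z => f1 z * f2 z) (fun z => f1' z * f2 z + f1 z * f2' z).
Proof.
move=> H1 H2 g t d Ug gd.
apply: cderiv_eq (cderivM (H1 _ _ _ Ug gd) (H2 _ _ _ Ug gd)) _; ring.
Qed.

Lemma holoZ U (c : R[i]) f f1 : holo U f f1 -> holo U (fun z => c * f z) (fun z => c * f1 z).
Proof.
move=> H; apply: holo_eq (holoM (@holo_cst U c) H) _ => z _.
by rewrite mul0r add0r.
Qed.

Lemma holoV U f f1 : (forall z, U z -> f z != 0) -> holo U f f1 ->
  holo U (fun z => (f z)^-1) (fun z => - f1 z / f z ^+ 2).
Proof.
move=> f0 H g t d Ug gd.
by apply: cderiv_eq (cderivV (f0 _ Ug) (H _ _ _ Ug gd)) _; rewrite !mulNr mulrAC.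
Qed.

Lemma holo_poly U (p : {poly R[i]}) : holo U (horner p) (horner p^`()).
Proof.
elim/poly_ind: p => [|p c IH].
  rewrite deriv0 => g t d Ug gd; rewrite horner0 mul0r.
  by under [X in cderiv X]eq_fun do rewrite horner0; exact: cderiv_cst.
move=> g t d Ug gd.
have := holoD (holoM IH (@holo_id U)) (@holo_cst U c) Ug gd.
rewrite derivMXaddC.
under eq_fun do rewrite -hornerMXaddC.
by move/cderiv_eq; apply; rewrite !hornerE /=; ring.
Qed.

Lemma holo_exprV U k : (forall z, U z -> z != 0) ->
  holo U (fun z => (z ^+ k)^-1) (fun z => - k%:R * (z ^+ k.+1)^-1).
Proof.
move=> U0.
have h : holo U (fun z => z ^+ k) (fun z => k%:R * z ^+ k.-1).
  move=> g t d Ug gd; have := @holo_poly U 'X^k _ _ _ Ug gd.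
  by under eq_fun do rewrite hornerXn; rewrite derivXn hornerMn hornerXn mulr_natl.
have k0 z : U z -> z ^+ k != 0 by move=> Uz; rewrite expf_neq0 ?U0.
apply: holo_eq (holoV k0 h) _ => z Uz.
have z0 := U0 _ Uz.
case: k {h k0} => [|k]; first by rewrite mul0r oppr0 !mul0r.
by rewrite /= -exprM muln2 -addnn exprD !exprS; field; rewrite z0 expf_neq0.
Qed.

End Holo.

(** * The fundamental theorem of calculus along piecewise C^1 curves *)

Section Piecewise.
Context {R : realType}.
Implicit Types (g h : R -> R[i]) (t : R) (z w d : R[i]) (U : set R[i]).
Implicit Types (f F : R[i] -> R[i]).
Local Notation Re := complex.Re.
Local Notation Im := complex.Im.
Local Notation mu := (@lebesgue_measure R).

Lemma C1_cderiv h t : C1_curve h -> cderiv h t (velocity h t).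
Proof.
move=> [h1 h2 _ _]; split; rewrite /velocity /= derive1E; exact/derivableP.
Qed.

Lemma velocity_piece g h (a b : R) : {in `[a, b], g =1 h} ->
  {in `]a, b[, velocity g =1 velocity h}.
Proof.
move=> gh t tab.
have ngh : \near t, g t = h t.
  have /near_in_itvoo := tab; apply: filterS => u uab.
  by apply: gh; apply: subset_itv_oo_cc uab.
rewrite /velocity !derive1E; congr (_ +i* _); apply: near_eq_derive => //.
  by apply: filterS ngh => u ->.
by apply: filterS ngh => u ->.
Qed.

(** Integrability is glued over the subdivision and the increments of Phi
telescope. *)
Lemma pieces_integral (s : nat -> R) (n : nat) (phi : R -> R) : s 0%N = 0 ->
  (forall k, (k < n)%N -> s k < s k.+1 /\ mu.-integrable `[s k, s k.+1] (EFin \o phi)) ->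
  forall k, (k <= n)%N ->
  [/\ 0 <= s k, mu.-integrable `[0, s k] (EFin \o phi) &
      forall Phi : R -> R, (forall j, (j < k)%N ->
        \int[mu]_(t in `[s j, s j.+1]) phi t = Phi (s j.+1) - Phi (s j)) ->
      \int[mu]_(t in `[0, s k]) phi t = Phi (s k) - Phi 0].
Proof.
move=> s0 H; elim=> [_|k IH kn].
  rewrite s0 set_itv1; split=> //.
    apply/integrableP; split; first exact: measurable_fun_set1.
    by rewrite integral_set1.
  by move=> Phi _; rewrite Rintegral_set1 subrr.
have [sk0 ik Pk] := IH (ltnW kn); have [sk ik'] := H _ kn.
have [i1 e1] := integrable_itv_cat sk0 (ltW sk) ik ik'.
split=> //; first exact: le_trans sk0 (ltW sk).
move=> Phi HPhi; rewrite e1 (HPhi k)// (Pk Phi); first by rewrite addrC addrA subrK.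
by move=> j jk; apply: HPhi; rewrite ltnS ltnW.
Qed.

Section AlongCurve.
Variables (U : set R[i]) (f f' : R[i] -> R[i]).
Hypothesis holof : holo U f f'.

Lemma piece_continuous h t : C1_curve h -> U (h t) ->
  {for t, continuous (fun u => Re (f (h u) * velocity h u))}.
Proof.
move=> C1h Uh; have hd := C1_cderiv t C1h.
have [c1 c2] := cderiv_continuous (holof Uh hd).
have [_ _ v1 v2] := C1h.
have -> : (fun u => Re (f (h u) * velocity h u)) = (fun u =>
   Re (f (h u)) * derive1 (fun u => Re (h u)) u
   - Im (f (h u)) * derive1 (fun u => Im (h u)) u).
  by apply/funext => u; rewrite cReM.
apply: cvgB; apply: cvgM => //; [exact: v1|exact: v2].
Qed.

Lemma piece_integral g h (a b : R) : a < b -> C1_curve h -> {in `[a, b], g =1 h} ->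
  (forall t, t \in `[a, b] -> U (g t)) ->
  mu.-integrable `[a, b] (EFin \o (fun t => Re (f (g t) * velocity g t))) /\
  forall F, holo U F f ->
  \int[mu]_(t in `[a, b]) Re (f (g t) * velocity g t) = Re (F (g b)) - Re (F (g a)).
Proof.
move=> ab C1h gh Ug.
pose phi u := Re (f (h u) * velocity h u).
have Uh t : t \in `[a, b] -> U (h t) by move=> tab; rewrite -gh//; exact: Ug.
have cphi : {within `[a, b], continuous phi}.
  apply: continuous_in_subspaceT => t; rewrite inE => tab.
  by apply: piece_continuous => //; exact: Uh.
have iphi : mu.-integrable `[a, b] (EFin \o phi).
  by apply: continuous_compact_integrable => //; exact: segment_compact.
have e : {in `]a, b[, (fun t => Re (f (g t) * velocity g t)) =1 phi}.
  move=> t tab /=; rewrite /phi (velocity_piece gh tab) gh//.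
  exact: subset_itv_oo_cc tab.
have [i1 e1] := integrable_itv_eq_oo e iphi.
split; first exact: i1.
move=> F HF.
have dF t : t \in `[a, b] -> is_derive t 1 (fun u => Re (F (h u))) (phi t).
  by move=> tab; have [] := HF _ _ _ (Uh _ tab) (C1_cderiv t C1h).
have cF t : t \in `[a, b] -> {for t, continuous (fun u => Re (F (h u)))}.
  by move=> /dF[d _]; apply/differentiable_continuous/derivable1_diffP.
have aab : a \in `[a, b] by rewrite in_itv /= lexx ltW.
have bab : b \in `[a, b] by rewrite in_itv /= lexx ltW.
rewrite e1 /Rintegral (continuous_FTC2 ab cphi (F := fun u => Re (F (h u)))).
- by rewrite /= !gh.
- split.
  + by move=> t tab; have [] := dF _ (subset_itv_oo_cc tab).
  + exact/cvg_at_right_filter/cF.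
  + exact/cvg_at_left_filter/cF.
- move=> t tab; have [d e2] := dF _ (subset_itv_oo_cc tab).
  by rewrite derive1E.
Qed.

(** On a closed piece the integrand agrees, up to the end points, with a continuous
function, and the fundamental theorem applies.  Only real parts are treated:
the imaginary part of f is the real part of - i f. *)
Lemma pw_integral_Re g : piecewise_C1 g -> (forall t, t \in `[0, 1] -> U (g t)) ->
  mu.-integrable `[0, 1] (EFin \o (fun t => Re (f (g t) * velocity g t))) /\
  forall F, holo U F f ->
  \int[mu]_(t in `[0, 1]) Re (f (g t) * velocity g t) = Re (F (g 1)) - Re (F (g 0)).
Proof.
move=> [n [s [s0 s1 H]]] Ug.
have mono j k : (k + j <= n)%N -> s k <= s (k + j)%N.
  elim: j => [|j IH]; first by rewrite addn0.
  rewrite addnS => kn; have [sk _] := H _ kn.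
  by rewrite (le_trans (IH (ltnW kn)))// ltW.
have P k : (k < n)%N -> s k < s k.+1 /\
    (mu.-integrable `[s k, s k.+1] (EFin \o (fun t => Re (f (g t) * velocity g t))) /\
    forall F, holo U F f ->
    \int[mu]_(t in `[s k, s k.+1]) Re (f (g t) * velocity g t)
      = Re (F (g (s k.+1))) - Re (F (g (s k)))).
  move=> kn; have [sk [h C1h gh]] := H _ kn; split=> //.
  apply: piece_integral gh _ => // t; rewrite !in_itv /= => /andP[t1 t2].
  apply: Ug; rewrite in_itv /=; apply/andP; split.
    by rewrite -s0 (le_trans _ t1)//; apply: (mono k 0%N); exact: ltnW.
  rewrite -s1 (le_trans t2)//.
  by have := mono (n - k.+1)%N k.+1; rewrite subnKC//; exact.
have Pi k : (k < n)%N -> s k < s k.+1 /\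
    mu.-integrable `[s k, s k.+1] (EFin \o (fun t => Re (f (g t) * velocity g t))).
  by move=> kn; have [? []] := P _ kn.
have [_ i1 e1] := pieces_integral s0 Pi (leqnn n).
rewrite s1 in i1 e1; split; first exact: i1.
move=> F HF.
rewrite (e1 (fun t => Re (F (g t))))// => j jn.
by have [_ [_ /(_ F HF)]] := P _ jn.
Qed.

End AlongCurve.

(** Each piece is compact.  The hypothesis on B is stated along curves because the
curve is only known to be C^1 on the pieces. *)
Lemma pw_bounded U g (B : R[i] -> R) : piecewise_C1 g ->
  (forall t, t \in `[0, 1] -> U (g t)) ->
  (forall h t d, U (h t) -> cderiv h t d -> {for t, continuous (fun u => B (h u))}) ->
  exists C, forall t, t \in `[0, 1] -> B (g t) <= C.
Proof.
move=> [n [s [s0 s1 H]]] Ug cB.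
have mono j k : (k + j <= n)%N -> s k <= s (k + j)%N.
  elim: j => [|j IH]; first by rewrite addn0.
  rewrite addnS => kn; have [sk _] := H _ kn.
  by rewrite (le_trans (IH (ltnW kn)))// ltW.
suff P k : (k <= n)%N -> exists C, forall t, t \in `[0, s k] -> B (g t) <= C.
  by have := P n (leqnn n); rewrite s1.
elim: k => [_|k IH kn].
  exists (B (g 0)) => t; rewrite s0 in_itv /= => t0.
  by rewrite (_ : t = 0)//; apply/eqP; rewrite eq_le andbC.
have [C HC] := IH (ltnW kn); have [sk [h C1h gh]] := H _ kn.
have [] := @EVT_max R (fun u => B (h u)) _ _ (ltW sk).
  apply: continuous_in_subspaceT => t; rewrite inE => tab.
  apply: cB (C1_cderiv t C1h); rewrite -gh//; apply: Ug.
  move: tab; rewrite /= !in_itv /= => /andP[t1 t2]; apply/andP; split.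
    by rewrite -s0 (le_trans _ t1)//; apply: (mono k 0%N); exact: ltnW.
  rewrite -s1 (le_trans t2)//.
  by have := mono (n - k.+1)%N k.+1; rewrite subnKC//; exact.
move=> c cab Hc; exists (Num.max C (B (h c))) => t; rewrite in_itv /= => /andP[t1 t2].
rewrite le_max; have [tk|/ltW tk] := leP t (s k).
  by rewrite HC// in_itv /= t1.
by rewrite gh ?Hc ?orbT// in_itv /= tk.
Qed.

End Piecewise.

(** * Contour integrals as linear functionals *)

Section Oint.
Context {R : realType}.
Implicit Types (g h : R -> R[i]) (t : R) (z w d : R[i]) (U : set R[i]).
Implicit Types (f F : R[i] -> R[i]).
Local Notation Re := complex.Re.
Local Notation Im := complex.Im.
Local Notation mu := (@lebesgue_measure R).

Definition integrable_on g f : Prop :=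
  mu.-integrable `[0, 1] (EFin \o (fun t => Re (f (g t) * velocity g t))) /\
  mu.-integrable `[0, 1] (EFin \o (fun t => Im (f (g t) * velocity g t))).

Lemma mul_mi_Re z : Re ((0 -i* 1) * z) = Im z.
Proof. by rewrite cReM /= mul0r sub0r mulN1r opprK. Qed.

Lemma oint_eq g f1 f2 : (forall t, t \in `[0, 1] -> f1 (g t) = f2 (g t)) ->
  oint g f1 = oint g f2.
Proof.
move=> e; rewrite /oint /cintegral; congr ((_ +i* _) / _); apply: eq_Rintegral => t.
  by rewrite inE /= => t01; rewrite e.
by rewrite inE /= => t01; rewrite e.
Qed.

Lemma integrable_on_eq g f1 f2 : (forall t, t \in `[0, 1] -> f1 (g t) = f2 (g t)) ->
  integrable_on g f1 -> integrable_on g f2.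
Proof.
move=> e [i1 i2]; split.
  by apply: eq_integrable i1 => // t; rewrite inE /= => t01; rewrite e.
by apply: eq_integrable i2 => // t; rewrite inE /= => t01; rewrite e.
Qed.

Lemma integrable_onD g f1 f2 : integrable_on g f1 -> integrable_on g f2 ->
  integrable_on g (fun z => f1 z + f2 z).
Proof.
move=> [i1 i2] [j1 j2]; split.
  apply: eq_integrable (integrableD _ i1 j1) => // t _.
  by rewrite /= -EFinD mulrDl cReD.
apply: eq_integrable (integrableD _ i2 j2) => // t _.
by rewrite /= -EFinD mulrDl cImD.
Qed.

Lemma ointD g f1 f2 : integrable_on g f1 -> integrable_on g f2 ->
  oint g (fun z => f1 z + f2 z) = oint g f1 + oint g f2.
Proof.
move=> [i1 i2] [j1 j2]; rewrite /oint -mulrDl; congr (_ / _).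
rewrite /cintegral.
transitivity ((\int[mu]_(t in `[0, 1]) (Re (f1 (g t) * velocity g t) + Re (f2 (g t) * velocity g t)))
  +i* (\int[mu]_(t in `[0, 1]) (Im (f1 (g t) * velocity g t) + Im (f2 (g t) * velocity g t)))).
  by congr (_ +i* _); apply: eq_Rintegral => t _; rewrite mulrDl ?cReD ?cImD.
by rewrite !RintegralD.
Qed.

Lemma integrable_onZ g f (c : R[i]) : integrable_on g f ->
  integrable_on g (fun z => c * f z).
Proof.
move=> [i1 i2]; split.
  apply: eq_integrable (integrableD _ (integrableZl _ (Re c) i1)
    (integrableZl _ (- Im c) i2)) => // t _.
  by rewrite /= -!EFinM -EFinD -mulrA [in RHS]cReM mulNr.
apply: eq_integrable (integrableD _ (integrableZl _ (Re c) i2)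
    (integrableZl _ (Im c) i1)) => // t _.
by rewrite /= -!EFinM -EFinD -mulrA [in RHS]cImM.
Qed.

Lemma ointZ g f (c : R[i]) : integrable_on g f ->
  oint g (fun z => c * f z) = c * oint g f.
Proof.
move=> [i1 i2]; rewrite /oint mulrA; congr (_ / _).
rewrite /cintegral.
set f1 := fun t => Re (f (g t) * velocity g t) in i1 *.
set f2 := fun t => Im (f (g t) * velocity g t) in i2 *.
transitivity ((\int[mu]_(t in `[0, 1]) (Re c * f1 t + - Im c * f2 t))
  +i* (\int[mu]_(t in `[0, 1]) (Re c * f2 t + Im c * f1 t))).
  congr (_ +i* _); apply: eq_Rintegral => t _.
    by rewrite -mulrA [in LHS]cReM mulNr.
  by rewrite -mulrA [in LHS]cImM.
have k1 r (k : R -> R) : mu.-integrable `[0, 1] (EFin \o k) ->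
    mu.-integrable `[0, 1] (EFin \o (fun t => r * k t)).
  by move=> ik; apply: eq_integrable (integrableZl _ r ik) => // t _.
rewrite !RintegralD//; [|by apply: k1..].
rewrite !RintegralZl//.
by apply: complex_ext; rewrite ?cReM ?cImM /= ?mulNr.
Qed.

Lemma integrable_on_sum g (I : Type) (r : seq I) (P : pred I) (f : I -> R[i] -> R[i]) :
  integrable_on g (fun=> 0) ->
  (forall i, P i -> integrable_on g (f i)) ->
  integrable_on g (fun z => \sum_(i <- r | P i) f i z).
Proof.
move=> i0 H; elim: r => [|i r IH].
  by apply: integrable_on_eq i0 => t _; rewrite big_nil.
have [Pi|nPi] := boolP (P i).
  by apply: integrable_on_eq (integrable_onD (H _ Pi) IH) => t _; rewrite big_cons Pi.
by apply: integrable_on_eq IH => t _; rewrite big_cons (negbTE nPi).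
Qed.

Lemma oint0 g : oint g (fun=> 0) = 0.
Proof.
rewrite /oint /cintegral.
under [X in X +i* _]eq_Rintegral do rewrite mul0r.
under [X in _ +i* X]eq_Rintegral do rewrite mul0r.
rewrite !Rintegral_cst//= !mul0r.
by [].
Qed.

Lemma oint_sum g (I : Type) (r : seq I) (P : pred I) (f : I -> R[i] -> R[i]) :
  integrable_on g (fun=> 0) ->
  (forall i, P i -> integrable_on g (f i)) ->
  oint g (fun z => \sum_(i <- r | P i) f i z) = \sum_(i <- r | P i) oint g (f i).
Proof.
move=> i0 H; elim: r => [|i r IH].
  by rewrite big_nil -[RHS](oint0 g); apply: oint_eq => t _; rewrite big_nil.
rewrite big_cons; have [Pi|nPi] := boolP (P i); rewrite -IH.
  rewrite -ointD; [|exact: H|exact: integrable_on_sum].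
  by apply: oint_eq => t _; rewrite big_cons Pi.
by apply: oint_eq => t _; rewrite big_cons (negbTE nPi).
Qed.

Lemma holo_integrable_on U f f' g : holo U f f' -> piecewise_C1 g ->
  (forall t, t \in `[0, 1] -> U (g t)) -> integrable_on g f.
Proof.
move=> hf pg Ug; split; first by have [] := pw_integral_Re hf pg Ug.
have [i _] := pw_integral_Re (holoZ (0 -i* 1) hf) pg Ug.
apply: eq_integrable i => // t _ /=.
by rewrite -mulrA mul_mi_Re.
Qed.

(** The values of the primitive at the two end points cancel. *)
Lemma oint_primitive U F f f' g : holo U F f -> holo U f f' -> piecewise_C1 g ->
  g 0 = g 1 -> (forall t, t \in `[0, 1] -> U (g t)) -> oint g f = 0.
Proof.
move=> hF hf pg g01 Ug; rewrite /oint /cintegral.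
have [_ /(_ F hF) ->] := pw_integral_Re hf pg Ug.
have [_ /(_ _ (holoZ (0 -i* 1) hF)) e] := pw_integral_Re (holoZ (0 -i* 1) hf) pg Ug.
have -> : \int[mu]_(t in `[0, 1]) Im (f (g t) * velocity g t) = 0.
  rewrite -[RHS](subrr (Re ((0 -i* 1) * F (g 0)))) {1}g01 -e.
  by apply: eq_Rintegral => t _; rewrite -mulrA mul_mi_Re.
by rewrite g01 subrr; exact: mul0r.
Qed.

End Oint.

(** * The inner integral *)

Section Inner.
Context {R : realType}.
Variable g : R -> R[i].
Hypothesis pg : piecewise_C1 g.
Hypothesis g01 : g 0 = g 1.
Implicit Types (z w : R[i]) (p : {poly R[i]}).

Lemma integrable_on_poly p : integrable_on g (horner p).
Proof. exact: (holo_integrable_on (@holo_poly _ setT p) pg). Qed.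

Lemma integrable_on_0 : integrable_on g (fun=> 0).
Proof. by apply: integrable_on_eq (integrable_on_poly 0) => t _; rewrite horner0. Qed.

Lemma poly_antiderivative p : {q : {poly R[i]} | q^`() = p}.
Proof.
exists (\poly_(i < (size p).+1) (p`_i.-1 / i%:R)).
apply/polyP => i; rewrite coef_deriv coef_poly ltnS /=.
have [ip|pi] := ltnP i (size p); last by rewrite mul0rn nth_default.
by rewrite -[LHS]mulr_natr divfK// pnatr_eq0.
Qed.

Lemma oint_poly p : oint g (horner p) = 0.
Proof.
have [q <-] := poly_antiderivative p.
by apply: (oint_primitive (@holo_poly _ setT q) (@holo_poly _ setT _) pg g01).
Qed.

Lemma oint_exprV k : (forall t, t \in `[0, 1] -> g t != 0) ->
  oint g (fun w => (w ^+ k.+2)^-1) = 0.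
Proof.
move=> g0; pose U := [set w : R[i] | w != 0].
have h1 : holo U (fun w => - (k.+1%:R)^-1 * (w ^+ k.+1)^-1) (fun w => (w ^+ k.+2)^-1).
  apply: holo_eq (holoZ _ (holo_exprV k.+1 _)) _ => // z _.
  by rewrite mulrA mulrNN mulVf ?mul1r// pnatr_eq0.
exact: (oint_primitive h1 (holo_exprV k.+2 (U := U) (fun z H => H)) pg g01).
Qed.

Lemma integrable_on_polyV p : (forall t, t \in `[0, 1] -> p.[g t] != 0) ->
  integrable_on g (fun w => (p.[w])^-1).
Proof.
move=> gp; pose U := [set w : R[i] | p.[w] != 0].
have /holo_integrable_on : holo U (fun w => (p.[w])^-1) (fun w => - (p^`()).[w] / p.[w] ^+ 2).
  by apply: holoV => //; exact: holo_poly.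
by apply.
Qed.

Section Pole.
Variable z : R[i].
Hypotheses (z0 : z != 0) (ez : encloses g z) (e0 : encloses g 0).

Let gz t : t \in `[0, 1] -> g t - z != 0.
Proof. by move=> t01; rewrite subr_eq0; have [/(_ t t01)] := ez. Qed.

Let g0 t : t \in `[0, 1] -> g t != 0.
Proof. by have [+ _] := e0; exact. Qed.

Lemma integrable_on_pole k : integrable_on g (fun w => (w ^+ k * (w - z))^-1).
Proof.
have := @integrable_on_polyV ('X^k * ('X - z%:P)).
move=> /(_ _)/integrable_on_eq; apply => [t t01|t t01]; rewrite !hornerE //=.
by rewrite mulf_neq0 ?expf_neq0 ?gz ?g0.
Qed.

(** For k > 0 the residues at z and at 0 cancel.  The induction rests on
1 / (w^(k+1) (w - z)) = (1 / z) (1 / (w^k (w - z)) - 1 / w^(k+1)),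
where the last term has a primitive unless k = 0; in that case its integral is
the winding number around 0. *)
Lemma oint_pole k : oint g (fun w => (w ^+ k * (w - z))^-1) = (k == 0%N)%:R.
Proof.
have iV j : integrable_on g (fun w => (w ^+ j)^-1).
  have := @integrable_on_polyV 'X^j.
  move=> /(_ _)/integrable_on_eq; apply => [t t01|t t01]; rewrite !hornerE //=.
  by rewrite expf_neq0 ?g0.
have step j : oint g (fun w => (w ^+ j.+1 * (w - z))^-1) =
   z^-1 * (oint g (fun w => (w ^+ j * (w - z))^-1) - oint g (fun w => (w ^+ j.+1)^-1)).
  rewrite -[- oint _ _]mulN1r -(ointZ (-1) (iV _)) -ointD; last first.
  - exact: integrable_onZ.
  - exact: integrable_on_pole.
  rewrite -ointZ; last by apply: integrable_onD (integrable_on_pole j) (integrable_onZ _ (iV _)).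
  apply: oint_eq => t t01; have := gz t01; have := g0 t01 => h1 h2.
  by rewrite exprS; field; rewrite h1 h2 z0 expf_neq0.
have W0 : oint g (fun w => (w ^+ 0 * (w - z))^-1) = 1.
  have [_ <-] := ez; apply: oint_eq => t _; by rewrite expr0 mul1r.
elim: k => [|k IH]; first by rewrite W0.
rewrite step; case: k IH => [|k] ->.
  have -> : oint g (fun w => (w ^+ 1)^-1) = 1.
    by have [_ <-] := e0; apply: oint_eq => t _; rewrite expr1 subr0.
  by rewrite subrr mulr0.
by rewrite oint_exprV ?subr0 ?mulr0.
Qed.

(** The quotient p / w^c is the polynomial drop_poly c p plus negative powers of
w.  The negative powers contribute nothing by oint_pole.  A polynomial h
contributes h(z): the quotient (h(w) - h(z)) / (w - z) is a polynomial, and the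
winding number around z is 1. *)
Lemma oint_drop_poly p c :
  oint g (fun w => p.[w] / (w ^+ c * (w - z))) = (drop_poly c p).[z].
Proof.
set q := drop_poly c p.
have [h qE] : exists h : {poly R[i]}, q = q.[z]%:P + h * ('X - z%:P).
  have /factor_theorem [h hE] : root (q - q.[z]%:P) z by rewrite rootE !hornerE subrr.
  by exists h; rewrite -hE addrC subrK.
transitivity (oint g (fun w => (q.[z] * (w ^+ 0 * (w - z))^-1 + h.[w]) +
    \sum_(j < c) p`_j * (w ^+ (c - j) * (w - z))^-1)).
  apply: oint_eq => t t01; have h1 := g0 t01; have h2 := gz t01.
  rewrite -{1}(poly_take_drop c p) -/q hornerD hornerM hornerXn mulrDl addrC.
  congr (_ + _).
    rewrite invfM mulrA mulfK ?expf_neq0// {1}qE !hornerE ?expr0 ?mul1r.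
    by rewrite mulrDl mulfK.
  rewrite /take_poly horner_poly mulr_suml; apply: eq_bigr => j _.
  rewrite -mulrA; congr (_ * _); rewrite !invfM mulrA; congr (_ / _).
  have -> : g t ^+ c = g t ^+ (c - j) * g t ^+ j by rewrite -exprD subnK// ltnW.
  by rewrite invfM mulrCA mulfV ?mulr1// expf_neq0.
rewrite ointD.
- rewrite ointD; last exact: integrable_on_poly.
  + rewrite oint_poly addr0 ointZ ?oint_pole ?mulr1; last exact: integrable_on_pole.
    rewrite oint_sum; first last.
    * by move=> i _; apply: integrable_onZ; exact: integrable_on_pole.
    * exact: integrable_on_0.
    rewrite big1 ?addr0// => i _; rewrite ointZ; last exact: integrable_on_pole.
    by rewrite oint_pole subn_eq0 leqNgt ltn_ord mulr0.
  + by apply: integrable_onZ; exact: integrable_on_pole.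
- apply: integrable_onD; last exact: integrable_on_poly.
  by apply: integrable_onZ; exact: integrable_on_pole.
- apply: integrable_on_sum; first exact: integrable_on_0.
  by move=> i _; apply: integrable_onZ; exact: integrable_on_pole.
Qed.

End Pole.
End Inner.

(** * The logarithm and powers on the slit plane *)

Section Log.
Context {R : realType}.
Implicit Types (g h : R -> R[i]) (t : R) (z w d b : R[i]) (U : set R[i]).
Local Notation Re := complex.Re.
Local Notation Im := complex.Im.

Lemma cexpD z w : cexp (z + w) = cexp z * cexp w.
Proof.
apply: complex_ext; rewrite ?cReM ?cImM /= cReD cImD expRD ?cosD ?sinD; ring.
Qed.

Lemma cexp0 : cexp (0 : R[i]) = 1.
Proof. by rewrite /cexp /= expR0 cos0 sin0 mul1r mulr0. Qed.

Lemma cexp_neq0 z : cexp z != 0.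
Proof.
apply/eqP => e; have := cexpD z (- z); rewrite subrr cexp0 e mul0r.
by move/eqP; rewrite oner_eq0.
Qed.

Lemma cexpN z : cexp (- z) = (cexp z)^-1.
Proof.
by apply: (mulfI (cexp_neq0 z)); rewrite -cexpD subrr cexp0 divff// cexp_neq0.
Qed.

Lemma cexpMn z n : cexp (n%:R * z) = cexp z ^+ n.
Proof.
elim: n => [|n IH]; first by rewrite mul0r cexp0.
by rewrite exprS -IH -cexpD -nat1r mulrDl mul1r.
Qed.

Lemma cderiv_cexp g t d : cderiv g t d ->
  cderiv (fun u => cexp (g u)) t (cexp (g t) * d).
Proof.
move=> [g1 g2]; split; rewrite /cexp /=.
  apply: is_derive_eq.
  by rewrite cReM /= /GRing.scale /=; ring.
apply: is_derive_eq.
by rewrite cImM /= /GRing.scale /=; ring.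
Qed.

Lemma holo_cexp U b : holo U (fun z => cexp (b * z)) (fun z => b * cexp (b * z)).
Proof.
move=> g t d _ gd; apply: cderiv_eq (cderiv_cexp (cderivM (cderiv_cst b t) gd)) _.
by rewrite mul0r add0r /=; ring.
Qed.

Lemma cmod_ge0 z : 0 <= cmod z.
Proof. exact: sqrtr_ge0. Qed.

Lemma cmod_sq z : cmod z ^+ 2 = Re z ^+ 2 + Im z ^+ 2.
Proof. by rewrite sqr_sqrtr// addr_ge0 ?sqr_ge0. Qed.

Lemma cmod_normr_Re z : `|Re z| <= cmod z.
Proof. by rewrite -sqrtr_sqr ler_wsqrtr// lerDl sqr_ge0. Qed.

Lemma cmod_gt0 z : z != 0 -> 0 < cmod z.
Proof. by move=> /sqnorm_gt0 z0; rewrite sqrtr_gt0. Qed.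

Lemma slit_gt0 z : in_slit_plane z -> 0 < cmod z + Re z.
Proof.
move=> sz; have := cmod_normr_Re z; rewrite ler_norml => /andP[h _].
rewrite lt_neqAle; apply/andP; split; last by rewrite -lerBlDr sub0r lerNl.
apply/eqP => e; apply: sz; have rE : cmod z = - Re z by lra.
have := cmod_sq z; rewrite rE sqrrN -{1}[_ ^+ 2]addr0 => /addrI/esym/eqP.
rewrite sqrf_eq0 => /eqP ->; split=> //.
by rewrite -oppr_ge0 -rE cmod_ge0.
Qed.

Lemma slit_neq0 z : in_slit_plane z -> z != 0.
Proof. by move=> sz; apply/eqP => z0; apply: sz; rewrite z0. Qed.

Lemma slit_pos (x : R) : 0 < x -> in_slit_plane x%:C.
Proof. by move=> x0 [_] /=; rewrite leNgt x0. Qed.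

Lemma cos_2atan (T : R) : cos (2 * atan T) = (1 - T ^+ 2) / (1 + T ^+ 2).
Proof.
rewrite mulr_natl cos_mulr2n cos_atan exprVn sqr_sqrtr ?addr_ge0 ?sqr_ge0//.
have : 1 + T ^+ 2 != 0 by rewrite gt_eqF// ltr_wpDr ?sqr_ge0.
by move=> H; rewrite -mulr_natl; field.
Qed.

Lemma sin_2atan (T : R) : sin (2 * atan T) = 2 * T / (1 + T ^+ 2).
Proof.
have T0 : 1 + T ^+ 2 != 0 by rewrite gt_eqF// ltr_wpDr ?sqr_ge0.
have c0 : cos (atan T) != 0.
  by rewrite cos_atan invr_eq0 gt_eqF// sqrtr_gt0 ltr_wpDr ?sqr_ge0.
have sE : sin (atan T) = T * cos (atan T) by rewrite -{2}(atanK T) /tan divfK.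
rewrite mulr_natl sin_mulr2n sE mulrCA -expr2 cos_atan exprVn sqr_sqrtr ?addr_ge0 ?sqr_ge0//.
by rewrite -mulr_natl; field.
Qed.

(** The half-angle formula presents the argument as a single differentiable
function on the whole slit plane, whereas the definition by acos changes branch
across the positive half-line. *)
Lemma carg_atan z : in_slit_plane z -> carg z = 2 * atan (Im z / (cmod z + Re z)).
Proof.
move=> sz; set r := cmod z; set x := Re z; set y := Im z.
have rx := slit_gt0 sz; rewrite -/r -/x in rx.
have r0 : 0 < r := cmod_gt0 (slit_neq0 sz).
have rxy : r ^+ 2 = x ^+ 2 + y ^+ 2 by exact: cmod_sq.
set T := y / (r + x).
have cosE : x / r = cos (2 * atan T).
  rewrite cos_2atan /T.
  have E : 1 + (y / (r + x)) ^+ 2 = 2 * r / (r + x).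
    have -> : (y / (r + x)) ^+ 2 = (r ^+ 2 - x ^+ 2) / (r + x) ^+ 2.
      by rewrite rxy; field; rewrite gt_eqF.
    by field; rewrite gt_eqF.
  rewrite E; have -> : (y / (r + x)) ^+ 2 = (r ^+ 2 - x ^+ 2) / (r + x) ^+ 2.
      by rewrite rxy; field; rewrite gt_eqF.
  by field; rewrite !gt_eqF.
rewrite /carg -/r -/x -/y cosE.
have b1 := atan_gtNpi2 T; have b2 := atan_ltpi2 T.
case: ifPn => y0.
  apply: cosK; rewrite in_itv /=.
  have : 0 <= atan T by rewrite -atan0 le_atan// divr_ge0// ltW.
  by move=> ?; apply/andP; split; lra.
rewrite cosKN ?opprK//.
have : atan T <= 0.
  by rewrite -atan0 le_atan// pmulr_lle0 ?invr_gt0// ltW// ltNge.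
by move=> ?; apply/andP; split; lra.
Qed.

Lemma cexp_clog z : in_slit_plane z -> cexp (clog z) = z.
Proof.
move=> sz; rewrite /cexp /clog /= carg_atan// lnK ?posrE ?cmod_gt0 ?slit_neq0//.
rewrite cos_2atan sin_2atan.
set r := cmod z; set x := Re z; set y := Im z.
have rx := slit_gt0 sz; rewrite -/r -/x in rx.
have r0 : 0 < r := cmod_gt0 (slit_neq0 sz).
have rxy : r ^+ 2 = x ^+ 2 + y ^+ 2 by exact: cmod_sq.
have E0 : (y / (r + x)) ^+ 2 = (r ^+ 2 - x ^+ 2) / (r + x) ^+ 2.
  by rewrite rxy; field; rewrite gt_eqF.
rewrite E0; have -> : 1 + (r ^+ 2 - x ^+ 2) / (r + x) ^+ 2 = 2 * r / (r + x).
  by field; rewrite gt_eqF.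
by apply: complex_ext => /=; field; rewrite !gt_eqF.
Qed.

Lemma clog_pos (x : R) : 0 < x -> clog x%:C = (ln x)%:C.
Proof.
move=> x0; have cx : cmod x%:C = x.
  by rewrite /cmod /= expr0n addr0 sqrtr_sqr gtr0_norm.
by rewrite /clog /carg cx /= lexx divff ?gt_eqF// acos1.
Qed.

Lemma cderiv_clog g t d : in_slit_plane (g t) -> cderiv g t d ->
  cderiv (fun u => clog (g u)) t (d / g t).
Proof.
move=> sg gd; have [c1 c2] := cderiv_continuous gd; have [g1 g2] := gd.
pose D u := Re (g u) ^+ 2 + Im (g u) ^+ 2.
have D0 : 0 < D t by exact: sqnorm_gt0 (slit_neq0 sg).
have dD : is_derive t 1 D (2 * (Re (g t) * Re d + Im (g t) * Im d)).
  by rewrite /D; apply: is_derive_eq; rewrite /GRing.scale /=; ring.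
have dr : is_derive t 1 (fun u => cmod (g u))
    ((Re (g t) * Re d + Im (g t) * Im d) / cmod (g t)).
  have := @is_derive1_comp _ Num.sqrt D t _ _ (is_derive1_sqrt D0) dD.
  move/is_derive_eq; apply; rewrite -/(cmod (g t)) /GRing.scale /=.
  by rewrite /D -/(cmod _); field; rewrite gt_eqF// cmod_gt0// slit_neq0.
set r := cmod (g t); set x := Re (g t); set y := Im (g t).
have rx := slit_gt0 sg; rewrite -/r -/x in rx.
have r0 : 0 < r := cmod_gt0 (slit_neq0 sg).
have rxy : r ^+ 2 = x ^+ 2 + y ^+ 2 by exact: cmod_sq.
split; rewrite /clog /=.
  have := @is_derive1_comp _ (@ln R) (fun u => cmod (g u)) t _ _ (is_derive1_ln r0) dr.
  move/is_derive_eq; apply; rewrite cReM cReV cImV -/x -/y -/r -rxy.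
  by field; rewrite gt_eqF.
pose A u := cmod (g u) + Re (g u).
have dA := is_deriveD dr g1.
have A0 : A t != 0 by rewrite gt_eqF.
have dT := is_deriveM g2 (@is_deriveV _ A _ _ _ A0 dA).
have dat := @is_derive1_comp _ (@atan R) _ t _ _ (is_derive1_atan _) dT.
have d2 := is_deriveZ 2 dat.
apply: (@near_eq_is_derive _ _ _ (fun u => 2 * atan (Im (g u) / A u))); last first.
  move: d2 => /is_derive_eq; apply.
  rewrite /A cImM cReV cImV -/x -/y -/r -rxy /GRing.scale /=.
  rewrite (_ : 1 + _ = 2 * r / (r + x)); last first.
    change (1 + (y / (r + x)) ^+ 2 = 2 * r / (r + x)).
    have -> : (y / (r + x)) ^+ 2 = (r ^+ 2 - x ^+ 2) / (r + x) ^+ 2.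
      by rewrite rxy; field; rewrite gt_eqF.
    by field; rewrite gt_eqF.
  (* The two sides differ by a multiple of r^2 - (x^2 + y^2). *)
  transitivity (Re d * (- y / r ^+ 2) + Im d * (x / r ^+ 2)
    + Im d * (r ^+ 2 - (x ^+ 2 + y ^+ 2)) / (r ^+ 2 * (r + x))).
    by field; rewrite !gt_eqF.
  by rewrite rxy subrr mulr0 mul0r addr0.
have cA : {for t, continuous A}.
  by have [dA' _] := dA; apply/differentiable_continuous/derivable1_diffP.
have : \forall u \near t, 0 < A u by exact: (cvgr_gt (A t) cA).
apply: filterS => u Au; rewrite carg_atan// => -[i0 r0'].
move: Au; rewrite /A /cmod i0 expr0n addr0 sqrtr_sqr ler0_norm//.
by rewrite addNr ltxx.
Qed.

Lemma holo_clog : holo in_slit_plane clog (fun z => z^-1).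
Proof.
by move=> g t d sg gd; rewrite mulrC; exact: cderiv_clog.
Qed.

Lemma holo_cpow b : holo in_slit_plane (cpow^~ b) (fun z => b * cpow z b / z).
Proof.
move=> g t d sg gd; have := holo_cexp b (U := setT) I (cderiv_clog sg gd).
by move/cderiv_eq; apply; rewrite /cpow; ring.
Qed.

Lemma cpow_pos (x : R) b : 0 < x -> cpow x%:C b = cexp (b * (ln x)%:C).
Proof. by move=> x0; rewrite /cpow clog_pos. Qed.

End Log.

(** * Segments in the slit plane *)

Section Homotopy.
Context {R : realType}.
Implicit Types (g h : R -> R[i]) (t : R) (z w d b c : R[i]).
Local Notation Re := complex.Re.
Local Notation Im := complex.Im.
Local Notation mu := (@lebesgue_measure R).

Lemma cmodM z w : cmod (z * w) = cmod z * cmod w.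
Proof.
rewrite /cmod -sqrtrM ?addr_ge0 ?sqr_ge0//; congr Num.sqrt.
by rewrite cReM cImM; ring.
Qed.

Lemma cmod_real (r : R) : cmod r%:C = `|r|.
Proof. by rewrite /cmod /= expr0n addr0 sqrtr_sqr. Qed.

Lemma cmod_cexp z : cmod (cexp z) = expR (Re z).
Proof.
rewrite /cmod /cexp /= !exprMn -mulrDr cos2Dsin2 mulr1 sqrtr_sqr ger0_norm ?expR_ge0//.
Qed.

Lemma cmodV z : cmod z^-1 = (cmod z)^-1.
Proof.
have [->|z0] := eqVneq z 0.
  by rewrite invr0 /cmod /= expr0n addr0 sqrtr0 invr0.
apply: (mulfI (lt0r_neq0 (cmod_gt0 z0))).
rewrite -cmodM !divff// ?lt0r_neq0 ?cmod_gt0//.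
by rewrite /cmod /= expr0n addr0 expr1n sqrtr1.
Qed.

Lemma cmod_Im z : `|Im z| <= cmod z.
Proof. by rewrite -sqrtr_sqr ler_wsqrtr// lerDr sqr_ge0. Qed.

Lemma Re_mul_le z w : `|Re (z * w)| <= cmod z * (`|Re w| + `|Im w|).
Proof.
rewrite cReM (le_trans (ler_normB _ _))// mulrDr lerD// normrM ler_wpM2r//.
  exact: cmod_normr_Re.
exact: cmod_Im.
Qed.

Lemma carg_le z : in_slit_plane z -> `|carg z| <= pi.
Proof.
move=> sz; rewrite carg_atan//; set T := (X in atan X).
have := atan_gtNpi2 T; have := atan_ltpi2 T => h1 h2.
by rewrite ler_norml; apply/andP; split; lra.
Qed.

Definition segment_point (x s : R) z : R[i] := x%:C + s%:C * (z - x%:C).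

Lemma segment_slit x s z : 0 < x -> 0 <= s <= 1 -> in_slit_plane z ->
  in_slit_plane (segment_point x s z).
Proof.
move=> x0 /andP[s0 s1] sz; rewrite /segment_point => -[].
rewrite cReD cImD cReM cImM !cReD !cImD !cReN !cImN /= !(mul0r, addr0, subr0, oppr0, add0r).
move=> /eqP; rewrite mulf_eq0 => /orP[/eqP->|/eqP iz].
  by rewrite mul0r addr0 leNgt x0.
move=> h; apply: sz; split=> //; rewrite leNgt; apply/negP => rz.
have : 0 < x * (1 - s) + s * Re z by nra.
by lra.
Qed.

(** Multiply by the number u = r + conj z, with r = |z|, which points along the
bisector of the angle between x and conj z.  The real part of u times the point
of the segment is (r + Re z) ((1 - s) x + s r), and (1 - s) x + s r is at least
x r / (x + r), while |u| <= 2 r. *)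
Lemma inv_cmod_segment_le x s z : 0 < x -> 0 <= s <= 1 -> in_slit_plane z ->
  (cmod (segment_point x s z))^-1 <= 2 * (x + cmod z) / ((cmod z + Re z) * x).
Proof.
move=> x0 s01 sz; have rx := slit_gt0 sz; have r0 := cmod_gt0 (slit_neq0 sz).
have w0 := cmod_gt0 (slit_neq0 (segment_slit x0 s01 sz)).
have rr := cmod_sq z.
set r := cmod z in rx r0 rr *; set X := Re z in rx rr *.
pose u : R[i] := (r + X) -i* Im z.
have E : Re (u * segment_point x s z) = (r + X) * ((1 - s) * x + s * r).
  rewrite /segment_point cReM cReD cImD cReM cImM !cReD !cImD !cReN !cImN /=.
  rewrite !(mul0r, addr0, subr0, oppr0, add0r, mulNr, opprK) -/X.
  have -> : (r + X) * ((1 - s) * x + s * r) =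
    (r + X) * (1 - s) * x + s * (r * X + r ^+ 2) by ring.
  by rewrite rr; ring.
have cu : cmod u <= 2 * r.
  have r2 : 0 <= 2 * r by rewrite mulr_ge0// ltW.
  rewrite -[leRHS](ger0_norm r2) -sqrtr_sqr /cmod ler_wsqrtr//=.
  rewrite sqrrN (_ : Im z ^+ 2 = r ^+ 2 - X ^+ 2); last by rewrite rr; ring.
  have := cmod_normr_Re z; rewrite -/r -/X ler_norml => /andP[h1 h2].
  by nra.
have : (r + X) * ((1 - s) * x + s * r) <= 2 * r * cmod (segment_point x s z).
  rewrite -E (le_trans (ler_norm _))// (le_trans (cmod_normr_Re _))// cmodM.
  by rewrite ler_wpM2r// ltW.
have : x * r <= ((1 - s) * x + s * r) * (x + r).
  case/andP: s01 => s0 s1; rewrite -subr_ge0.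
  have -> : ((1 - s) * x + s * r) * (x + r) - x * r = (1 - s) * x ^+ 2 + s * r ^+ 2 by ring.
  by apply: addr_ge0; apply: mulr_ge0; rewrite ?sqr_ge0 ?subr_ge0.
move=> h1 h2; have h3 : (r + X) * (x * r) <= 2 * r * cmod (segment_point x s z) * (x + r).
  rewrite (le_trans (ler_wpM2l (ltW rx) h1))// mulrA ler_wpM2r//.
  by rewrite addr_ge0// ltW.
rewrite -[leLHS]mul1r ler_pdivrMr// mulrAC ler_pdivlMr ?mulr_gt0// mul1r.
rewrite -(ler_pM2r r0).
by rewrite (le_trans _ (le_trans h3 _)) // le_eqVlt; apply/orP; left; apply/eqP; ring.
Qed.

Lemma cmod_segment_le x s z : 0 < x -> 0 <= s <= 1 -> cmod (segment_point x s z) <= x + (`|Re z| + `|Im z|).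
Proof.
move=> x0 /andP[s0 s1].
have cle w : cmod w <= `|Re w| + `|Im w|.
  rewrite -[leRHS]ger0_norm ?addr_ge0// -sqrtr_sqr /cmod ler_wsqrtr// sqrrD.
  by rewrite !real_normK ?num_real// addrAC lerDl mulrn_wge0// mulr_ge0.
rewrite (le_trans (cle _))// /segment_point cReD cImD cReM cImM !cReD !cImD !cReN !cImN /=.
rewrite !(mul0r, addr0, subr0, oppr0, add0r) addrA lerD//.
  rewrite (_ : x + s * (Re z - x) = (1 - s) * x + s * Re z); last by ring.
  rewrite (le_trans (ler_normD _ _))// lerD// normrM.
    by rewrite !ger0_norm ?subr_ge0 ?(ltW x0)// ler_piMl ?(ltW x0)// gerBl.
  by rewrite ger0_norm// ler_piMl.
by rewrite normrM ger0_norm// ler_piMl.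
Qed.

End Homotopy.

(** * Cauchy's formula for powers *)

Section CauchyPower.
Context {R : realType}.
Implicit Types (h : R -> R[i]) (t : R) (z w d c : R[i]).
Local Notation Re := complex.Re.
Local Notation Im := complex.Im.
Local Notation mu := (@lebesgue_measure R).

Lemma cderiv_segment h t d (x s : R) : cderiv h t d ->
  cderiv (fun u => segment_point x s (h u)) t (s%:C * d).
Proof.
move=> hd; apply: cderiv_eq (cderivD (cderiv_cst x%:C t)
  (cderivM (cderiv_cst s%:C t) (cderivD hd (cderiv_cst (- x%:C) t)))) _.
by rewrite /=; ring.
Qed.

Lemma holo_cpow_segment (x s : R) (b : R[i]) : 0 < x -> 0 <= s <= 1 ->
  holo in_slit_plane (fun z => cpow (segment_point x s z) b)
    (fun z => b * cpow (segment_point x s z) b / segment_point x s z * s%:C).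
Proof.
move=> x0 s01 g t d sg gd.
apply: cderiv_eq (holo_cpow b (g := fun u => segment_point x s (g u)) _ (cderiv_segment x s gd)) _.
  exact: segment_slit.
by rewrite /=; ring.
Qed.

Lemma cmod_continuous h t d : cderiv h t d -> {for t, continuous (fun u => cmod (h u))}.
Proof.
move=> /cderiv_continuous[c1 c2].
apply: (@continuous_comp _ _ _ (fun u => Re (h u) ^+ 2 + Im (h u) ^+ 2) Num.sqrt).
  by apply: cvgD; [exact: (cvgM c1 c1)|exact: (cvgM c2 c2)].
exact: sqrt_continuous.
Qed.

Variables (g : R -> R[i]) (x : R) (b : R[i]).
Hypotheses (pg : piecewise_C1 g) (g01 : g 0 = g 1) (x0 : 0 < x).
Hypothesis sg : forall t, t \in `[0, 1] -> in_slit_plane (g t).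
Hypothesis gx : forall t, t \in `[0, 1] -> g t != x%:C.

(* The parameter of the homotopy.  It runs through [0, 1] while s runs through
   the whole line, so that differentiation under the integral sign meets no end
   point. *)
Let S (s : R) := sin s ^+ 2.

Let S01 s : 0 <= S s <= 1.
Proof. by rewrite sqr_ge0 /S sin2cos2 gerBl sqr_ge0. Qed.

(* The derivative of the power at the point of parameter S s on the segment. *)
Let dfr s z := b * cpow (segment_point x (S s) z) b / segment_point x (S s) z.

Let homot (c : R[i]) (s t : R) : R :=
  Re (c * ((cpow (segment_point x (S s) (g t)) b - cpow x%:C b) / (g t - x%:C)) * velocity g t).

Let dhomot (c : R[i]) (s t : R) : R :=
  Re (c * ((2 * sin s * cos s)%:C * dfr s (g t)) * velocity g t).

Let homot_derive c (s t : R) : t \in `[0, 1] -> is_derive s 1 (homot c ^~ t) (dhomot c s t).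
Proof.
move=> t01; have gx0 : g t - x%:C != 0 by rewrite subr_eq0 gx.
have dS : is_derive s 1 S (2 * sin s * cos s).
  by rewrite /S; apply: is_derive_eq; rewrite /GRing.scale /=; ring.
have dsegment : cderiv (fun u => segment_point x (S u) (g t)) s ((2 * sin s * cos s)%:C * (g t - x%:C)).
  have dSC : cderiv (fun u => (S u)%:C) s (2 * sin s * cos s)%:C.
    by split => //=; exact: is_derive_cst.
  apply: cderiv_eq (cderivD (cderiv_cst x%:C s)
    (cderivM dSC (cderiv_cst (g t - x%:C) s))) _.
  by rewrite mulr0 addr0 add0r.
have ssegment : in_slit_plane (segment_point x (S s) (g t)) by apply: segment_slit => //; exact: sg.
have d1 := holo_cpow b ssegment dsegment.
have d2 := cderivM (cderivM (cderiv_cst c s) (cderivM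
  (cderivD d1 (cderiv_cst (- cpow x%:C b) s)) (cderiv_cst (g t - x%:C)^-1 s)))
  (cderiv_cst (velocity g t) s).
have [+ _] := d2; move/is_derive_eq; apply.
rewrite /dhomot; congr complex.Re; rewrite /dfr /=.
rewrite !(mulr0, mul0r, addr0, add0r); congr (_ * _ * _).
by rewrite mulrA mulfK// mulrC.
Qed.

Let dfr_holo (s : R) : exists f', holo in_slit_plane (dfr s) f'.
Proof.
have sl z : in_slit_plane z -> segment_point x (S s) z != 0.
  by move=> sz; apply: slit_neq0; exact: segment_slit.
have hs : holo in_slit_plane (segment_point x (S s)) (cst (S s)%:C).
  by move=> h t d _ hd; exact: cderiv_segment.
eexists; exact: holoM (holoZ b (holo_cpow_segment b x0 (S01 s))) (holoV sl hs).
Qed.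

(* The s-derivative of the integrand is a multiple of the derivative along the
   curve of the power at the moving point, so its integral vanishes. *)
Let dhomot_int c (s : R) : \int[mu]_(t in `[0, 1]) dhomot c s t = 0.
Proof.
have [f' hf'] := dfr_holo s.
have [s0|s0] := eqVneq (sin s) 0.
  under eq_Rintegral do rewrite /dhomot s0 mulr0 mul0r mul0r mulr0 mul0r.
  by rewrite Rintegral_cst//= mul0r.
have hF : holo in_slit_plane (fun z => c * ((2 * cos s / sin s)%:C * cpow (segment_point x (S s) z) b))
   (fun z => c * ((2 * sin s * cos s)%:C * dfr s z)).
  apply: holo_eq (holoZ c (holoZ _ (holo_cpow_segment b x0 (S01 s)))) _ => z sz.
  rewrite /dfr -/(S s); congr (c * _).
  have E : (2 * cos s / sin s)%:C * (S s)%:C = (2 * sin s * cos s)%:C.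
    by rewrite -rmorphM /=; congr (_%:C); rewrite /S; field.
  by rewrite -E mulrA mulrAC mulrC mulrA.
have [_ /(_ _ hF)] := pw_integral_Re (holoZ c (holoZ (2 * sin s * cos s)%:C hf')) pg sg.
by rewrite g01 subrr.
Qed.

Let homot_integrable c (s : R) : mu.-integrable `[0, 1] (EFin \o homot c s).
Proof.
pose U := [set z : R[i] | in_slit_plane z /\ z - x%:C != 0].
have h1 : holo U (fun z => (cpow (segment_point x (S s) z) b + - cpow x%:C b))
    (fun z => b * cpow (segment_point x (S s) z) b / segment_point x (S s) z * (S s)%:C + 0).
  apply: holoD (@holo_cst _ _ _).
  by apply: holo_sub (holo_cpow_segment b x0 (S01 s)) _ => z [].
have U0 z : U z -> z + - x%:C != 0 by case.
have h2 := holoV U0 (holoD (@holo_id _ _) (@holo_cst _ U (- x%:C))).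
have [] := pw_integral_Re (holoZ c (holoM h1 h2)) pg _ => // t t01.
by split; rewrite ?subr_eq0 ?gx//; exact: sg.
Qed.

(** The bound is uniform in s, as domination requires: the modulus of z^b depends
only on the logarithm of |z|, which is bounded along the segments, and on the
argument, which is at most pi. *)
Lemma segment_derivative_bound : exists C, forall s t, t \in `[0, 1] -> cmod (dfr s (g t)) <= C.
Proof.
pose B1 z := 2 * (x + cmod z) / ((cmod z + Re z) * x).
pose B2 z := x + (`|Re z| + `|Im z|).
have [C1 HC1] : exists C, forall t, t \in `[0, 1] -> B1 (g t) <= C.
  apply: (pw_bounded pg sg) => h t d sh hd; have [c1 c2] := cderiv_continuous hd.
  have cm := cmod_continuous hd; rewrite /B1; apply: cvgM.
    by apply: cvgM; [exact: cvg_cst|apply: cvgD => //; exact: cvg_cst].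
  apply: cvgV; first by rewrite mulf_neq0// gt_eqF// slit_gt0.
  by apply: cvgM; [apply: cvgD|exact: cvg_cst].
have [C2 HC2] : exists C, forall t, t \in `[0, 1] -> B2 (g t) <= C.
  apply: (pw_bounded pg sg) => h t d sh hd; have [c1 c2] := cderiv_continuous hd.
  rewrite /B2; apply: cvgD; first exact: cvg_cst.
  by apply: cvgD; apply: cvg_norm.
exists (cmod b * expR (`|Re b| * (`|ln C1| + `|ln C2|) + `|Im b| * pi) * C1) => s t t01.
rewrite /dfr; set z := segment_point x (S s) (g t).
have sz : in_slit_plane z by apply: segment_slit => //; exact: sg.
have z0 := cmod_gt0 (slit_neq0 sz).
have zC1 : (cmod z)^-1 <= C1.
  by rewrite (le_trans _ (HC1 t t01))//; apply: inv_cmod_segment_le => //; exact: sg.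
have zC2 : cmod z <= C2 by rewrite (le_trans _ (HC2 t t01))//; exact: cmod_segment_le.
have C1p : 0 < C1 by rewrite (lt_le_trans _ zC1)// invr_gt0.
have C2p : 0 < C2 by rewrite (lt_le_trans _ zC2).
have lnz : `|ln (cmod z)| <= `|ln C1| + `|ln C2|.
  have l2 : ln (cmod z) <= ln C2 by rewrite ler_ln.
  have l1 : - ln (cmod z) <= ln C1 by rewrite -lnV// ler_ln ?posrE ?invr_gt0.
  rewrite ler_norml; have := ler_norm (ln C1); have := ler_norm (ln C2).
  have := normr_ge0 (ln C1); have := normr_ge0 (ln C2).
  by move=> *; apply/andP; split; lra.
rewrite !cmodM cmodV ler_pM ?mulr_ge0 ?invr_ge0 ?cmod_ge0//.
rewrite ler_wpM2l ?cmod_ge0// /cpow cmod_cexp ler_expR cReM /=.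
rewrite (le_trans (ler_norm _))// (le_trans (ler_normB _ _))// !normrM.
by rewrite lerD// ler_wpM2l// carg_le.
Qed.

Let homot_const c : \int[mu]_(t in `[0, 1]) homot c (pi / 2) t = 0.
Proof.
transitivity (\int[mu]_(t in `[0, 1]) homot c 0 t); last first.
  rewrite (_ : \int[mu]_(t in `[0, 1]) homot c 0 t = \int[mu]_(t in `[0, 1]) cst 0 t).
    by rewrite Rintegral_cst//= mul0r.
  apply: eq_Rintegral => t _; rewrite /homot /S sin0 expr0n /= /segment_point mul0r addr0.
  by rewrite subrr mul0r mulr0 mul0r.
apply: (@is_derive_0_is_cst R (fun s => \int[mu]_(t in `[0, 1]) homot c s t)) => a.
have [C HC] := segment_derivative_bound.
have C0 : 0 <= C.
  by apply: le_trans (HC 0 0 _); rewrite ?cmod_ge0// in_itv /= lexx ler01.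
pose G t := cmod c * 2 * C * (`|Re (velocity g t)| + `|Im (velocity g t)|).
have aI : `]a - 1, a + 1[%classic a.
  by rewrite /= in_itv /= ltrDl ltrBlDr ltrDl !ltr01.
have [v1 v2] : mu.-integrable `[0, 1] (EFin \o (fun t => Re (velocity g t))) /\
    mu.-integrable `[0, 1] (EFin \o (fun t => Im (velocity g t))).
  have [h1 h2] : integrable_on g (fun=> 1).
    by apply: (holo_integrable_on (@holo_cst _ setT 1) pg).
  split.
    by apply: eq_integrable h1 => // t _; congr (complex.Re _)%:E; rewrite mul1r.
  by apply: eq_integrable h2 => // t _; congr (complex.Im _)%:E; rewrite mul1r.
have iG : mu.-integrable `[0, 1] (EFin \o G).
  have w1 : mu.-integrable `[0, 1] (EFin \o (fun t => `|Re (velocity g t)|)).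
    exact: integrable_norm v1.
  have w2 : mu.-integrable `[0, 1] (EFin \o (fun t => `|Im (velocity g t)|)).
    exact: integrable_norm v2.
  apply: eq_integrable (integrableZl _ (cmod c * 2 * C) (integrableD _ w1 w2)) => // t _.
have G0 t : 0 <= G t by rewrite /G !mulr_ge0 ?cmod_ge0 ?addr_ge0.
have hd (s t : R) : `]a - 1, a + 1[%classic s -> `[0, 1]%classic t -> derivable (homot c ^~ t) s 1.
  by move=> _ t01; have [] := homot_derive c s t01.
have pE (s t : R) : t \in `[0, 1] -> partial1of2 (homot c) s t = dhomot c s t.
  by move=> t01; rewrite /partial1of2 derive1E; have [] := homot_derive c s t01.
have ub (s t : R) : `]a - 1, a + 1[%classic s -> `[0, 1]%classic t ->
    `|partial1of2 (homot c) s t| <= G t.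
  move=> _ t01; rewrite pE// /dhomot /G (le_trans (Re_mul_le _ _))//.
  rewrite ler_wpM2r ?addr_ge0// -[leRHS]mulrA cmodM ler_wpM2l ?cmod_ge0//.
  rewrite cmodM ler_pM ?cmod_ge0 ?HC//.
  rewrite cmod_real !normrM ger0_norm// -mulrA ler_piMr//.
  by rewrite mulr_ile1// ler_norml ?sin_geN1 ?sin_le1 ?cos_geN1 ?cos_le1.
have m01 : measurable (`[0, 1]%classic : set R) by [].
have hi (s : R) : `]a - 1, a + 1[%classic s -> mu.-integrable `[0, 1] (EFin \o homot c s).
  by move=> _; exact: homot_integrable.
have dv := derivable_under_integral (f := homot c) (mu := mu) m01 aI hi hd G0 iG ub.
have dE := differentiation_under_integral (f := homot c) (mu := mu) m01 aI hi hd G0 iG ub.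
apply: DeriveDef => //; rewrite -derive1E dE -[RHS](dhomot_int c a).
by apply: eq_Rintegral => t; rewrite inE => t01; exact: pE.
Qed.

(** Contract the curve to the point x along segments.  The integral is constant
along the homotopy and vanishes at its beginning, where the curve is a
point. *)
Lemma oint_cpow_sub : oint g (fun z => (cpow z b - cpow x%:C b) / (z - x%:C)) = 0.
Proof.
have S1 : S (pi / 2) = 1 by rewrite /S sin_pihalf expr1n.
have s1 z : segment_point x 1 z = z by rewrite /segment_point mul1r addrC subrK.
rewrite /oint /cintegral.
have := homot_const 1; rewrite /homot S1.
under eq_Rintegral do rewrite s1 mul1r.
move=> ->.
have := homot_const (0 -i* 1); rewrite /homot S1.
under eq_Rintegral do rewrite s1 -mulrA mul_mi_Re.
by move=> ->; exact: mul0r.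
Qed.

End CauchyPower.

(** * Lagrange interpolation and sums over roots *)

Section Lagrange.
Variable F : fieldType.
Implicit Types (s : seq F) (p q : {poly F}) (x y z : F).

Definition root_poly s : {poly F} := \prod_(x <- s) ('X - x%:P).

Lemma size_root_poly s : size (root_poly s) = (size s).+1.
Proof. exact: size_prod_XsubC. Qed.

Lemma monic_root_poly s : root_poly s \is monic.
Proof. exact: monic_prod_XsubC. Qed.

Lemma horner_root_poly s z : (root_poly s).[z] = \prod_(x <- s) (z - x).
Proof. by rewrite horner_prod; apply: eq_bigr => x _; rewrite hornerXsubC. Qed.

Lemma root_poly_root s x : x \in s -> (root_poly s).[x] = 0.
Proof. by move=> xs; apply/eqP; have := root_prod_XsubC s x; rewrite xs. Qed.

Lemma root_poly_rem s x : x \in s -> root_poly s = ('X - x%:P) * root_poly (rem x s).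
Proof. by move=> xs; rewrite /root_poly (big_rem x). Qed.

Lemma deriv_root_poly s x : x \in s -> (root_poly s)^`().[x] = (root_poly (rem x s)).[x].
Proof.
move=> xs; rewrite (root_poly_rem xs) derivM derivXsubC mul1r !hornerE subrr mul0r.
by rewrite addr0.
Qed.

Lemma deriv_root_poly_neq0 s x : uniq s -> x \in s -> (root_poly s)^`().[x] != 0.
Proof.
move=> us xs; rewrite deriv_root_poly// horner_root_poly prodf_seq_neq0.
apply/allP => y ys; rewrite /= subr_eq0; apply: contraTneq ys => <-.
by rewrite mem_rem_uniq// inE eqxx.
Qed.

Lemma lagrange s q : uniq s -> (size q <= size s)%N ->
  q = \sum_(x <- s) (q.[x] / (root_poly s)^`().[x]) *: root_poly (rem x s).
Proof.
move=> us qs; apply/eqP; rewrite -subr_eq0; set d := _ - _; apply/eqP.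
apply: (@roots_geq_poly_eq0 _ d s); rewrite ?uniq_rootsE//.
  apply/allP => y ys; rewrite rootE /d hornerD hornerN horner_sum (big_rem y)//=.
  rewrite hornerZ deriv_root_poly// divfK; last first.
    by rewrite -deriv_root_poly// deriv_root_poly_neq0.
  rewrite big_seq big1 ?addr0 ?subrr// => x xs; rewrite hornerZ root_poly_root ?mulr0//.
  move: xs; rewrite !mem_rem_uniq// !inE => /andP[xy xs].
  by rewrite eq_sym xy ys.
rewrite (leq_trans (size_polyD _ _))// geq_max qs size_polyN.
apply: (leq_trans (size_sum _ _ _)); apply/bigmax_leqP_seq => x xs _.
rewrite (leq_trans (size_scale_leq _ _))// size_root_poly size_rem//.
by case: s xs {us qs d}.
Qed.

(** The leading coefficients on the two sides of Lagrange's formula. *)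
Lemma sum_residues s q : uniq s -> (size q <= size s)%N ->
  \sum_(x <- s) q.[x] / (root_poly s)^`().[x] = q`_(size s).-1.
Proof.
move=> us qs; rewrite {2}(lagrange us qs) coef_sum big_seq [RHS]big_seq.
apply: eq_bigr => x xs; rewrite coefZ.
have -> : (root_poly (rem x s))`_(size s).-1 = lead_coef (root_poly (rem x s)).
  by rewrite lead_coefE size_root_poly size_rem.
by rewrite (monicP (monic_root_poly _)) mulr1.
Qed.

(** Lagrange's formula for the constant 1, that is, the partial fraction
decomposition of 1 / P. *)
Lemma root_polyV s z : uniq s -> s != [::] -> (root_poly s).[z] != 0 ->
  (root_poly s).[z]^-1 = \sum_(x <- s) ((root_poly s)^`().[x] * (z - x))^-1.
Proof.
move=> us s0 Pz; apply: (mulfI Pz); rewrite divff// mulr_sumr.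
have /(congr1 (horner^~ z)) : 1 = \sum_(x <- s) (1.[x] / (root_poly s)^`().[x]) *: root_poly (rem x s).
  by apply: lagrange; rewrite // size_poly1; case: s s0 {us Pz}.
rewrite hornerC horner_sum => ->; rewrite big_seq [RHS]big_seq.
apply: eq_bigr => x xs; rewrite hornerZ hornerC mul1r.
have PzE : (root_poly s).[z] = (z - x) * (root_poly (rem x s)).[z].
  by rewrite {1}(root_poly_rem xs) hornerM hornerXsubC.
have zx : z - x != 0 by move: Pz; rewrite PzE mulf_eq0 negb_or => /andP[].
have d0 := deriv_root_poly_neq0 us xs.
by rewrite PzE; field; rewrite zx.
Qed.

End Lagrange.

(** * The residue theorem for powers *)

Section Residues.
Context {R : realType}.
Implicit Types (t : R) (z w d b c : R[i]) (p : {poly R[i]}).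

Lemma cpowS z b : in_slit_plane z -> cpow z (b + 1) = cpow z b * z.
Proof. by move=> sz; rewrite /cpow mulrDl mul1r cexpD cexp_clog. Qed.

Lemma cpowDn z b n : in_slit_plane z -> cpow z (b + n%:R) = cpow z b * z ^+ n.
Proof. by move=> sz; rewrite /cpow mulrDl cexpD cexpMn cexp_clog. Qed.

Variable g : R -> R[i].
Hypotheses (pg : piecewise_C1 g) (g01 : g 0 = g 1).
Hypothesis sg : forall t, t \in `[0, 1] -> in_slit_plane (g t).

(** The primitive is a power, except for the exponent -1, where it is the
logarithm. *)
Lemma oint_cpow b : oint g (cpow^~ b) = 0.
Proof.
have [b1|b1] := eqVneq (b + 1) 0.
  have hl : holo in_slit_plane clog (cpow^~ b).
    apply: holo_eq holo_clog _ => z sz; have z0 := slit_neq0 sz.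
    by apply: (mulIf z0); rewrite -cpowS// b1 mulVf// /cpow mul0r cexp0.
  exact: oint_primitive hl (holo_cpow b) pg g01 sg.
have h : holo in_slit_plane (fun z => (b + 1)^-1 * cpow z (b + 1)) (cpow^~ b).
  apply: holo_eq (holoZ _ (holo_cpow (b + 1))) _ => z sz.
  have z0 := slit_neq0 sz.
  by rewrite -mulrA mulrA mulVf// mul1r cpowS// mulfK.
exact: oint_primitive h (holo_cpow b) pg g01 sg.
Qed.

Lemma integrable_on_cpow b : integrable_on g (cpow^~ b).
Proof. exact: holo_integrable_on (holo_cpow b) pg sg. Qed.

Lemma cpow_horner b p z : in_slit_plane z ->
  \sum_(i < size p) p`_i * cpow z (b + i%:R) = cpow z b * p.[z].
Proof.
move=> sz; rewrite horner_coef mulr_sumr; apply: eq_bigr => i _.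
by rewrite cpowDn//; ring.
Qed.

Lemma integrable_on_cpow_poly b p : integrable_on g (fun z => cpow z b * p.[z]).
Proof.
have i0 := integrable_on_0 pg.
have : integrable_on g (fun z => \sum_(i < size p) p`_i * cpow z (b + i%:R)).
  apply: integrable_on_sum => // i _; apply: integrable_onZ.
  exact: integrable_on_cpow.
by apply: integrable_on_eq => t t01; rewrite cpow_horner//; exact: sg.
Qed.

Lemma oint_cpow_poly b p : oint g (fun z => cpow z b * p.[z]) = 0.
Proof.
have i0 := integrable_on_0 pg.
transitivity (oint g (fun z => \sum_(i < size p) p`_i * cpow z (b + i%:R))).
  by apply: oint_eq => t t01; rewrite cpow_horner//; exact: sg.
rewrite oint_sum//.
  by rewrite big1// => i _; rewrite ointZ ?oint_cpow ?mulr0//; exact: integrable_on_cpow.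
by move=> i _; apply: integrable_onZ; exact: integrable_on_cpow.
Qed.

Section Pole.
Variable x : R.
Hypotheses (x0 : 0 < x) (ex : encloses g x%:C).

Let gx t : t \in `[0, 1] -> g t - x%:C != 0.
Proof. by move=> t01; rewrite subr_eq0; have [/(_ t t01)] := ex. Qed.

Lemma integrable_on_inv_sub : integrable_on g (fun z => (z - x%:C)^-1).
Proof.
have := integrable_on_polyV pg (p := 'X - x%:C%:P).
move=> /(_ _)/integrable_on_eq; apply => [t t01|t t01]; rewrite hornerXsubC//.
exact: gx.
Qed.

Lemma integrable_on_cpow_quotient b : integrable_on g (fun z => cpow z b / (z - x%:C)).
Proof.
pose U := [set z : R[i] | in_slit_plane z /\ z - x%:C != 0].
have h1 : holo U (cpow^~ b) (fun z => b * cpow z b / z).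
  by apply: holo_sub (holo_cpow b) _ => z [].
have U0 z : U z -> z + - x%:C != 0 by case.
have h2 := holoV U0 (holoD (@holo_id _ _) (@holo_cst _ U (- x%:C))).
apply: holo_integrable_on (holoM h1 h2) pg _ => t t01.
by split; [exact: sg|exact: gx].
Qed.

(** The difference with the constant function x^b integrates to 0 and the winding
number around x is 1. *)
Lemma cauchy_cpow b : oint g (fun z => cpow z b / (z - x%:C)) = cpow x%:C b.
Proof.
have [_ w1] := ex.
rewrite -[RHS]mulr1 -w1 /winding -ointZ; last exact: integrable_on_inv_sub.
have gx' t : t \in `[0, 1] -> g t != x%:C by move=> /gx; rewrite subr_eq0.
rewrite -[RHS]add0r -(oint_cpow_sub b pg g01 x0 sg gx') -ointD.
- by apply: oint_eq => t _; rewrite -mulrDl subrK.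
- have := integrable_onD (integrable_on_cpow_quotient b)
    (integrable_onZ (- cpow x%:C b) integrable_on_inv_sub).
  by apply: integrable_on_eq => t _; rewrite mulrBl mulNr.
- exact: integrable_onZ integrable_on_inv_sub.
Qed.

Lemma poly_sub_value p : exists h : {poly R[i]}, p = p.[x%:C]%:P + h * ('X - x%:C%:P).
Proof.
have /factor_theorem [h hE] : root (p - p.[x%:C]%:P) x%:C by rewrite rootE !hornerE subrr.
by exists h; rewrite -hE addrC subrK.
Qed.

Lemma cauchy_cpow_poly b p :
  integrable_on g (fun z => cpow z b * p.[z] / (z - x%:C)) /\
  oint g (fun z => cpow z b * p.[z] / (z - x%:C)) = cpow x%:C b * p.[x%:C].
Proof.
have [h hE] := poly_sub_value p.
have e t : t \in `[0, 1] -> p.[x%:C] * (cpow (g t) b / (g t - x%:C)) + cpow (g t) b * h.[g t]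
   = cpow (g t) b * p.[g t] / (g t - x%:C).
  move=> t01; have := gx t01 => ?.
  by rewrite [in RHS]hE hornerD hornerM hornerC hornerXsubC; field.
have i1 := integrable_onZ p.[x%:C] (integrable_on_cpow_quotient b).
have i2 := integrable_on_cpow_poly b h.
split; first exact: integrable_on_eq e (integrable_onD i1 i2).
transitivity (oint g (fun z =>
    p.[x%:C] * (cpow z b / (z - x%:C)) + cpow z b * h.[z])).
  by apply: oint_eq => t t01; rewrite e.
rewrite ointD// ointZ; last exact: integrable_on_cpow_quotient.
by rewrite cauchy_cpow oint_cpow_poly addr0 mulrC.
Qed.

End Pole.

(** Partial fractions reduce to one simple pole at a time. *)
Lemma residue_cpow (s : seq R) b p : uniq s -> s != [::] ->
  (forall x, x \in s -> 0 < x /\ encloses g x%:C) ->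
  let P := root_poly [seq x%:C | x <- s] in
  oint g (fun z => cpow z b * (p.[z] / P.[z]))
    = \sum_(x <- s) cpow x%:C b * (p.[x%:C] / P^`().[x%:C]).
Proof.
move=> us s0 sx P; set sC := [seq x%:C | x <- s] in P *.
have usC : uniq sC by rewrite map_inj_uniq//; exact: complexI.
have sC0 : sC != [::] by rewrite -size_eq0 size_map size_eq0.
have e t : t \in `[0, 1] ->
   \sum_(x <- s | x \in s) (P^`().[x%:C])^-1 * (cpow (g t) b * p.[g t] / (g t - x%:C))
   = cpow (g t) b * (p.[g t] / P.[g t]).
  move=> t01.
  have Pt : P.[g t] != 0.
    rewrite /P horner_root_poly prodf_seq_neq0; apply/allP => _ /mapP[x xs ->] /=.
    by rewrite subr_eq0; have [_ [/(_ t t01)]] := sx x xs.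
  rewrite /P (root_polyV usC sC0 Pt) big_map -big_seq !mulr_sumr.
  by apply: eq_bigr => x _; rewrite invfM; ring.
transitivity (oint g (fun z => \sum_(x <- s | x \in s)
    (P^`().[x%:C])^-1 * (cpow z b * p.[z] / (z - x%:C)))).
  by apply: oint_eq => t t01; rewrite e.
rewrite oint_sum; first last.
- move=> x xs; have [x0 ex] := sx x xs; apply: integrable_onZ.
  by have [] := cauchy_cpow_poly x0 ex b p.
- exact: integrable_on_0.
rewrite [RHS]big_seq; apply: eq_bigr => x xs; have [x0 ex] := sx x xs.
have [i1 e1] := cauchy_cpow_poly x0 ex b p.
by rewrite ointZ// e1; ring.
Qed.

End Residues.

(** * Palindromic polynomials and their truncations *)

Section Palindromic.
Variable F : numFieldType.
Implicit Types (s : seq F) (p q : {poly F}) (x y z tau sigma : F).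

(** A nonzero polynomial over a field of characteristic 0 cannot vanish at all
positive integers. *)
Lemma poly_eq_nonzero p q : (forall x, x != 0 -> p.[x] = q.[x]) -> p = q.
Proof.
move=> H; apply/eqP; rewrite -subr_eq0; apply/eqP.
set d := p - q; pose rs := [seq i.+1%:R | i <- iota 0 (size d)] : seq F.
apply: (@roots_geq_poly_eq0 _ d rs); rewrite ?uniq_rootsE.
- apply/allP => _ /mapP[i _ ->]; rewrite rootE /d hornerD hornerN H ?subrr//.
- by rewrite map_inj_uniq ?iota_uniq// => i j /eqP; rewrite eqr_nat => /eqP[].
- by rewrite size_map size_iota.
Qed.

Definition palindromic n tau p : Prop :=
  forall x, x != 0 -> x ^+ n * p.[x^-1] = tau * p.[x].

Lemma palindromicM n1 n2 t1 t2 p q : palindromic n1 t1 p -> palindromic n2 t2 q ->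
  palindromic (n1 + n2) (t1 * t2) (p * q).
Proof.
move=> H1 H2 x x0; rewrite !hornerM exprD mulrACA H1// H2//; ring.
Qed.

Lemma palindromic1 : palindromic 0 1 1.
Proof. by move=> x _; rewrite !hornerC expr0. Qed.

Lemma palindromic_XsubC1 : palindromic 1 (-1) ('X - 1%:P).
Proof. by move=> x x0; rewrite !hornerXsubC; field. Qed.

Lemma palindromic_pair y : y != 0 ->
  palindromic 2 1 (('X - y%:P) * ('X - y^-1%:P)).
Proof. by move=> y0 x x0; rewrite !hornerM !hornerXsubC; field; rewrite x0 y0. Qed.

Lemma palindromic_coef n tau p j : (size p <= n.+1)%N -> palindromic n tau p ->
  (j <= n)%N -> p`_(n - j) = tau * p`_j.
Proof.
move=> sp H jn.
have : \poly_(i < n.+1) p`_(n - i) = tau *: p.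
  apply: poly_eq_nonzero => x x0; rewrite hornerZ -H//.
  rewrite horner_poly (horner_coef_wide _ sp) mulr_sumr (reindex_inj rev_ord_inj) /=.
  apply: eq_bigr => i _; rewrite subSS subKn; last by rewrite -ltnS.
  rewrite mulrCA; congr (_ * _); rewrite exprVn.
  have -> : x ^+ n = x ^+ (n - i) * x ^+ i by rewrite -exprD subnK// -ltnS.
  by rewrite mulfK// expf_neq0.
move/(congr1 (fun r : {poly F} => r`_j)); rewrite coefZ coef_poly ltnS jn.
by [].
Qed.

Section Fixed.
Variables (n : nat) (tau : F) (p : {poly F}).
Hypotheses (sp : (size p <= n.+1)%N) (pal : palindromic n tau p).

(** Reversing the coefficients exchanges the high and the low ones. *)
Lemma horner_drop_inv c x : x != 0 -> (c <= n)%N ->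
  x ^+ (n - c) * (drop_poly c p).[x^-1] = tau * (take_poly (n - c).+1 p).[x].
Proof.
move=> x0 cn; rewrite /take_poly horner_poly.
have sd : (size (drop_poly c p) <= (n - c).+1)%N.
  by rewrite size_drop_poly -subSn// leq_sub2r.
rewrite (horner_coef_wide _ sd) !mulr_sumr (reindex_inj rev_ord_inj) /=.
apply: eq_bigr => i _; rewrite subSS coef_drop_poly.
have ic : (i <= n - c)%N by rewrite -ltnS.
have -> : (n - c - i + c = n - i)%N.
  by rewrite addnC addnBA// subnKC.
rewrite (palindromic_coef sp pal); last by rewrite (leq_trans ic)// leq_subr.
rewrite mulrCA -!mulrA; congr (_ * (_ * _)); rewrite exprVn.
have -> : x ^+ (n - c) = x ^+ (n - c - i) * x ^+ i by rewrite -exprD subnK.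
by rewrite [X in X / _]mulrC mulfK// expf_neq0.
Qed.

Lemma horner_take_root c x : p.[x] = 0 -> (take_poly c p).[x] = - (x ^+ c * (drop_poly c p).[x]).
Proof.
rewrite -{1}(poly_take_drop c p) hornerD hornerM hornerXn => /eqP.
by rewrite addr_eq0 mulrC => /eqP.
Qed.

Lemma horner_deriv_inv x : x != 0 -> p.[x] = 0 -> (0 < n)%N ->
  x ^+ n.-1 * p^`().[x^-1] = - tau * (x * p^`().[x]).
Proof.
move=> x0 px n0.
have sd : (size p^`() <= n)%N.
  apply/leq_sizeP => j nj; rewrite coef_deriv nth_default ?mul0rn//.
  exact: leq_trans sp _.
have xE : x * p^`().[x] = \sum_(i < n.+1) i%:R * p`_i * x ^+ i.
  rewrite (horner_coef_wide _ sd) mulr_sumr big_ord_recl /= !mul0r add0r.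
  apply: eq_bigr => i _; rewrite coef_deriv /= /bump /= add1n exprS -mulr_natl.
  by ring.
have pE : \sum_(i < n.+1) n%:R * p`_i * x ^+ i = 0.
  transitivity (n%:R * p.[x]); last by rewrite px mulr0.
  rewrite (horner_coef_wide _ sp) mulr_sumr.
  by apply: eq_bigr => i _; rewrite mulrA.
transitivity (tau * \sum_(i < n.+1) (n - i)%:R * p`_i * x ^+ i); last first.
  rewrite xE mulNr -mulrN -[- _]add0r -[X in X - _]pE -sumrB; congr (_ * _).
  apply: eq_bigr => i _; rewrite natrB; last by rewrite -ltnS.
  by ring.
rewrite (horner_coef_wide _ sd) big_ord_recr /= subnn !mul0r addr0.
rewrite !mulr_sumr (reindex_inj rev_ord_inj) /=.
apply: eq_bigr => i _; rewrite coef_deriv.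
have -> : (n - i.+1).+1 = (n - i)%N by rewrite subnSK.
rewrite (palindromic_coef sp pal (ltnW (ltn_ord i))) exprVn.
have -> : x ^+ n.-1 = x ^+ i * x ^+ (n - i.+1).
  by rewrite -exprD; congr (_ ^+ _); have := ltn_ord i; lia.
by rewrite -mulr_natl; field; rewrite expf_neq0.
Qed.

End Fixed.

(** If j < c then X^j drop_poly c P has degree less than that of P.  If c <= j, it
is congruent to - X^(j-c) take_poly c P modulo P, of degree less than j.  In
both cases sum_residues reads off one coefficient, which can only be the leading
coefficient of P. *)
Lemma sum_residues_drop s n j c : uniq s -> size s = n -> (j < n)%N ->
  let P := root_poly s in
  \sum_(x <- s) x ^+ j * (drop_poly c P).[x] / P^`().[x] = (c == j.+1)%:R.
Proof.
move=> us sn js P.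
have sP : size P = n.+1 by rewrite size_root_poly sn.
have [cj|jc] := leqP c j.
  transitivity (\sum_(x <- s) (- 'X^(j - c) * take_poly c P).[x] / P^`().[x]).
    rewrite big_seq [RHS]big_seq; apply: eq_bigr => x xs; congr (_ / _).
    rewrite hornerM hornerN hornerXn horner_take_root ?root_poly_root//.
    by rewrite mulrNN mulrA -exprD subnK.
  have sz : (size (- 'X^(j - c) * take_poly c P)%R <= j)%N.
    rewrite mulNr size_polyN (leq_trans (size_polyMleq _ _))// size_polyXn.
    by rewrite addSn /= -[leqRHS](subnK cj) leq_add2l size_take_poly.
  rewrite sum_residues//; last by rewrite sn (leq_trans sz)// ltnW.
  rewrite nth_default; first by rewrite ltn_eqF.
  by rewrite sn (leq_trans sz)//; lia.
transitivity (\sum_(x <- s) ('X^j * drop_poly c P).[x] / P^`().[x]).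
  by apply: eq_bigr => x _; rewrite hornerM hornerXn.
rewrite sum_residues//; last first.
  have [->|d0] := eqVneq (drop_poly c P) 0; first by rewrite mulr0 size_poly0.
  rewrite (leq_trans (size_polyMleq _ _))// size_polyXn size_drop_poly sP sn; lia.
rewrite sn coefXnM coef_drop_poly ifF; last by lia.
have [->|cj] := eqVneq c j.+1; last by rewrite nth_default// sP; lia.
have -> : (n.-1 - j + j.+1 = (size P).-1)%N by rewrite sP /=; lia.
by rewrite -lead_coefE; exact/monicP/monic_root_poly.
Qed.

End Palindromic.

(** * The polynomial left by the inner integral *)

Section Kernel.
Variable F : numFieldType.
Implicit Types (x sigma tau : F) (p : {poly F}).

(** The value of the inner integral up to a factor: p is the product over the
nodes, and the two truncations come from the two terms in the numerator of the
integrand. *)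
Definition inner_poly e sigma cp cm p : {poly F} :=
  'X^e * drop_poly cp p + sigma%:P * drop_poly cm p.

Lemma horner_inner_poly e sigma cp cm p x : (inner_poly e sigma cp cm p).[x]
  = x ^+ e * (drop_poly cp p).[x] + sigma * (drop_poly cm p).[x].
Proof. by rewrite /inner_poly !hornerE. Qed.

Section Fixed.
Variables (n : nat) (tau : F) (p : {poly F}).
Hypotheses (sp : (size p <= n.+1)%N) (pal : palindromic n tau p).
Hypotheses (tau2 : tau * tau = 1).
Variable x : F.
Hypotheses (x0 : x != 0) (px : p.[x] = 0).

(** At a root of p the part of degree at least c' is minus the part of degree less
than c', and reversal identifies the latter with the part of degree at least
c.  Here the two truncations are complementary. *)
Lemma drop_inv_odd c c' : (c + c' = n.+1)%N -> (0 < c')%N ->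
  (drop_poly c p).[x^-1] = - tau * x * (drop_poly c' p).[x].
Proof.
move=> cc c'0; have cn : (c <= n)%N by lia.
have := horner_drop_inv sp pal x0 cn.
have -> : (n - c).+1 = c' by lia.
rewrite horner_take_root// => h; apply: (mulfI (expf_neq0 (n - c) x0)).
rewrite h (_ : x ^+ c' = x ^+ (n - c) * x); last by rewrite -exprSr; congr (_ ^+ _); lia.
by ring.
Qed.

(** As drop_inv_odd, but now the truncations overlap in one coefficient. *)
Lemma drop_inv_even c c' : (c + c' = n)%N ->
  (drop_poly c p).[x^-1] = tau * (p`_c' - (drop_poly c' p).[x]).
Proof.
move=> cc; have cn : (c <= n)%N by lia.
have := horner_drop_inv sp pal x0 cn.
have -> : (n - c)%N = c' by lia.
have -> : (take_poly c'.+1 p).[x] = (take_poly c' p).[x] + p`_c' * x ^+ c'.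
  by rewrite /take_poly !horner_poly big_ord_recr.
rewrite horner_take_root// => h; apply: (mulfI (expf_neq0 c' x0)).
by rewrite h; ring.
Qed.

Lemma deriv_inv K e : n = (K + e).+1 -> (e <= 1)%N ->
  x ^+ K * x ^+ e * p^`().[x^-1] = - tau * (x * p^`().[x]).
Proof.
move=> nK e1; rewrite -(horner_deriv_inv sp pal) ?nK//.
by rewrite -exprD.
Qed.

(** Inversion exchanges the two truncations in inner_poly up to a monomial factor;
the derivative at a root of a palindromic polynomial also changes by a monomial
factor. *)
Lemma inner_poly_inv_odd e sigma cp cm K :
  (cp + cm = n.+1)%N -> (0 < cp)%N -> (0 < cm)%N -> n = (K + e).+1 -> (e <= 1)%N ->
  sigma * sigma = 1 -> p^`().[x] != 0 ->
  let G := inner_poly e sigma cp cm p in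
  G.[x^-1] / p^`().[x^-1] = sigma * x ^+ K * (G.[x] / p^`().[x]).
Proof.
move=> cc cp0 cm0 nK e1 s2 dp G.
have D1 := drop_inv_odd cc cm0.
have D2 : (drop_poly cm p).[x^-1] = - tau * x * (drop_poly cp p).[x].
  by apply: drop_inv_odd => //; lia.
have t0 : tau != 0 by apply/eqP => t0; move: tau2; rewrite t0 mul0r => /eqP; rewrite eq_sym oner_eq0.
have dV := deriv_inv nK e1.
have dp' : p^`().[x^-1] != 0.
  apply/eqP => dp0; move: dV; rewrite dp0 mulr0 => /esym/eqP.
  by rewrite !mulf_eq0 oppr_eq0 (negbTE t0) (negbTE x0) (negbTE dp).
have GE : x ^+ e * G.[x^-1] = - (sigma * tau) * x * G.[x].
  rewrite !horner_inner_poly D1 D2 exprVn.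
  have e0 : x ^+ e != 0 by rewrite expf_neq0.
  transitivity (- tau * x * (sigma * sigma) * (drop_poly cm p).[x]
     - sigma * tau * x * x ^+ e * (drop_poly cp p).[x]).
    by rewrite s2; field.
  by ring.
apply: (mulIf dp'); rewrite divfK//; apply: (mulfI (expf_neq0 e x0)); rewrite GE.
transitivity (sigma * (x ^+ K * x ^+ e * p^`().[x^-1]) * (G.[x] / p^`().[x])); last by ring.
by rewrite dV; field.
Qed.

(** As inner_poly_inv_odd.  The overlapping coefficient appears twice, with
opposite signs because sigma = - tau. *)
Lemma inner_poly_inv_even sigma cp cm K :
  (cp + cm = n)%N -> n = K.+2 -> sigma = - tau -> p^`().[x] != 0 ->
  let G := inner_poly 0 sigma cp cm p in
  G.[x^-1] / p^`().[x^-1] = sigma * x ^+ K * (G.[x] / p^`().[x]).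
Proof.
move=> cc nK st dp G.
have D1 := drop_inv_even cc.
have D2 : (drop_poly cm p).[x^-1] = tau * (p`_cp - (drop_poly cp p).[x]).
  by apply: drop_inv_even => //; lia.
have pc : p`_cm = tau * p`_cp.
  by rewrite -(palindromic_coef sp pal)//; [congr (p`_ _)|]; lia.
have t0 : tau != 0 by apply/eqP => t0; move: tau2; rewrite t0 mul0r => /eqP; rewrite eq_sym oner_eq0.
have dV : x ^+ K * x ^+ 1 * p^`().[x^-1] = - tau * (x * p^`().[x]).
  by apply: deriv_inv => //; rewrite addn1.
have dp' : p^`().[x^-1] != 0.
  apply/eqP => dp0; move: dV; rewrite dp0 mulr0 => /esym/eqP.
  by rewrite !mulf_eq0 oppr_eq0 (negbTE t0) (negbTE x0) (negbTE dp).
have GE : G.[x^-1] = G.[x].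
  rewrite !horner_inner_poly D1 D2 expr0 pc st.
  transitivity (tau * tau * p`_cp - tau * (drop_poly cm p).[x]
     - tau * tau * p`_cp + tau * tau * (drop_poly cp p).[x]); first by ring.
  by rewrite tau2; ring.
apply: (mulIf dp'); rewrite divfK//; apply: (mulfI x0); rewrite GE.
transitivity (sigma * (x ^+ K * x ^+ 1 * p^`().[x^-1]) * (G.[x] / p^`().[x])); last by ring.
rewrite dV st; transitivity (tau * tau * (x * G.[x])); last by field.
by rewrite tau2 mul1r.
Qed.

End Fixed.

Lemma sum_residues_inner_poly (s : seq F) (n e : nat) sigma (cp cm p0 k m : nat) : uniq s -> size s = n ->
  cp = (p0 + m + 1 + e)%N -> (p0 + k + e < n)%N ->
  let P := root_poly s in let G := inner_poly e sigma cp cm P in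
  \sum_(x <- s) x ^+ (p0 + k) * (G.[x] / P^`().[x])
    = (k == m)%:R + sigma * (cm == (p0 + k).+1)%:R.
Proof.
move=> us sn cpE kn P G.
transitivity (\sum_(x <- s) x ^+ (p0 + k + e) * (drop_poly cp P).[x] / P^`().[x]
  + sigma * \sum_(x <- s) x ^+ (p0 + k) * (drop_poly cm P).[x] / P^`().[x]).
  rewrite mulr_sumr -big_split /=; apply: eq_bigr => x _.
  by rewrite horner_inner_poly [x ^+ (p0 + k + e)]exprD; ring.
rewrite !(sum_residues_drop _ us sn); [|lia|lia].
by congr (_%:R + _); apply/eqP/eqP; lia.
Qed.

End Kernel.

(** * Cramer's rule through a dual family *)

Section Cramer.
Variables (F : fieldType) (N : nat) (T : Type).
Variables (v : 'I_N -> T -> F) (kappa : 'I_N -> T).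
Variables (J : 'I_N -> T -> F) (omega : 'I_N -> F) (c : 'I_N -> 'I_N -> F).
Hypothesis omega0 : forall m, omega m != 0.
Hypothesis JE : forall m a, J m a = \sum_i c m i * v i a.
Hypothesis Jk : forall m k, J m (kappa k) = omega m * (k == m)%:R.

Let A : 'M[F]_N := \matrix_(i, j) v i (kappa j).
Let C : 'M[F]_N := \matrix_(i, j) ((omega i)^-1 * c i j).

Let CA : C *m A = 1%:M.
Proof.
apply/matrixP => i j; rewrite !mxE.
transitivity ((omega i)^-1 * J i (kappa j)).
  by rewrite JE mulr_sumr; apply: eq_bigr => k _; rewrite !mxE mulrA.
by rewrite Jk mulKf// eq_sym.
Qed.

(** The coefficients c, divided by omega, form a left inverse of the matrix. *)
Lemma det_dual_neq0 : \det A != 0.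
Proof.
apply/eqP => A0; have := congr1 determinant CA; rewrite det_mulmx A0 mulr0 det1.
by move/eqP; rewrite eq_sym oner_eq0.
Qed.

(** Multiplied on the left by the inverse, the new matrix is the identity except in
column m, and the entry of that column on the diagonal is the only one that
matters. *)
Lemma det_replace_column m a :
  \det (\matrix_(i, j) v i (if j == m then a else kappa j)) = \det A * (J m a / omega m).
Proof.
set B := (X in \det X).
have detC : \det C * \det A = 1 by rewrite -det_mulmx CA det1.
have CB i j : (C *m B) i j = if j == m then J i a / omega i else (i == j)%:R.
  rewrite !mxE; set b := if j == m then a else kappa j.
  transitivity ((omega i)^-1 * J i b).
    by rewrite JE mulr_sumr; apply: eq_bigr => k _; rewrite !mxE mulrA.
  rewrite /b; case: eqP => _; first by rewrite mulrC.
  by rewrite Jk mulKf// eq_sym.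
have detCB : \det (C *m B) = J m a / omega m.
  rewrite (expand_det_row _ m) (bigD1 m)//= big1 ?addr0; last first.
    by move=> j jm; rewrite CB (negbTE jm) eq_sym (negbTE jm) mul0r.
  rewrite CB eqxx /cofactor -signr_odd addnn odd_double expr0 mul1r.
  rewrite (_ : row' m (col' m (C *m B)) = 1%:M) ?det1 ?mulr1//.
  apply/matrixP => i j; rewrite 2!mxE CB eq_sym (negbTE (neq_lift m j)) mxE.
  by rewrite (inj_eq lift_inj).
by rewrite -detCB det_mulmx mulrA [\det A * _]mulrC detC mul1r.
Qed.

End Cramer.

(** * Functions given by Laurent polynomials *)

Section LaurentFunctions.
Context {R : realType} (N : nat).
Local Notation K := R[i].
Implicit Types (z : 'I_N -> K) (f : ('I_N -> K) -> K).

Definition is_laurent f : Prop := exists P : @laurent R N,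
  forall z, (forall i, z i != 0) -> laurent_eval P z = f z.

Lemma is_laurent_eq f1 f2 : is_laurent f1 ->
  (forall z, (forall i, z i != 0) -> f1 z = f2 z) -> is_laurent f2.
Proof. by move=> [P HP] e; exists P => z z0; rewrite HP// e. Qed.

Lemma is_laurent_cst (c : K) : is_laurent (fun=> c).
Proof.
exists [:: (c, [ffun=> 0])] => z z0; rewrite /laurent_eval big_seq1 /=.
by rewrite big1 ?mulr1// => i _; rewrite ffunE expr0z.
Qed.

Lemma is_laurent_var (j : 'I_N) (e : int) : is_laurent (fun z => z j ^ e).
Proof.
exists [:: (1, [ffun i => if i == j then e else 0])] => z z0.
rewrite /laurent_eval big_seq1 /= mul1r (bigD1 j)//= ffunE eqxx.
by rewrite big1 ?mulr1// => i ij; rewrite ffunE (negbTE ij) expr0z.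
Qed.

Lemma is_laurentD f1 f2 : is_laurent f1 -> is_laurent f2 ->
  is_laurent (fun z => f1 z + f2 z).
Proof.
move=> [P HP] [Q HQ]; exists (P ++ Q) => z z0.
by rewrite /laurent_eval big_cat /= -/(laurent_eval P z) -/(laurent_eval Q z) HP// HQ.
Qed.

Lemma is_laurentM f1 f2 : is_laurent f1 -> is_laurent f2 ->
  is_laurent (fun z => f1 z * f2 z).
Proof.
move=> [P HP] [Q HQ].
exists [seq (s.1 * t.1, [ffun i => s.2 i + t.2 i]) | s : K * {ffun 'I_N -> int} <- P, t : K * {ffun 'I_N -> int} <- Q] => z z0.
rewrite -HP// -HQ// /laurent_eval big_allpairs_dep /= mulr_suml.
apply: eq_bigr => s _; rewrite mulr_sumr; apply: eq_bigr => t _.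
rewrite mulrACA -big_split /=; congr (_ * _); apply: eq_bigr => i _.
by rewrite ffunE expfzDr.
Qed.

Lemma is_laurent_sum (I : Type) (r : seq I) (P : pred I) (f : I -> ('I_N -> K) -> K) :
  (forall i, is_laurent (f i)) -> is_laurent (fun z => \sum_(i <- r | P i) f i z).
Proof.
move=> H; elim: r => [|i r IH].
  by apply: is_laurent_eq (is_laurent_cst 0) _ => z _; rewrite big_nil.
have [Pi|nPi] := boolP (P i).
  by apply: is_laurent_eq (is_laurentD (H i) IH) _ => z _; rewrite big_cons Pi.
by apply: is_laurent_eq IH _ => z _; rewrite big_cons (negbTE nPi).
Qed.

Lemma is_laurent_prod (I : Type) (r : seq I) (P : pred I) (f : I -> ('I_N -> K) -> K) :
  (forall i, is_laurent (f i)) -> is_laurent (fun z => \prod_(i <- r | P i) f i z).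
Proof.
move=> H; elim: r => [|i r IH].
  by apply: is_laurent_eq (is_laurent_cst 1) _ => z _; rewrite big_nil.
have [Pi|nPi] := boolP (P i).
  by apply: is_laurent_eq (is_laurentM (H i) IH) _ => z _; rewrite big_cons Pi.
by apply: is_laurent_eq IH _ => z _; rewrite big_cons (negbTE nPi).
Qed.

Lemma is_laurentX f k : is_laurent f -> is_laurent (fun z => f z ^+ k).
Proof.
move=> H; apply: is_laurent_eq (@is_laurent_prod _ (iota 0 k) predT (fun=> f) _) _ => // z _.
by rewrite big_const_seq count_predT size_iota -Monoid.iteropE.
Qed.

Lemma is_laurent_det n (M : ('I_N -> K) -> 'M[K]_n) :
  (forall i j, is_laurent (fun z => M z i j)) -> is_laurent (fun z => \det (M z)).
Proof.
move=> H; apply: is_laurent_sum => s; apply: is_laurentM (is_laurent_cst _) _.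
exact: is_laurent_prod.
Qed.

End LaurentFunctions.

(** * Newton interpolation *)

Section Newton.
Variable F : comNzRingType.
Implicit Types (p : {poly F}) (a x : F) (U : nat -> F).

(** The quotient of p by X - a, by synthetic division.  The bound M does not depend
on a, which makes the coefficients polynomial functions of a. *)
Definition synthetic M a p : {poly F} :=
  \poly_(j < M) \sum_(k < M | (j < k)%N) p`_k * a ^+ (k - j.+1).

Lemma syntheticE M a p : (size p <= M)%N ->
  p = p.[a]%:P + ('X - a%:P) * synthetic M a p.
Proof.
move=> pM; apply/polyP => j; rewrite coefD coefC mulrBl coefB coefXM coefCM.
have S i : (synthetic M a p)`_i = \sum_(k < M | (i < k)%N) p`_k * a ^+ (k - i.+1).
  rewrite coef_poly; case: ltnP => // Mi; rewrite big1// => k ik.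
  by have := leq_trans (ltn_ord k) Mi; rewrite ltnNge (ltnW ik).
rewrite !S mulr_sumr.
have SaE i : \sum_(k < M | (i < k)%N) a * (p`_k * a ^+ (k - i.+1))
    = \sum_(k < M | (i < k)%N) p`_k * a ^+ (k - i).
  by apply: eq_bigr => k ik; rewrite mulrCA -exprS subnSK.
rewrite SaE; have [jM|Mj] := ltnP j M; last first.
  rewrite nth_default; last exact: leq_trans pM Mj.
  rewrite [\sum_(k < M | _) p`_k * a ^+ (k - j)]big1; last first.
    by move=> k jk; have := leq_trans (ltn_ord k) Mj; rewrite ltnNge (ltnW jk).
  case: j Mj => [|j] Mj; last first.
    rewrite add0r subr0 big1// => k jk.
    by have := leq_trans (ltn_ord k) Mj; rewrite ltnNge jk.
  rewrite (horner_coef_wide _ pM) big1 ?add0r ?subrr ?oppr0 ?addr0//.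
  by move=> k; have := leq_trans (ltn_ord k) Mj.
case: j jM SaE => [|j] jM _ /=.
  rewrite sub0r (horner_coef_wide _ pM) (bigD1 (Ordinal jM))//= expr0 mulr1.
  rewrite -addrA [X in _ + X](_ : _ = 0) ?addr0//; apply/eqP; rewrite subr_eq0; apply/eqP.
  by apply: eq_big => k; rewrite ?lt0n// => _; rewrite subn0.
rewrite add0r (bigD1 (Ordinal jM))//= subnn expr0 mulr1 -addrA.
rewrite [X in _ + X](_ : _ = 0) ?addr0//; apply/eqP; rewrite subr_eq0; apply/eqP.
by apply: eq_bigl => k; rewrite -(inj_eq val_inj) /=; lia.
Qed.

Fixpoint newton M U p l : {poly F} :=
  if l is l'.+1 then synthetic M (U l') (newton M U p l') else p.

Lemma size_newton M U p l : (size p <= M)%N -> (size (newton M U p l) <= M)%N.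
Proof. by case: l => //= l _; exact: size_poly. Qed.

(** The values (newton M U p l).[U l] are the divided differences of p at
U 0, ..., U l. *)
Lemma newton_expansion M U p n x : (size p <= M)%N ->
  p.[x] = \sum_(l < n) (newton M U p l).[U l] * \prod_(r < l) (x - U r)
        + (newton M U p n).[x] * \prod_(r < n) (x - U r).
Proof.
move=> pM; elim: n => [|n IH]; first by rewrite !big_ord0 add0r mulr1.
rewrite IH big_ord_recr /= -addrA; congr (_ + _).
rewrite {1}(syntheticE (U n) (size_newton U n pM)) !hornerE /= big_ord_recr /=.
by ring.
Qed.

Lemma newton_at_node M U p (n : nat) (j : 'I_n) : (size p <= M)%N ->
  p.[U j] = \sum_(l < n) (newton M U p l).[U l] * \prod_(r < l) (U j - U r).
Proof.
move=> pM; rewrite (newton_expansion U n (U j) pM) [X in _ + _ * X](bigD1 j)//= subrr.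
by rewrite mul0r mulr0 addr0.
Qed.

(** Newton's formula factors the matrix, and the factor formed by the products of
differences is triangular. *)
Lemma det_newton M U n (p : 'I_n -> {poly F}) : (forall i, (size (p i) <= M)%N) ->
  \det (\matrix_(i, j) (p i).[U j]) =
  \det (\matrix_(i < n, l < n) (newton M U (p i) l).[U l])
   * \prod_(j < n) \prod_(r < j) (U j - U r).
Proof.
move=> pM; pose T : 'M[F]_n := \matrix_(l, j) \prod_(r < l) (U j - U r).
have -> : \matrix_(i, j) (p i).[U j] =
    (\matrix_(i < n, l < n) (newton M U (p i) l).[U l]) *m T.
  apply/matrixP => i j; rewrite !mxE (newton_at_node U j (pM i)).
  by apply: eq_bigr => l _; rewrite !mxE.
rewrite det_mulmx -(det_tr T) [\det T^T]det_trig; last first.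
  apply/is_trig_mxP => i j ij; rewrite !mxE (bigD1 (Ordinal ij))//= subrr mul0r//.
by congr (_ * _); apply: eq_bigr => j _; rewrite !mxE.
Qed.

End Newton.

(** * The characters are Laurent polynomials *)

Section CharacterPolynomials.
Context {R : realType}.
Local Notation K := R[i].

(** Polynomials of Chebyshev type in u = x + 1 / x, by the recursion
e_(k+2) = u e_(k+1) - e_k; two consecutive terms are carried along. *)
Fixpoint entry_poly_pair G k : {poly K} * {poly K} :=
  if k is k'.+1 then
    let p := entry_poly_pair G k' in (p.2, 'X * p.2 - p.1)
  else match G with
    | TypeB => (1, 'X + 1) | TypeC => (1, 'X) | TypeD => (2%:P, 'X)
    end.

Definition entry_poly G k : {poly K} := (entry_poly_pair G k).1.

Lemma entry_num_rec G k (x : K) : x != 0 ->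
  entry_num G k.+2 x = (x + x^-1) * entry_num G k.+1 x - entry_num G k x.
Proof.
move=> x0; case: G; rewrite /entry_num; [|rewrite !addn1 !exprS|rewrite !exprS].
- set y := sqrtC x; have y2 : x = y ^+ 2 by rewrite sqrtCK.
  have y0 : y != 0 by apply: contraNneq x0 => y0; rewrite y2 y0 expr0n.
  have -> : (2 * k.+2 + 1 = 2 * k + 1 + 4)%N by lia.
  have -> : (2 * k.+1 + 1 = 2 * k + 1 + 2)%N by lia.
  by rewrite y2 !exprD; field; rewrite y0 expf_neq0.
- by field; rewrite x0 expf_neq0.
- by field; rewrite x0 expf_neq0.
Qed.

Lemma entry_polyE G k (x : K) : x != 0 -> entry_den G x != 0 ->
  entry_num G k x / entry_den G x = (entry_poly G k).[x + x^-1].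
Proof.
move=> x0 d0.
suff [] : entry_num G k x / entry_den G x = (entry_poly_pair G k).1.[x + x^-1] /\
          entry_num G k.+1 x / entry_den G x = (entry_poly_pair G k).2.[x + x^-1] by [].
elim: k => [|k [IH1 IH2]]; last first.
  split=> //=; rewrite hornerD hornerN hornerM hornerX -IH1 -IH2 entry_num_rec//.
  by ring.
case: G d0 => d0 /=; rewrite !hornerE /entry_num.
- move: d0; rewrite /entry_den; set y := sqrtC x => d0.
  have y2 : x = y ^+ 2 by rewrite sqrtCK.
  have y0 : y != 0 by apply: contraNneq x0 => y0; rewrite y2 y0 expr0n.
  have y1 : y * y - 1 != 0.
    apply: contraNneq d0 => /eqP; rewrite subr_eq0 => /eqP yy.
    by apply/eqP/(mulfI y0); rewrite mulrBr yy mulfV// subrr mulr0.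
  by split; [rewrite divff|rewrite y2; field; rewrite y0].
- rewrite /entry_den in d0 *; split; first by rewrite divff.
  have x1 : x * x - 1 != 0.
    apply: contraNneq d0 => /eqP; rewrite subr_eq0 => /eqP yy.
    by apply/eqP/(mulfI x0); rewrite mulrBr yy mulfV// subrr mulr0.
  by field; rewrite x0.
- by rewrite /entry_den; split; rewrite ?expr0 ?expr1 ?invr1 ?mulr1.
Qed.

Section Existence.
Variables (N : nat).
Implicit Types (z : 'I_N -> K).

(** The index is a natural number, as in the Newton expansion, so the family of the
nodes is extended by 0. *)
Definition node_sum z (r : nat) : K :=
  oapp (fun i : 'I_N => z i + (z i)^-1) 0 (insub r).

Lemma node_sum_ord z (i : 'I_N) : node_sum z i = z i + (z i)^-1.
Proof. by rewrite /node_sum valK. Qed.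

Lemma is_laurent_node_sum r : is_laurent (fun z => node_sum z r).
Proof.
rewrite /node_sum; case: insubP => [i _ _|_] /=; last exact: is_laurent_cst.
exact: is_laurentD (is_laurent_var i 1) (is_laurent_var i (-1)).
Qed.

Lemma is_laurent_newton_coef M (p : {poly K}) l j :
  is_laurent (fun z => (newton M (node_sum z) p l)`_j).
Proof.
elim: l j => [|l IH] j /=; first exact: is_laurent_cst.
have [jM|Mj] := ltnP j M; last first.
  by apply: is_laurent_eq (is_laurent_cst _ 0) _ => z _; rewrite coef_poly ltnNge Mj.
have H : is_laurent (fun z => \sum_(k < M | (j < k)%N)
    (newton M (node_sum z) p l)`_k * node_sum z l ^+ (k - j.+1)).
  apply: is_laurent_sum => k; apply: is_laurentM (IH k) _.
  exact: is_laurentX (is_laurent_node_sum l).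
by apply: is_laurent_eq H _ => z _; rewrite coef_poly jM.
Qed.

Lemma is_laurent_newton M (p : {poly K}) l : (size p <= M)%N ->
  is_laurent (fun z => (newton M (node_sum z) p l).[node_sum z l]).
Proof.
move=> pM.
have H : is_laurent (fun z => \sum_(k < M)
    (newton M (node_sum z) p l)`_k * node_sum z l ^+ k).
  apply: is_laurent_sum => k; apply: is_laurentM.
    exact: is_laurent_newton_coef.
  exact: is_laurentX (is_laurent_node_sum l).
by apply: is_laurent_eq H _ => z _; rewrite -horner_coef_wide// size_newton.
Qed.

Lemma prod_node_sum z :
  \prod_(j < N) \prod_(r < j) (node_sum z j - node_sum z r)
  = (\prod_(i < N) \prod_(j < N | (i < j)%N) -1) * Vs z.
Proof.
transitivity (\prod_(j < N) \prod_(i < N | (i < j)%N) - (z i + (z i)^-1 - z j - (z j)^-1)).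
  apply: eq_bigr => j _; rewrite (big_ord_widen N (fun r => node_sum z j - node_sum z r)) ?(ltnW (ltn_ord j))//.
  by apply: eq_bigr => i _; rewrite !node_sum_ord; ring.
rewrite (exchange_big_dep predT)//= /Vs -big_split; apply: eq_bigr => i _ /=.
by rewrite -big_split; apply: eq_bigr => j _; rewrite /= mulN1r.
Qed.

(** Divide det_newton by the Vandermonde product: the remaining determinant has
entries which are polynomial in the variables z + 1 / z. *)
Lemma exists_character G (lam : 'I_N -> nat) : exists P, is_character G lam P (R := R).
Proof.
pose p (i : 'I_N) := entry_poly G (lam i + (N - i.+1)).
pose M := \max_i size (p i).
have pM i : (size (p i) <= M)%N by exact: leq_bigmax.
have [P HP] : is_laurent (fun z => \det (\matrix_(i < N, l < N)
      (newton M (node_sum z) (p i) l).[node_sum z l])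
     * (\prod_(i < N) \prod_(j < N | (i < j)%N) -1)).
  apply: is_laurentM; last exact: is_laurent_cst.
  apply: is_laurent_det => i l.
  by apply: is_laurent_eq (is_laurent_newton _ (pM i)) _ => z _; rewrite mxE.
exists P => z z0 d0 V0; rewrite HP// /character_quotient.
apply: (mulIf V0); rewrite divfK// -mulrA -prod_node_sum -det_newton//.
congr (\det _); apply/matrixP => i j; rewrite !mxE node_sum_ord.
by rewrite entry_polyE.
Qed.

Lemma chiE G (lam : 'I_N -> nat) z : (forall i, z i != 0) ->
  (forall i, entry_den G (z i) != 0) -> Vs z != 0 ->
  chi G lam z = character_quotient G lam z.
Proof.
move=> z0 d0 V0; rewrite /chi.
have [P HP] := exists_character G lam.
have : is_character G lam (character_laurent (R := R) G lam).
  by rewrite /character_laurent; case: xgetP => [Q _ //|/(_ P)]; case.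
exact.
Qed.

End Existence.
End CharacterPolynomials.

(** * Powers of q *)

Section QPowers.
Context {R : realType}.
Variable q : R.
Hypotheses (q_gt0 : 0 < q) (q_lt1 : q < 1).
Local Notation K := R[i].
Implicit Types (a b : K) (r : R).

Lemma qpowD a b : qpow q (a + b) = qpow q a * qpow q b.
Proof. by rewrite /qpow mulrDl cexpD. Qed.

Lemma qpow0 : qpow q 0 = 1.
Proof. by rewrite /qpow mul0r cexp0. Qed.

Lemma qpow_neq0 a : qpow q a != 0.
Proof. exact: cexp_neq0. Qed.

Lemma qpowN a : qpow q (- a) = (qpow q a)^-1.
Proof. by rewrite /qpow mulNr cexpN. Qed.

Lemma qpowMn n a : qpow q (n%:R * a) = qpow q a ^+ n.
Proof. by rewrite /qpow -mulrA cexpMn. Qed.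

Lemma qpow_real r : qpow q r%:C = (q `^ r)%:C.
Proof.
rewrite /qpow -rmorphM /= /cexp /= cos0 sin0 mulr1 mulr0.
by rewrite /powR gt_eqF.
Qed.

Lemma ln_q : ln q < 0.
Proof. by rewrite ln_lt0// q_gt0. Qed.

Lemma powR_q_inj r r' : q `^ r = q `^ r' -> r = r'.
Proof.
move=> /(congr1 (@ln R)); rewrite !ln_powR => /mulIf; apply.
by rewrite lt_eqF// ln_q.
Qed.

Lemma qpow_real_eq1 r : (qpow q r%:C == 1) = (r == 0).
Proof.
apply/eqP/eqP => [|->]; last exact: qpow0.
rewrite qpow_real => /eqP; rewrite eq_complex /= => /andP[/eqP h _].
by apply: powR_q_inj; rewrite h powRr0.
Qed.

Lemma cpow_q r b : cpow (q `^ r)%:C b = qpow q (r%:C * b).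
Proof.
rewrite cpow_pos ?powR_gt0// ln_powR rmorphM /= /qpow; congr cexp.
by ring.
Qed.

Lemma cpow_nat (x : R) n : 0 < x -> cpow x%:C n%:R = x%:C ^+ n.
Proof.
move=> x0; have sx := slit_pos x0.
by rewrite /cpow cexpMn cexp_clog.
Qed.

End QPowers.

(** * The sum over the nodes *)

Section Core.
Context {R : realType}.
Variable q : R.
Hypotheses (q_gt0 : 0 < q) (q_lt1 : q < 1).
Local Notation K := R[i].
Variables (N : nat) (el : 'I_N -> R).
Hypotheses (el_ge0 : forall i, 0 <= el i) (el_inj : injective el).

Definition support_nodes : seq 'I_N := [seq i <- enum 'I_N | el i != 0].

(** For el i = 0 the nodes q^(el i) and q^(- el i) coincide with 1, so they are left
out, and h tells whether the node 1 is put back (once). *)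
Definition node_seq h : seq R :=
  nseq h 1 ++ [seq q `^ el i | i <- support_nodes]
    ++ [seq q `^ (- el i) | i <- support_nodes].

Definition node_poly h : {poly K} := root_poly [seq x%:C | x <- node_seq h].

Lemma node_seq_gt0 h x : x \in node_seq h -> 0 < x.
Proof.
rewrite !mem_cat => /or3P[/nseqP[-> _]|/mapP[i _ ->]|/mapP[i _ ->]] //.
- exact: powR_gt0.
- exact: powR_gt0.
Qed.

Lemma uniq_node_seq h : (h <= 1)%N -> uniq (node_seq h).
Proof.
move=> h1; have us : uniq support_nodes by rewrite filter_uniq// enum_uniq.
rewrite !cat_uniq; apply/and5P; split.
- by case: h h1 => [|[]].
- apply/hasPn => x; rewrite mem_cat => /orP[]/mapP[i + ->]; rewrite mem_filter => /andP[ei _].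
    apply/negP => /nseqP[e _]; move: ei; rewrite -(qpow_real_eq1 q_gt0 q_lt1) qpow_real// e.
    by rewrite eqxx.
  apply/negP => /nseqP[e _]; move: ei; rewrite -oppr_eq0 -(qpow_real_eq1 q_gt0 q_lt1) qpow_real// e.
  by rewrite eqxx.
- rewrite map_inj_in_uniq// => i j _ _ /(powR_q_inj q_gt0 q_lt1); exact: el_inj.
- apply/hasPn => x /mapP[i + ->]; rewrite mem_filter => /andP[ei _].
  apply/negP => /mapP[j _ /(powR_q_inj q_gt0 q_lt1) e].
  have := el_ge0 i; have := el_ge0 j; rewrite -e oppr_ge0 => e1 e2.
  by move: ei; rewrite eq_le e1 e2.
- by rewrite map_inj_in_uniq// => i j _ _ /(powR_q_inj q_gt0 q_lt1)/oppr_inj; exact: el_inj.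
Qed.

Lemma size_node_seq h : size (node_seq h) = (h + 2 * size support_nodes)%N.
Proof. by rewrite !size_cat size_nseq !size_map mul2n addnn. Qed.

Lemma palindromic_node_poly h :
  palindromic (h + 2 * size support_nodes) ((-1) ^+ h) (node_poly h).
Proof.
rewrite /node_poly /root_poly !map_cat !big_cat /= !big_map -[X in palindromic _ X]mulr1; apply: palindromicM.
  elim: h => [|h IH] /=; first by rewrite big_nil; exact: palindromic1.
  by have := palindromicM (@palindromic_XsubC1 _) IH; rewrite big_cons exprS !rmorph1.
rewrite -big_split /=; elim: support_nodes => [|i r IH] /=.
  by rewrite big_nil; exact: palindromic1.
rewrite big_cons mulnS -[1]mulr1; apply: palindromicM IH.
rewrite powRN fmorphV; apply: palindromic_pair.
by rewrite -(qpow_real q_gt0) qpow_neq0.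
Qed.

Variables (sigma : K) (h n e p0 k0 : nat) (eps0 : R) (cp cm : nat -> nat).
Let tau : K := (-1) ^+ h.
Hypotheses (h1 : (h <= 1)%N) (nE : n = (h + 2 * size support_nodes)%N).
(* The numbers that distinguish the types: inner_poly has parameters e, cp, cm and
   sigma, and the outer power of z is a + p0 - eps0. *)
Hypotheses (cpE : forall m, cp m = (p0 + m + 1 + e)%N) (pN : (p0 + e + N <= n)%N).
Hypotheses (sigma2 : sigma * sigma = 1) (k0E : k0%:R = 2 * (p0%:R - eps0) :> R).
Hypothesis parity : forall m, (m < N)%N ->
  [/\ (e <= 1)%N, (cp m + cm m = n.+1)%N, (0 < cm m)%N & n = (k0 + e).+1] \/
  [/\ e = 0%N, (cp m + cm m = n)%N, n = k0.+2 & sigma = - tau].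
Hypothesis middle : h = 0%N \/ sigma = -1 \/ sigma = 1 /\ exists i0, el i0 = 0.

Definition residue_sum m a : K := \sum_(x <- node_seq h)
  cpow x%:C (a + p0%:R - eps0%:C) *
    ((inner_poly e sigma (cp m) (cm m) (node_poly h)).[x%:C] / (node_poly h)^`().[x%:C]).

Definition basis_fun (i : 'I_N) a : K :=
  qpow q ((el i)%:C * a) + sigma * qpow q (- ((el i)%:C * a)).

Let G m := inner_poly e sigma (cp m) (cm m) (node_poly h).

Let uniqC : uniq [seq x%:C | x <- node_seq h].
Proof. by rewrite map_inj_uniq ?uniq_node_seq//; exact: complexI. Qed.

Let size_P : (size (node_poly h) <= n.+1)%N.
Proof. by rewrite size_root_poly size_map size_node_seq nE. Qed.

Let pal_P : palindromic n tau (node_poly h).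
Proof. by rewrite nE; exact: palindromic_node_poly. Qed.

Let tau2 : tau * tau = 1.
Proof. by rewrite -expr2 sqrr_sign. Qed.

Let weight_inv m x : (m < N)%N -> x \in node_seq h ->
  (G m).[x%:C^-1] / (node_poly h)^`().[x%:C^-1]
  = sigma * x%:C ^+ k0 * ((G m).[x%:C] / (node_poly h)^`().[x%:C]).
Proof.
move=> mN xs; have x0 : x%:C != 0 :> K.
  by rewrite (inj_eq (@complexI _) x 0) gt_eqF// (node_seq_gt0 xs).
have xC : x%:C \in [seq x%:C | x <- node_seq h] by apply: map_f.
have px := root_poly_root xC.
have dp := deriv_root_poly_neq0 uniqC xC.
have [[e1 cc cm0 nK]|[e0 cc nK st]] := parity mN.
  by apply: (inner_poly_inv_odd size_P pal_P) => //; rewrite cpE addn1 addSn.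
by rewrite /G e0; apply: (inner_poly_inv_even size_P pal_P).
Qed.

(** The weights of x and 1 / x are related by weight_inv, and the power of x in that
relation is the one that turns the two terms into a multiple of basis_fun.
The node 1 is its own inverse: its weight vanishes if sigma = -1, and otherwise
it is half of a multiple of the basis function with el i = 0. *)
Lemma residue_sum_basis m : (m < N)%N ->
  exists c : 'I_N -> K, forall a, residue_sum m a = \sum_i c i * basis_fun i a.
Proof.
move=> mN.
pose w (x : R) : K := (G m).[x%:C] / (node_poly h)^`().[x%:C].
pose c1 i := if el i == 0 then 0 else qpow q ((el i)%:C * (p0%:R - eps0%:C)) * w (q `^ el i).
have E a : residue_sum m a = h%:R * w 1 + \sum_i c1 i * basis_fun i a.
  rewrite /residue_sum !big_cat /= !big_map; congr (_ + _).
    rewrite big_nseq iter_addr_0 mulr_natl -[w 1]mul1r; congr (_ * _ *+ _).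
    by rewrite -(powRr0 q) (cpow_q q_gt0) mul0r qpow0.
  rewrite -big_split /= big_filter big_enum_cond /= [RHS](bigID (fun i => el i != 0)) /=.
  rewrite [X in _ = _ + X]big1 ?addr0; last first.
    by move=> i; rewrite negbK /c1 => ->; rewrite mul0r.
  apply: eq_bigr => i ei; rewrite /c1 (negbTE ei) /basis_fun !(cpow_q q_gt0).
  have iS : i \in support_nodes by rewrite mem_filter ei mem_enum.
  have iN : q `^ el i \in node_seq h by rewrite !mem_cat (map_f (fun i => q `^ el i) iS) orbT.
  have -> : (q `^ (- el i))%:C = (q `^ el i)%:C^-1 :> K by rewrite powRN fmorphV.
  rewrite (weight_inv mN iN) -/(w (q `^ el i)).
  rewrite -(qpow_real q_gt0) -qpowMn.
  have -> : (k0%:R : K) = 2 * (p0%:R - eps0%:C).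
    have := congr1 (real_complex R) k0E.
    by rewrite rmorphM rmorphB /= !rmorph_nat.
  transitivity (qpow q ((el i)%:C * (a + p0%:R - eps0%:C)) * w (q `^ el i)
    + sigma * (qpow q ((- el i)%:C * (a + p0%:R - eps0%:C))
      * qpow q (2 * (p0%:R - eps0%:C) * (el i)%:C)) * w (q `^ el i)); first by ring.
  rewrite -qpowD.
  have -> : (el i)%:C * (a + p0%:R - eps0%:C)
    = (el i)%:C * (p0%:R - eps0%:C) + (el i)%:C * a by ring.
  have -> : (- el i)%:C * (a + p0%:R - eps0%:C) + 2 * (p0%:R - eps0%:C) * (el i)%:C
    = (el i)%:C * (p0%:R - eps0%:C) + - ((el i)%:C * a) by rewrite rmorphN /=; ring.
  by rewrite !qpowD; ring.
have [h0|[s1|[s1 [i0 ei0]]]] := middle.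
- by exists c1 => a; rewrite E h0 mul0r add0r.
- have w10 : h%:R * w 1 = 0.
    case: (posnP h) => [->|hp]; first by rewrite mul0r.
    have := @weight_inv m 1 mN; rewrite mem_cat mem_nseq hp eqxx => /(_ isT).
    rewrite invr1 expr1n mulr1 -/(w 1) s1 mulN1r => /eqP.
    by rewrite -subr_eq0 opprK -mulr2n mulrn_eq0 /= => /eqP ->; rewrite mulr0.
  by exists c1 => a; rewrite E w10 add0r.
- exists (fun i => c1 i + (i == i0)%:R * (h%:R * w 1 / 2)) => a.
  under eq_bigr do rewrite mulrDl.
  rewrite big_split /= E addrC; congr (_ + _).
  rewrite (bigD1 i0)//= eqxx big1 ?addr0; last by move=> i /negbTE ->; rewrite !mul0r.
  have -> : basis_fun i0 a = 2 by rewrite /basis_fun ei0 mul0r oppr0 !qpow0 s1 mulr1.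
  by rewrite mul1r divfK.
Qed.

(** At these exponents the powers in the sum are integral. *)
Lemma residue_sum_node m k : (k < N)%N ->
  residue_sum m (k%:R + eps0%:C) = (k == m)%:R + sigma * (cm m == (p0 + k).+1)%:R.
Proof.
move=> kN.
have us : size [seq x%:C | x <- node_seq h] = n by rewrite size_map size_node_seq.
have kn : (p0 + k + e < n)%N by lia.
have := sum_residues_inner_poly sigma (cm m) uniqC us (cpE m) kn => /= <-.
rewrite big_map [LHS]big_seq [RHS]big_seq; apply: eq_bigr => x xs; congr (_ * _).
rewrite -(cpow_nat _ (node_seq_gt0 xs)); congr (cpow _ _).
by rewrite natrD; ring.
Qed.

Variable omega : 'I_N -> K.
Hypotheses (omega0 : forall m, omega m != 0).
Hypothesis omegaE : forall m k : 'I_N,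
  (k == m)%:R + sigma * (cm m == (p0 + k).+1)%:R = omega m * (k == m)%:R.

Let kappa (j : 'I_N) : K := j%:R + eps0%:C.

Lemma core_det :
  \det (\matrix_(i, j) basis_fun i (kappa j)) != 0 /\
  forall (m : 'I_N) a,
    \det (\matrix_(i, j) basis_fun i (if j == m then a else kappa j))
    = \det (\matrix_(i, j) basis_fun i (kappa j)) * (residue_sum m a / omega m).
Proof.
have [c cE] := choice (fun m : 'I_N => residue_sum_basis (ltn_ord m)).
have Jk (m k : 'I_N) : residue_sum m (kappa k) = omega m * (k == m)%:R.
  by rewrite residue_sum_node// omegaE.
split.
  exact: (det_dual_neq0 (J := fun m : 'I_N => residue_sum m) (c := c) omega0 cE Jk).
move=> m a.
exact: (det_replace_column (J := fun m : 'I_N => residue_sum m) (c := c) omega0 cE Jk).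
Qed.

End Core.

(** * The prefactor *)

Section VandermondeRatio.
Context {R : realType}.
Local Notation K := R[i].
Local Notation u x := (x + x^-1).

Lemma Vs_replace_coordinate N (m : 'I_N) (z : nat -> K) : exists C : K, forall x,
  Vs (fun j : 'I_N => if j == m then x else z j)
  = C * ((\prod_(k < N | (k < m)%N) (u (z k) - u x))
       * (\prod_(k < N | (m < k)%N) (u (z k) - u x))).
Proof.
exists ((\prod_(j < N | (m < j)%N) -1) *
  \prod_(i < N | i != m) \prod_(j < N | (i < j)%N && (j != m)) (u (z i) - u (z j))) => x.
pose point (j : 'I_N) := if j == m then x else z j; rewrite -/point.
have E i : i != m -> \prod_(j < N | (i < j)%N)
     (point i + (point i)^-1 - point j - (point j)^-1)
   = (if (i < m)%N then u (z i) - u x else 1)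
     * \prod_(j < N | (i < j)%N && (j != m)) (u (z i) - u (z j)).
  move=> im; rewrite (bigID (fun j => j == m)) /=; congr (_ * _).
    rewrite big_mkcondl big_pred1_eq /point (negbTE im) eqxx.
    by case: ifP => // _; ring.
  apply: eq_bigr => j /andP[_ jm]; rewrite /point (negbTE im) (negbTE jm); ring.
rewrite /Vs (bigD1 m)//=.
rewrite (eq_bigr _ E).
rewrite big_split /= -big_mkcondr /=.
have -> : \prod_(i < N | (i != m) && (i < m)%N) (u (z i) - u x)
    = \prod_(k < N | (k < m)%N) (u (z k) - u x).
  by apply: eq_bigl => i; rewrite -(inj_eq val_inj) ltn_neqAle andbA andbb.
have -> : \prod_(j < N | (m < j)%N) (point m + (point m)^-1 - point j - (point j)^-1)
    = (\prod_(j < N | (m < j)%N) -1) * \prod_(k < N | (m < k)%N) (u (z k) - u x).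
  rewrite -big_split /=; apply: eq_bigr => j mj; rewrite /point eqxx.
  by rewrite -(inj_eq val_inj) gtn_eqF//; ring.
by ring.
Qed.

End VandermondeRatio.

Section Normalized.
Context {R : realType}.
Variable q : R.
Hypotheses (q_gt0 : 0 < q) (q_lt1 : q < 1).
Local Notation K := R[i].
Implicit Types (a b : K).

Definition sign_of G : K := if G is TypeD then 1 else -1.

Definition den_factor G b : K :=
  match G with
  | TypeB => qpow q (b / 2) - qpow q (- (b / 2))
  | TypeC => qpow q b - qpow q (- b)
  | TypeD => 1
  end.

Definition epsC G : K := (eps G)%:C.

(** The numerator and the denominator in type B change sign together with the choice
of the square root of q^b. *)
Lemma entry_quotient G k b : den_factor G b != 0 ->
  entry_den G (qpow q b) != 0 /\
  entry_num G k (qpow q b) / entry_den G (qpow q b)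
  = (qpow q ((k%:R + eps G)%:C * b) + sign_of G * qpow q (- ((k%:R + eps G)%:C * b)))
    / den_factor G b.
Proof.
case: G => d0; rewrite /entry_num /entry_den /den_factor in d0 *.
- set y := sqrtC _; set h := qpow q (b / 2) in d0 *.
  have h0 : h != 0 by exact: qpow_neq0.
  have hE : qpow q b = h ^+ 2.
    by rewrite /h expr2 -qpowD; congr (qpow _ _); field.
  have : y ^+ 2 == h ^+ 2 by rewrite -hE sqrtCK.
  have pE : qpow q ((k%:R + 1 / 2)%:C * b) = h ^+ (2 * k + 1).
    rewrite /h -qpowMn; congr (qpow _ _).
    by rewrite rmorphD rmorph_nat fmorph_div rmorph1 rmorph_nat natrD natrM; field.
  rewrite /eps !qpowN pE /sign_of.
  rewrite qpowN -/h in d0 *.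
  rewrite eqf_sqr => /orP[]/eqP ->; first by rewrite mulN1r.
  have o : odd (2 * k + 1) by rewrite oddD oddM.
  have d1 : - h - (- h)^-1 = - (h - h^-1) by rewrite invrN; ring.
  rewrite d1 oppr_eq0 d0; split=> //.
  have hN : (- h) ^+ (2 * k + 1) = - h ^+ (2 * k + 1).
    by rewrite exprNn -signr_odd o expr1 mulN1r.
  by rewrite hN !invrN; ring.
- rewrite qpowN in d0 *; split=> //; congr (_ / _).
  rewrite qpowN /sign_of mulN1r.
  have -> : qpow q ((k%:R + eps TypeC)%:C * b) = qpow q b ^+ (k + 1).
    by rewrite -qpowMn; congr (qpow _ _); rewrite rmorphD rmorph_nat rmorph1 natrD.
  by [].
- split; rewrite ?oner_neq0//; congr (_ / _); rewrite qpowN mul1r.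
  have -> : qpow q ((k%:R + eps TypeD)%:C * b) = qpow q b ^+ k.
    by rewrite -qpowMn; congr (qpow _ _); rewrite rmorphD rmorph_nat rmorph0 addr0.
  by [].
Qed.

Lemma character_quotient_qpow G N (lam : 'I_N -> nat) (b : 'I_N -> K) :
  (forall j, den_factor G (b j) != 0) ->
  character_quotient G lam (fun j => qpow q (b j))
  = \det (\matrix_(i, j) basis_fun q (ell G lam) (sign_of G) i (b j))
    / (\prod_j den_factor G (b j)) / Vs (fun j => qpow q (b j)).
Proof.
move=> d0; rewrite /character_quotient; congr (_ / _).
rewrite -prodfV -[X in _ = _ * X](eq_bigr _ (fun j _ => erefl)).
pose d : 'rV[K]_N := \row_j (den_factor G (b j))^-1.
have -> : \prod_j (den_factor G (b j))^-1 = \det (diag_mx d).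
  by rewrite det_diag; apply: eq_bigr => j _; rewrite mxE.
rewrite -det_mulmx; congr (\det _); apply/matrixP => i j.
rewrite mul_mx_diag !mxE; have [_ ->] := entry_quotient (lam i + (N - i.+1)) (d0 j).
by [].
Qed.

(** Up to the factor q^k, the difference of q^k + q^(-k) and q^b + q^(-b). *)
Definition dist_factor k b : K := (1 - qpow q (k + b)) * (1 - qpow q (k - b)).

Lemma dist_factorE k b : qpow q k + (qpow q k)^-1 - (qpow q b + (qpow q b)^-1)
  = (qpow q k)^-1 * dist_factor k b.
Proof.
rewrite /dist_factor !qpowD qpowN; have := qpow_neq0 q k; have := qpow_neq0 q b.
by move=> h1 h2; field; rewrite h1 h2.
Qed.

Definition pochhammers G (N m : nat) b : K :=
  qpochs [:: qpow q (epsC G + b); qpow q (epsC G - b)] q m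
  * qpochs [:: qpow q (m%:R + 1 + epsC G + b); qpow q (m%:R + 1 + epsC G - b)] q (N - m - 1).

Lemma qpow_nat n : qpow q n%:R = (q ^+ n)%:C.
Proof.
rewrite -[n%:R]mulr1 qpowMn rmorphXn /= -[1](rmorph1 (real_complex R)) qpow_real//.
by rewrite powRr1// ltW.
Qed.

Lemma qpochs2 (c b : K) n : qpochs [:: qpow q (c + b); qpow q (c - b)] q n
  = \prod_(i < n) dist_factor (i%:R + c) b.
Proof.
rewrite /qpochs big_cons big_seq1 /qpoch -big_split /=; apply: eq_bigr => i _.
by rewrite -!qpow_nat -!qpowD /dist_factor; congr ((1 - qpow _ _) * (1 - qpow _ _)); ring.
Qed.

Lemma pochhammersE G N (m : 'I_N) b : pochhammers G N m b =
  (\prod_(k < N | (k < m)%N) dist_factor (k%:R + epsC G) b)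
  * (\prod_(k < N | (m < k)%N) dist_factor (k%:R + epsC G) b).
Proof.
rewrite /pochhammers !qpochs2; congr (_ * _).
  by rewrite (big_ord_widen N (fun k => dist_factor (k%:R + epsC G) b)) ?(ltnW (ltn_ord m)).
have -> : \prod_(k < N | (m < k)%N) dist_factor (k%:R + epsC G) b
    = \prod_(m.+1 <= k < N) dist_factor (k%:R + epsC G) b.
  by rewrite big_geq_mkord; apply: eq_bigl => k.
have -> : (N - m - 1 = N - m.+1)%N by lia.
rewrite -[X in index_iota X _]add0n big_addn big_mkord; apply: eq_bigr => i _.
have -> : (i + m.+1)%:R = i%:R + (m%:R + 1) :> K by rewrite natrD natr1.
by rewrite [in RHS]addrA !addrA.
Qed.

Variables (G : lie_type) (N : nat) (lam : 'I_N -> nat).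

Let kappa (j : 'I_N) : K := j%:R + epsC G.
Let shifted (m : 'I_N) a (j : 'I_N) : K := if j == m then a else kappa j.

Lemma base_pointE j : base_point G q j = qpow q (kappa j).
Proof. by rewrite /base_point /kappa /epsC rmorphD rmorph_nat. Qed.

Lemma shifted_pointE (m : 'I_N) a j : shifted_point G q m a j = qpow q (shifted m a j).
Proof.
rewrite /shifted_point /shifted base_pointE -(inj_eq val_inj).
by case: ifP.
Qed.

Lemma shifted_kappa m j : shifted m (kappa m) j = kappa j.
Proof. by rewrite /shifted; case: eqP => // ->. Qed.

(** Only the differences that involve the coordinate m depend on it, and they are
the factors of the q-Pochhammer symbols. *)
Lemma Vs_shifted (m : 'I_N) a b :
  Vs (fun j => qpow q (shifted m a j)) * pochhammers G N m b
  = Vs (fun j => qpow q (shifted m b j)) * pochhammers G N m a.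
Proof.
have [C HC] := Vs_replace_coordinate m (fun k => qpow q (k%:R + epsC G)).
have E c : Vs (fun j => qpow q (shifted m c j)) = C *
    ((\prod_(k < N | (k < m)%N) (qpow q (k%:R + epsC G))^-1)
     * (\prod_(k < N | (m < k)%N) (qpow q (k%:R + epsC G))^-1)) * pochhammers G N m c.
  rewrite pochhammersE -mulrA [X in C * X]mulrACA -!big_split /=.
  rewrite (_ : Vs _ = Vs (fun j : 'I_N => if j == m then qpow q c
      else qpow q (j%:R + epsC G))); last first.
    by congr Vs; apply/funext => j; rewrite /shifted; case: ifP.
  rewrite HC; congr (_ * (_ * _)); apply: eq_bigr => k _; exact: dist_factorE.
by rewrite !E mulrAC.
Qed.

Lemma kappa_gt0 (j : 'I_N) : (0 < j)%N -> 0 < j%:R + eps G :> R.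
Proof.
by move=> j0; rewrite ltr_pwDl ?ltr0n//; case: G => /=; rewrite ?divr_ge0.
Qed.

Lemma kappaE j : kappa j = (j%:R + eps G)%:C.
Proof. by rewrite /kappa /epsC rmorphD rmorph_nat. Qed.

Lemma den_factor_kappa j : den_factor G (kappa j) != 0.
Proof.
have D r : 0 < r -> qpow q r%:C - qpow q (- r%:C) != 0.
  move=> r0; rewrite qpowN subr_eq0; apply/eqP => h.
  have : qpow q (r + r)%:C == 1.
    by rewrite rmorphD qpowD {1}h mulVf// qpow_neq0.
  by rewrite qpow_real_eq1// gt_eqF// addr_gt0.
rewrite kappaE; case: G => /=; last exact: oner_neq0.
- have -> : (j%:R + 1 / 2)%:C / 2 = ((j%:R + 1 / 2) / 2 : R)%:C :> K.
    by rewrite fmorph_div rmorph_nat.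
  by apply: D; rewrite divr_gt0// ltr_wpDl.
- by apply: D; rewrite ltr_wpDl.
Qed.

Lemma Vs_base_neq0 : Vs (fun j => qpow q (kappa j)) != 0.
Proof.
apply/prodf_neq0 => i _; apply/prodf_neq0 => j ij.
have -> : qpow q (kappa i) + (qpow q (kappa i))^-1 - qpow q (kappa j) - (qpow q (kappa j))^-1
   = qpow q (kappa i) + (qpow q (kappa i))^-1 - (qpow q (kappa j) + (qpow q (kappa j))^-1) by ring.
rewrite dist_factorE mulf_neq0 ?invr_neq0 ?qpow_neq0// /dist_factor.
have n1 r : r != 0 -> 1 - qpow q r%:C != 0.
  by move=> r0; rewrite subr_eq0 eq_sym qpow_real_eq1.
rewrite !kappaE -rmorphD -rmorphB mulf_neq0// n1//.
  rewrite gt_eqF// ltr_wpDl//; first by rewrite addr_ge0//; case: G => /=; rewrite ?divr_ge0.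
  exact/kappa_gt0/(leq_ltn_trans _ ij).
by rewrite opprD addrACA subrr addr0 subr_eq0 eqr_nat ltn_eqF.
Qed.

Lemma normalized_chiE (m : 'I_N) a (r : K) :
  let A (c : 'I_N -> K) := \det (\matrix_(i, j) basis_fun q (ell G lam) (sign_of G) i (c j)) in
  A kappa != 0 -> A (shifted m a) = A kappa * r ->
  den_factor G a != 0 -> pochhammers G N m a != 0 ->
  normalized_chi G q lam m a = r *
    ((den_factor G (kappa m) * pochhammers G N m (kappa m))
     / (den_factor G a * pochhammers G N m a)).
Proof.
move=> A A0 AE da pa; rewrite /normalized_chi.
have -> : shifted_point G q m a = (fun j : 'I_N => qpow q (shifted m a j)).
  by apply/funext => j; exact: shifted_pointE.
have -> : base_point G q (N := N) = (fun j : 'I_N => qpow q (kappa j)).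
  by apply/funext => j; exact: base_pointE.
have ds j : den_factor G (shifted m a j) != 0.
  by rewrite /shifted; case: ifP => // _; exact: den_factor_kappa.
have VE := Vs_shifted m a (kappa m).
have kE : (fun j => qpow q (shifted m (kappa m) j)) = (fun j => qpow q (kappa j)).
  by apply/funext => j; rewrite shifted_kappa.
rewrite kE in VE.
have V0 := Vs_base_neq0.
have Vp : Vs (fun j => qpow q (shifted m a j)) * pochhammers G N m (kappa m) != 0.
  by rewrite VE mulf_neq0.
have [Vs0 pk] : Vs (fun j => qpow q (shifted m a j)) != 0 /\ pochhammers G N m (kappa m) != 0.
  by apply/andP; rewrite -negb_or -mulf_eq0.
rewrite !chiE//; try by move=> j; rewrite ?qpow_neq0//.
- rewrite !character_quotient_qpow//; last exact: den_factor_kappa.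
  rewrite -/(A kappa) -/(A (shifted m a)) AE.
  have PE : \prod_j den_factor G (shifted m a j) = den_factor G a *
      \prod_(j | j != m) den_factor G (kappa j).
    rewrite (bigD1 m)//= /shifted eqxx; congr (_ * _); apply: eq_bigr => j /negbTE ->.
    by [].
  rewrite PE [\prod_j den_factor G (kappa j)](bigD1 m)//=.
  have D0 : \prod_(j | j != m) den_factor G (kappa j) != 0.
    by apply/prodf_neq0 => j _; exact: den_factor_kappa.
  have dk := den_factor_kappa m.
  have -> : Vs (fun j => qpow q (shifted m a j))
    = Vs (fun j => qpow q (kappa j)) * pochhammers G N m a / pochhammers G N m (kappa m).
    by rewrite -VE mulfK.
  by field; rewrite da pa dk pk V0 D0 A0.
- by move=> j; have [] := entry_quotient 0 (den_factor_kappa j).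
- by move=> j; have [] := entry_quotient 0 (ds j).
Qed.

End Normalized.

Lemma cvg_neq (T : Type) (K : numFieldType) (F : set_system T) (FF : Filter F)
  (f : T -> K) (l c : K) : f x @[x --> F] --> l -> l != c -> \forall x \near F, f x != c.
Proof.
move=> fl; rewrite -subr_eq0 => lc.
have h : f x - c @[x --> F] --> l - c by apply: cvgB fl _; exact: cvg_cst.
by apply: filterS (cvgr_neq0 _ h lc) => x; rewrite subr_eq0.
Qed.

Lemma cvg_divr (T : Type) (K : numFieldType) (F : set_system T) (FF : Filter F)
  (f : T -> K) (l c : K) : f x @[x --> F] --> l -> f x / c @[x --> F] --> l / c.
Proof. by move=> fl; apply: cvgM; [exact: fl|exact: cvg_cst]. Qed.

Lemma cvg_dnbhs_id (K : numFieldType) (a : K) : b @[b --> a^'] --> a.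
Proof. exact: cvg_within. Qed.

Lemma cvg_addl (T : Type) (K : numFieldType) (F : set_system T) (FF : Filter F)
  (f : T -> K) (l c : K) : f x @[x --> F] --> l -> c + f x @[x --> F] --> c + l.
Proof. by move=> fl; apply: cvgD; [exact: cvg_cst|exact: fl]. Qed.

Lemma cvg_affine (K : numFieldType) (c s a : K) :
  c + s * b @[b --> a] --> c + s * a.
Proof. exact (cvg_addl (c := c) (nbhs_filter a) (@mulrl_continuous K s a)). Qed.

(** * Isolated singularities and continuity in the exponent *)

Section ComplexContinuity.
Context {R : realType}.
Local Notation K := (complex_complex__canonical__Num_NumField R).
Implicit Types (a b z : K).

Lemma normr_cmod z : `|z| = (cmod z)%:C.
Proof. by rewrite normc_def. Qed.

Lemma cvg_Re (T : Type) (F : set_system T) (FF : Filter F) (f : T -> K) (l : K) :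
  f x @[x --> F] --> l -> complex.Re (f x) @[x --> F] --> complex.Re l.
Proof.
move=> fl; apply/cvgrPdist_lt => e e0.
have e0C : 0 < e%:C :> K by rewrite ltcR.
move/cvgrPdist_lt : fl => /(_ _ e0C); apply: filterS => x.
rewrite normr_cmod ltcR; apply: le_lt_trans.
by rewrite -cReN -cReD; exact: cmod_normr_Re.
Qed.

Lemma cvg_Im (T : Type) (F : set_system T) (FF : Filter F) (f : T -> K) (l : K) :
  f x @[x --> F] --> l -> complex.Im (f x) @[x --> F] --> complex.Im l.
Proof.
move=> fl; apply/cvgrPdist_lt => e e0.
have e0C : 0 < e%:C :> K by rewrite ltcR.
move/cvgrPdist_lt : fl => /(_ _ e0C); apply: filterS => x.
rewrite normr_cmod ltcR; apply: le_lt_trans.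
by rewrite -cImN -cImD; exact: cmod_Im.
Qed.

Lemma cvg_real_complex (T : Type) (F : set_system T) (FF : Filter F) (f : T -> R) (l : R) :
  f x @[x --> F] --> l -> ((f x)%:C : K) @[x --> F] --> (l%:C : K).
Proof.
move=> fl; apply/cvgrPdist_lt => e; rewrite ltcE /= => /andP[/eqP ie re].
move/cvgrPdist_lt : fl => /(_ _ re); apply: filterS => x h.
by rewrite -rmorphB normr_cmod cmod_real ltcE /= ie eqxx.
Qed.

Lemma cvg_cexp (T : Type) (F : set_system T) (FF : Filter F) (f : T -> K) (l : K) :
  f x @[x --> F] --> l -> (cexp (f x) : K) @[x --> F] --> (cexp l : K).
Proof.
move=> fl; have re := cvg_Re FF fl; have im := cvg_Im FF fl.
have E z : cexp z = (expR (complex.Re z) * cos (complex.Im z))%:C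
    + (0 +i* 1) * (expR (complex.Re z) * sin (complex.Im z))%:C.
  by apply: complex_ext; rewrite ?cReD ?cImD ?cReM ?cImM /=; ring.
under eq_fun do rewrite E.
rewrite E.
have ce : expR (complex.Re (f x)) @[x --> F] --> expR (complex.Re l).
  by apply: continuous_cvg re; exact: continuous_expR.
have cc : cos (complex.Im (f x)) @[x --> F] --> cos (complex.Im l).
  by apply: continuous_cvg im; exact: continuous_cos.
have cs : sin (complex.Im (f x)) @[x --> F] --> sin (complex.Im l).
  by apply: continuous_cvg im; exact: continuous_sin.
apply: cvgD; first by apply: cvg_real_complex; exact: cvgM.
apply: cvgM; first exact: cvg_cst.
by apply: cvg_real_complex; exact: cvgM.
Qed.

Lemma cexp_eq1 z : `|complex.Im z| < 1 -> cexp z = 1 -> z = 0.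
Proof.
move=> im1 e1.
have re0 : complex.Re z = 0.
  have := cmod_cexp z; rewrite e1 (cmod_real 1) normr1 -expR0.
  by move/expR_inj.
have s0 : sin (complex.Im z) = 0.
  by move: e1; rewrite /cexp re0 expR0 => /(congr1 (@complex.Im R)) /=; rewrite mul1r.
have pi1 : 1 < pi :> R by rewrite (lt_le_trans _ (pi_ge2 R))// ltr1n.
have im0 : complex.Im z = 0.
  move: im1; rewrite ltr_norml => /andP[h1 h2].
  have [h|h|//] := ltgtP (complex.Im z) 0.
    have : 0 < sin (- complex.Im z) by apply: sin_gt0_pi; apply/andP; split; lra.
    by rewrite sinN s0 oppr0 ltxx.
  have : 0 < sin (complex.Im z) by apply: sin_gt0_pi; apply/andP; split; lra.
  by rewrite s0 ltxx.
exact: complex_ext.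
Qed.

Variable q : R.
Hypotheses (q_gt0 : 0 < q) (q_lt1 : q < 1).

Lemma cvg_qpow (T : Type) (F : set_system T) (FF : Filter F) (f : T -> K) (l : K) :
  f x @[x --> F] --> l -> (qpow q (f x) : K) @[x --> F] --> (qpow q l : K).
Proof.
move=> fl.
have h : (f x * (ln q)%:C : K) @[x --> F] --> (l * (ln q)%:C : K).
  by apply: cvgM fl _; exact: cvg_cst.
exact (cvg_cexp FF h).
Qed.

(** Near a solution, q^(c + s b) = 1 means exp h = 1 for a small multiple h of the
difference, so that h = 0 by cexp_eq1. *)
Lemma near_qpow_neq1 (a c s : K) : s != 0 -> \forall b \near a^', qpow q (c + s * b) != 1.
Proof.
move=> s0.
have cl := @cvg_affine K c s a.
have [e|ne] := eqVneq (qpow q (c + s * a)) 1; last first.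
  apply: nbhs_dnbhs.
  have n0 : (qpow q (c + s * a) : K) != 1 by [].
  have h := cvg_qpow (nbhs_filter a) cl.
  exact (cvg_neq (nbhs_filter a) h n0).
have ch := @cvg_affine K (- (s * a * (ln q)%:C)) (s * (ln q)%:C) a.
have c0 : - (s * a * (ln q)%:C) + s * (ln q)%:C * a = 0 :> K by ring.
rewrite c0 in ch.
have /cvgrPdist_lt/(_ 1 ltr01) := cvg_Im (nbhs_filter a) ch.
move=> /nbhs_dnbhs H; near=> b.
have ba : b != a by near: b; exact: nbhs_dnbhs_neq.
apply/eqP => qb.
have : qpow q (s * (b - a)) = 1.
  have -> : s * (b - a) = (c + s * b) - (c + s * a) by ring.
  by rewrite qpowD qpowN qb e divr1.
rewrite /qpow => /cexp_eq1 h.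
have : s * (b - a) * (ln q)%:C = 0.
  apply: h; near: b; apply: filterS H => b; rewrite /= sub0r normrN.
  by rewrite (_ : - (s * a * (ln q)%:C) + s * (ln q)%:C * b = s * (b - a) * (ln q)%:C)//; ring.
apply/eqP; rewrite !mulf_neq0// ?subr_eq0//.
by rewrite (inj_eq (@complexI _) _ 0) lt_eqF// ln_q.
Unshelve. all: by end_near. Qed.

Lemma near_prod_neq0 (I : Type) (r : seq I) (P : pred I) (f : I -> K -> K) (F : set_system K)
  (FF : Filter F) : (forall i, P i -> \forall b \near F, f i b != 0) ->
  \forall b \near F, \prod_(i <- r | P i) f i b != 0.
Proof.
move=> H; elim: r => [|i r IH].
  by apply: nearW => b; rewrite big_nil oner_neq0.
have [Pi|nPi] := boolP (P i); last first.
  by apply: filterS IH => b; rewrite big_cons (negbTE nPi).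
near=> b; rewrite big_cons Pi mulf_neq0//.
  by near: b; exact: H.
by near: b; exact: IH.
Unshelve. all: by end_near. Qed.

Lemma near_dist_factor a k : \forall b \near a^', dist_factor q k b != 0.
Proof.
have H s : s != 0 -> \forall b \near a^', 1 - qpow q (k + s * b) != 0.
  by move=> s0; apply: filterS (near_qpow_neq1 a k s0) => b h; rewrite subr_eq0 eq_sym.
near=> b; rewrite /dist_factor mulf_neq0//.
  by near: b; apply: filterS (H 1 (oner_neq0 _)) => b; rewrite mul1r.
near: b; have n1 : -1 != 0 :> K by rewrite oppr_eq0 oner_neq0.
by apply: filterS (H (-1) n1) => b; rewrite mulN1r.
Unshelve. all: by end_near. Qed.

Lemma near_pochhammers a G N (m : 'I_N) : \forall b \near a^', pochhammers q G N m b != 0.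
Proof.
near=> b; rewrite pochhammersE//; apply: mulf_neq0; near: b.
  by apply: near_prod_neq0 => k _; exact: near_dist_factor.
by apply: near_prod_neq0 => k _; exact: near_dist_factor.
Unshelve. all: by end_near. Qed.

Lemma near_den_factor a G : \forall b \near a^', den_factor q G b != 0.
Proof.
have D b : qpow q b - qpow q (- b) = qpow q (- b) * (qpow q (0 + 2 * b) - 1).
  by rewrite add0r qpowMn !qpowN; have := qpow_neq0 q b => h; field.
have n2 : 2 != 0 :> K by rewrite pnatr_eq0.
case: G => /=.
- apply: filterS (near_qpow_neq1 a 0 (oner_neq0 _)) => b h.
  rewrite D mulf_neq0 ?qpow_neq0// subr_eq0.
  by rewrite (_ : 0 + 2 * (b / 2) = 0 + 1 * b)//; field.
- apply: filterS (near_qpow_neq1 a 0 n2) => b h.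
  by rewrite D mulf_neq0 ?qpow_neq0// subr_eq0.
- by apply: nearW => b; exact: oner_neq0.
Qed.

Lemma cvg_chi_shifted G N (lam : 'I_N -> nat) m (T : Type) (F : set_system T)
    (FF : Filter F) (f : T -> K) (l : K) : f x @[x --> F] --> l ->
  (chi G lam (shifted_point G q m (f x)) : K) @[x --> F]
    --> (chi G lam (shifted_point G q m l) : K).
Proof.
move=> fl; rewrite /chi /laurent_eval.
elim: (character_laurent G lam) => [|t P IH].
  by under eq_fun do rewrite big_nil; rewrite big_nil; exact: cvg_cst.
under eq_fun do rewrite big_cons; rewrite big_cons; apply: cvgD IH.
apply: cvgM; first exact: cvg_cst.
elim: (index_enum _) => [|i r IH].
  by under eq_fun do rewrite big_nil; rewrite big_nil; exact: cvg_cst.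
under eq_fun do rewrite big_cons; rewrite big_cons; apply: cvgM IH.
rewrite /shifted_point; case: (i == m :> nat); last exact: cvg_cst.
have X k : (qpow q (f x) ^+ k : K) @[x --> F] --> (qpow q l ^+ k : K).
  under eq_fun do rewrite -qpowMn; rewrite -qpowMn; apply: cvg_qpow.
  by apply: cvgM fl; exact: cvg_cst.
case: (t.2 i) => k; first exact: X.
by apply: cvgV; [rewrite expf_neq0// qpow_neq0|exact: X].
Qed.

(** The character is a Laurent polynomial in q^a, hence continuous, and the
denominators do not vanish in a punctured neighbourhood of a. *)
Lemma value_by_continuity_chi G N (lam : 'I_N -> nat) (m : 'I_N) (den rhs : K -> K) a :
  (forall b, den_factor q G b * pochhammers q G N m b != 0 -> den b != 0) ->
  (forall b, den b != 0 -> rhs b = normalized_chi G q lam m b) ->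
  value_by_continuity den rhs a (normalized_chi G q lam m a).
Proof.
move=> d0 H; rewrite /value_by_continuity; case: eqP => [_|/eqP da]; last by rewrite H.
have c : (normalized_chi G q lam m b : K) @[b --> a^'] --> (normalized_chi G q lam m a : K).
  have ca : b @[b --> a^'] --> a by exact: cvg_dnbhs_id.
  have h := cvg_chi_shifted (G := G) (lam := lam) (m := m) (dnbhs_filter a) ca.
  exact (cvg_divr (dnbhs_filter a) h).
apply: cvg_trans c; apply: near_eq_cvg; near=> b; rewrite H// d0// mulf_neq0//.
  by near: b; exact: near_den_factor.
by near: b; exact: near_pochhammers.
Unshelve. all: by end_near. Qed.

End ComplexContinuity.

(** * The contour integrals as sums over the nodes *)

Section Exponents.
Context {R : realType}.
Variables (G : lie_type) (N : nat) (lam : 'I_N -> nat).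
Hypothesis lam_GT : is_GT lam.

Lemma ell_ge0 i : 0 <= ell G lam i :> R.
Proof. by rewrite addr_ge0//; case: G => /=; rewrite ?divr_ge0. Qed.

(** The numbers lam i + (N - i.+1) are strictly decreasing. *)
Lemma ell_inj : injective (ell G lam : 'I_N -> R).
Proof.
move=> i j /addIr/eqP; rewrite eqr_nat => /eqP e; apply/val_inj/eqP.
have H (i' j' : 'I_N) : (lam i' + (N - i'.+1) = lam j' + (N - j'.+1))%N -> ~~ (i' < j')%N.
  move=> e'; apply/negP => ij; have := lam_GT (ltnW ij); have := ltn_ord j'; move: e' ij.
  by move: (lam i') (lam j') (nat_of_ord i') (nat_of_ord j') => a b c d; lia.
rewrite eqn_leq; apply/andP; split; rewrite leqNgt; first exact (H _ _ (esym e)).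
exact (H _ _ e).
Qed.

Lemma size_support_nodes : (forall i, ell G lam i != 0 :> R) ->
  size (support_nodes (ell G lam : 'I_N -> R)) = N.
Proof.
move=> e0; rewrite /support_nodes (eq_filter (a2 := predT)) ?filter_predT ?size_enum_ord// => i; rewrite e0.
Qed.

Lemma size_support_nodes0 i0 : ell G lam i0 = 0 :> R ->
  size (support_nodes (ell G lam : 'I_N -> R)) = N.-1.
Proof.
move=> ei0; rewrite -sum1_size big_filter big_enum_cond /=.
rewrite (eq_bigl (fun i => i \in predC1 i0)) ?sum1_card ?cardC1 ?card_ord// => i.
by rewrite inE /= -(inj_eq ell_inj) ei0.
Qed.

End Exponents.

Section Contour.
Context {R : realType}.
Variable q : R.
Hypotheses (q_gt0 : 0 < q) (q_lt1 : q < 1).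
Local Notation K := R[i].
Variables (G : lie_type) (N : nat) (lam : 'I_N -> nat).
Hypothesis lam_GT : is_GT lam.
Implicit Types (p : {poly K}) (b : K).

Definition node_product : {poly K} :=
  \prod_(i < N) (('X - (q `^ ell G lam i)%:C%:P) * ('X - (q `^ (- ell G lam i))%:C%:P)).

Lemma horner_node_product z :
  node_product.[z] = \prod_(i < N) node_factor G q lam i z.
Proof.
rewrite horner_prod; apply: eq_bigr => i _.
by rewrite hornerM !hornerXsubC.
Qed.

Lemma node_polyE h : node_poly q (ell G lam) h = ('X - 1%:P) ^+ h *
  \prod_(i < N | ell G lam i != 0 :> R)
     (('X - (q `^ ell G lam i)%:C%:P) * ('X - (q `^ (- ell G lam i))%:C%:P)).
Proof.
rewrite /node_poly /root_poly !map_cat !big_cat /= !big_map; congr (_ * _).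
  by rewrite big_nseq; elim: h => [|h IH] /=; rewrite ?expr0// IH exprS !rmorph1.
by rewrite -big_split /= big_filter big_enum_cond.
Qed.

Variables (gz gw : R -> K).
Hypothesis adm : admissible_contours G q lam gz gw.

(** The node 1 lies between q^l and q^(-l), hence in the convex hull of the
nodes. *)
Lemma node_encloses h x : (0 < N)%N -> x \in node_seq q (ell G lam) h -> encloses gz x%:C.
Proof.
move=> N0 xs; apply: (adm_z_nodes adm) => c d cd.
have nd i : q `^ ell G lam i \in `[c, d] /\ q `^ (- ell G lam i) \in `[c, d].
  by split; apply: cd; exists i; [left|right].
move: xs; rewrite !mem_cat => /or3P[/nseqP[-> _]|/mapP[i _ ->]|/mapP[i _ ->]].
- have [] := nd (Ordinal N0); rewrite !in_itv /= => /andP[h1 _] /andP[_ h2].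
  have e0 : 0 <= ell G lam (Ordinal N0) :> R := ell_ge0 _ _ _.
  apply/andP; split.
    apply: le_trans h1 _; rewrite -(powRr0 q).
    by apply: ger_powR => //; rewrite q_gt0 ltW.
  apply: le_trans _ h2; rewrite -{1}(powRr0 q).
  by apply: ger_powR; rewrite ?q_gt0 ?(ltW q_lt1)// oppr_le0.
- by have [] := nd i.
- by have [] := nd i.
Qed.

Lemma inner_integral p c (C : K) t : t \in `[0, 1] ->
  oint gw (fun w => C * (p.[w] / (w ^+ c * (w - gz t)))) = C * (drop_poly c p).[gz t].
Proof.
move=> t01; have pw := contour_C1 (adm_w adm).
have ez := adm_w_z adm t01; have e0 := adm_w_origin adm.
have z0 := slit_neq0 (adm_z_slit adm t01).
rewrite ointZ ?(oint_drop_poly pw (contour_closed (adm_w adm)) z0 ez e0)//.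
pose r : {poly K} := 'X^c * ('X - (gz t)%:P).
pose U := [set w : K | r.[w] != 0].
have hr : forall w, U w -> r.[w] != 0 by [].
have := holoM (@holo_poly _ U p) (holoV hr (@holo_poly _ U r)).
move/holo_integrable_on => /(_ _ pw) H.
apply: integrable_on_eq (H _) => u u01; first by rewrite /r !hornerE.
change (is_true (r.[gw u] != 0)); rewrite /r hornerM hornerXsubC hornerXn.
have [h1 _] := ez; have [h2 _] := e0.
by rewrite mulf_neq0 ?expf_neq0 ?h2// subr_eq0 h1.
Qed.

Lemma outer_integral p h b : (0 < N)%N -> (h <= 1)%N -> node_seq q (ell G lam) h != [::] ->
  let P := node_poly q (ell G lam) h in
  oint gz (fun z => cpow z b * (p.[z] / P.[z]))
  = \sum_(x <- node_seq q (ell G lam) h) cpow x%:C b * (p.[x%:C] / P^`().[x%:C]).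
Proof.
move=> N0 h1 s0 P.
have pg := contour_C1 (adm_z adm); have g01 := contour_closed (adm_z adm).
have sg := adm_z_slit adm.
have us := uniq_node_seq q_gt0 q_lt1 (ell_ge0 G lam) (ell_inj lam_GT) h1.
apply: (residue_cpow pg g01 sg b p us s0) => x xs; split.
  exact: (node_seq_gt0 q_gt0 xs).
exact: node_encloses xs.
Qed.

End Contour.

Section Formulas.
Context {R : realType}.
Variable q : R.
Hypotheses (q_gt0 : 0 < q) (q_lt1 : q < 1).
Local Notation K := R[i].
Variables (N : nat) (lam : 'I_N -> nat).
Hypotheses (lam_GT : is_GT lam).
Implicit Types (p : {poly K}) (b z w : K).

Lemma prod_node_ratio G z w :
  \prod_(i < N) (node_factor G q lam i w / node_factor G q lam i z)
  = (node_product q G lam).[w] / (node_product q G lam).[z].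
Proof. by rewrite big_split /= prodfV !horner_node_product. Qed.

Lemma node_poly_full G h : (forall i, ell G lam i != 0 :> R) ->
  node_poly q (ell G lam) h = ('X - 1%:P) ^+ h * node_product q G lam.
Proof.
move=> e0; rewrite node_polyE; congr (_ * _).
by apply: eq_bigl => i; rewrite e0.
Qed.

Lemma ell_neq0 G i : G <> TypeD -> ell G lam i != 0 :> R.
Proof.
move=> GD; rewrite gt_eqF// /ell ltr_wpDl//.
by case: G GD => //= _; rewrite divr_gt0.
Qed.

Lemma node_seq_neq0 G h : (0 < h + size (support_nodes (ell G lam : 'I_N -> R)))%N ->
  node_seq q (ell G lam) h != [::].
Proof.
rewrite lt0n addn_eq0 => H; apply: contraNneq H => /(congr1 size).
by rewrite size_node_seq => /eqP; rewrite addn_eq0 muln_eq0.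
Qed.

Lemma drop_polyBMXn c k p : (k <= c)%N ->
  drop_poly c ((1 - 'X^k) * p) = drop_poly c p - drop_poly (c - k) p.
Proof.
rewrite -subn_eq0 => /eqP kc; rewrite mulrBl mul1r ['X^k * p]mulrC.
by rewrite linearB /= drop_polyMXn kc expr0 mulr1.
Qed.

Variable m : nat.
Hypothesis mN : (m < N)%N.

Lemma contour_residueC gz gw b : admissible_contours TypeC q lam gz gw ->
  oint gz (fun z => oint gw (fun w => integrandC q lam m b z w))
  = residue_sum q (ell TypeC lam) (-1) 0 0 N 1
      (fun m => N + m + 1 + 0)%N (fun m => N - m - 1)%N m b.
Proof.
move=> adm; have N0 : (0 < N)%N by lia.
pose P := node_poly q (ell TypeC lam) 0.
have PE : P = node_product q TypeC lam.
  by rewrite /P node_poly_full ?expr0 ?mul1r// => i; exact: ell_neq0.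
pose c := (N + m + 1)%N; pose p : {poly K} := (1 - 'X^(2 * m + 2)) * P.
pose g := inner_poly 0 (-1) (N + m + 1 + 0) (N - m - 1) P.
transitivity (oint gz (fun z => cpow z (b + N%:R - 1) * (g.[z] / P.[z]))).
  apply: oint_eq => t t01.
  transitivity (oint gw (fun w => cpow (gz t) (b + N%:R - 1) / P.[gz t]
      * (p.[w] / (w ^+ c * (w - gz t))))).
    apply: oint_eq => u _; rewrite /integrandC prod_node_ratio -PE /p /c.
    rewrite hornerM hornerD hornerN hornerXn hornerC; ring.
  rewrite (inner_integral adm)// -mulrA [_^-1 * _]mulrC; congr (_ * (_ / _)).
  rewrite /p drop_polyBMXn; last by rewrite /c; lia.
  rewrite /g horner_inner_poly addn0 expr0 mul1r hornerD hornerN mulN1r.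
  by congr (_ - (drop_poly _ _).[_]); rewrite /c; lia.
rewrite (outer_integral q_gt0 q_lt1 lam_GT adm)//; last first.
  apply: node_seq_neq0; rewrite size_support_nodes// => i; exact: ell_neq0.
Qed.

Lemma contour_residueB gz gw b : admissible_contours TypeB q lam gz gw ->
  oint gz (fun z => oint gw (fun w => integrandB q lam m b z w))
  = residue_sum q (ell TypeB lam) (-1) 1 1 N (1 / 2)
      (fun m => N + m + 1 + 1)%N (fun m => N - m)%N m b.
Proof.
move=> adm; have N0 : (0 < N)%N by lia.
pose P := node_poly q (ell TypeB lam) 1.
have PE : P = ('X - 1%:P) * node_product q TypeB lam.
  by rewrite /P node_poly_full ?expr1// => i; exact: ell_neq0.
pose c := (N + m + 2)%N; pose B := b + N%:R - 1 / 2.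
pose g := inner_poly 1 (-1) (N + m + 1 + 1) (N - m) P.
transitivity (oint gz (fun z => cpow z B * (g.[z] / P.[z]))).
  apply: oint_eq => t t01.
  pose p : {poly K} := ((gz t)%:P - 'X^(2 * m + 2)) * P.
  transitivity (oint gw (fun w => cpow (gz t) B / P.[gz t]
      * (p.[w] / (w ^+ c * (w - gz t))))).
    apply: oint_eq => u _; rewrite /integrandB prod_node_ratio PE /p /c.
    rewrite !(hornerM, hornerD, hornerN, hornerXn, hornerC, hornerX) PE.
    rewrite !(hornerM, hornerD, hornerN, hornerXn, hornerC, hornerX) -/B [((gz t - 1) * _)^-1]invfM; ring.
  rewrite (inner_integral adm)// -mulrA [_^-1 * _]mulrC; congr (_ * (_ / _)).
  have -> : p = (gz t) *: P - P * 'X^(2 * m + 2).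
    by rewrite /p mulrBl mul_polyC [_ * P]mulrC.
  rewrite linearB linearZ /= drop_polyMXn (_ : (2 * m + 2 - c)%N = 0%N); last by rewrite /c; lia.
  rewrite expr0 mulr1 /g horner_inner_poly expr1 hornerD hornerN hornerZ mulN1r.
  by congr (_ * (drop_poly _ _).[_] - (drop_poly _ _).[_]); rewrite /c; lia.
rewrite (outer_integral q_gt0 q_lt1 lam_GT adm)//.
by apply: eq_bigr => x _; rewrite fmorph_div rmorph1 rmorph_nat.
Qed.

Lemma drop_polyS c p : drop_poly c p = (p`_c)%:P + 'X * drop_poly c.+1 p.
Proof.
apply/polyP => j; rewrite coefD coefC coefXM !coef_drop_poly.
by case: j => [|j] /=; rewrite ?addr0 ?add0r// addSnnS.
Qed.

Lemma drop_polyS_XsubC1 c p :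
  drop_poly c.+1 (('X - 1%:P) * p) = drop_poly c p - drop_poly c.+1 p.
Proof.
rewrite mulrBl mul1r mulrC linearB /= -['X]expr1 drop_polyMXn subSS subn0.
by rewrite expr0 mulr1.
Qed.

(** If p is the product over the nodes with the double node 1 counted once, its
antisymmetry makes the coefficients at the two truncation points opposite, and
this is what makes X - 1 a factor. *)
Lemma inner_polyD_double p : p`_(N + m) = - p`_(N - m.+1) ->
  inner_poly 1 1 (N + m).+1 (N - m) (('X - 1%:P) * p)
  = ('X - 1%:P) * inner_poly 0 1 (N + m) (N - m) p.
Proof.
move=> pal; have E : (N - m = (N - m.+1).+1)%N by lia.
rewrite /inner_poly {1}E !drop_polyS_XsubC1 -E.
rewrite (drop_polyS (N - m.+1)) -E (drop_polyS (N + m)) pal.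
by rewrite polyCN expr0 expr1; ring.
Qed.

Lemma natr_predn : (N.-1)%:R = N%:R - 1 :> K.
Proof. by rewrite -subn1 natrB//; lia. Qed.

Lemma integrandD_inner gz gw b t : admissible_contours TypeD q lam gz gw ->
  t \in `[0, 1] ->
  oint gw (fun w => integrandD q lam m b (gz t) w)
  = cpow (gz t) (b + N%:R - 1) *
    ((inner_poly 1 1 (N + m).+1 (N - m) (node_product q TypeD lam)).[gz t]
     / (node_product q TypeD lam).[gz t]).
Proof.
move=> adm t01; set P := node_product q TypeD lam.
pose c := (N + m + 1)%N; pose B := b + N%:R - 1.
pose p : {poly K} := ((gz t)%:P + 'X^(2 * m + 1)) * P.
transitivity (oint gw (fun w => cpow (gz t) B / P.[gz t]
    * (p.[w] / (w ^+ c * (w - gz t))))).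
  apply: oint_eq => u _; rewrite /integrandD prod_node_ratio -/P /p /c.
  by rewrite !(hornerM, hornerD, hornerXn, hornerC) -/B; ring.
rewrite (inner_integral adm)// -mulrA [_^-1 * _]mulrC; congr (_ * (_ / _)).
have -> : p = (gz t) *: P + P * 'X^(2 * m + 1).
  by rewrite /p mulrDl mul_polyC ['X^_ * P]mulrC.
rewrite linearD linearZ /= drop_polyMXn (_ : (2 * m + 1 - c)%N = 0%N); last by rewrite /c; lia.
rewrite expr0 mulr1 horner_inner_poly expr1 hornerD hornerZ mul1r.
by congr (_ * (drop_poly _ _).[_] + (drop_poly _ _).[_]); rewrite /c; lia.
Qed.

Lemma contour_residueD gz gw b : admissible_contours TypeD q lam gz gw ->
  (forall i, ell TypeD lam i != 0 :> R) ->
  oint gz (fun z => oint gw (fun w => integrandD q lam m b z w))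
  = residue_sum q (ell TypeD lam) 1 0 1 N.-1 0
      (fun m => N.-1 + m + 1 + 1)%N (fun m => N - m)%N m b.
Proof.
move=> adm e0; have N0 : (0 < N)%N by lia.
pose P := node_poly q (ell TypeD lam) 0.
have PE : node_product q TypeD lam = P.
  by rewrite /P node_poly_full ?expr0 ?mul1r.
have cE : (N.-1 + m + 1 + 1 = (N + m).+1)%N by lia.
rewrite /residue_sum cE natr_predn.
transitivity (oint gz (fun z => cpow z (b + N%:R - 1) *
    ((inner_poly 1 1 (N + m).+1 (N - m) P).[z] / P.[z]))).
  by apply: oint_eq => t t01; rewrite (integrandD_inner b adm t01) PE.
rewrite (outer_integral q_gt0 q_lt1 lam_GT adm)//; last first.
  by apply: node_seq_neq0; rewrite size_support_nodes.
by apply: eq_bigr => x _; rewrite rmorph0 subr0 addrA.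
Qed.

Lemma contour_residueD0 gz gw b i0 : admissible_contours TypeD q lam gz gw ->
  ell TypeD lam i0 = 0 :> R ->
  oint gz (fun z => oint gw (fun w => integrandD q lam m b z w))
  = residue_sum q (ell TypeD lam) 1 1 0 N.-1 0
      (fun m => N.-1 + m + 1 + 0)%N (fun m => N - m)%N m b.
Proof.
move=> adm e0; have N0 : (0 < N)%N by lia.
pose P := node_poly q (ell TypeD lam) 1.
have PE : node_product q TypeD lam = ('X - 1%:P) * P.
  rewrite /node_product (bigD1 i0)//= e0 oppr0 powRr0 /P node_polyE expr1 mulrA.
  congr (_ * _).
  by apply: eq_bigl => i; rewrite -(inj_eq (@ell_inj R TypeD N lam lam_GT)) e0.
have cE : (N.-1 + m + 1 + 0 = N + m)%N by lia.
rewrite /residue_sum cE natr_predn.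
have sn := size_support_nodes0 lam_GT e0.
have pal : P`_(N + m) = - P`_(N - m.+1).
  have sP : (size P <= (1 + 2 * size (support_nodes (ell TypeD lam : 'I_N -> R))).+1)%N.
    by rewrite size_root_poly size_map size_node_seq.
  have jn : (N - m.+1 <= 1 + 2 * size (support_nodes (ell TypeD lam : 'I_N -> R)))%N.
    by rewrite sn; lia.
  have := palindromic_coef sP (palindromic_node_poly q_gt0 (ell TypeD lam) 1) jn.
  by rewrite expr1 mulN1r => <-; congr (_`__); rewrite sn; lia.
transitivity (oint gz (fun z => cpow z (b + N%:R - 1) *
    ((inner_poly 0 1 (N + m) (N - m) P).[z] / P.[z]))).
  apply: oint_eq => t t01; rewrite (integrandD_inner b adm t01) PE.
  rewrite inner_polyD_double// !hornerM hornerXsubC; congr (_ * _).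
  have [h1 _] : encloses gz 1%:C.
    by apply: (node_encloses q_gt0 q_lt1 adm (h := 1)) => //; rewrite mem_cat mem_nseq eqxx.
  have z1 : gz t - 1 != 0 by rewrite subr_eq0; exact: h1.
  by rewrite -mulf_div divff// mul1r.
rewrite (outer_integral q_gt0 q_lt1 lam_GT adm)//.
by apply: eq_bigr => x _; rewrite rmorph0 subr0 addrA.
Qed.

End Formulas.

(** * The three formulas *)

Section Prefactors.
Context {R : realType}.
Variable q : R.
Local Notation K := R[i].
Implicit Types (a b : K).

Lemma epsCB : epsC TypeB = 1 / 2 :> K.
Proof. by rewrite /epsC fmorph_div rmorph1 rmorph_nat. Qed.

Lemma epsCC : epsC TypeC = 1 :> K.
Proof. exact: rmorph1. Qed.

Lemma epsCD : epsC TypeD = 0 :> K.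
Proof. exact: rmorph0. Qed.

Lemma denBE N m b : denB q N m b = den_factor q TypeB b * pochhammers q TypeB N m b.
Proof.
rewrite /denB /pochhammers epsCB -mulrA; congr (_ * (_ * _)).
by congr (qpochs [:: qpow _ _; qpow _ _] _ _); field.
Qed.

Lemma denCE N m b : denC q N m b = den_factor q TypeC b * pochhammers q TypeC N m b.
Proof.
rewrite /denC /pochhammers epsCC -mulrA; congr (_ * (_ * _)).
by congr (qpochs [:: qpow _ _; qpow _ _] _ _); ring.
Qed.

Lemma denDE N m b : denD q N m b = 2 * (den_factor q TypeD b * pochhammers q TypeD N m b).
Proof.
rewrite /denD /pochhammers epsCD mul1r !addr0 -mulrA; congr (_ * (_ * _)).
by rewrite add0r sub0r.
Qed.

Lemma qpochs_swap (x y : K) n : qpochs [:: x; y] q n = qpochs [:: y; x] q n.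
Proof. by rewrite /qpochs !big_cons !big_nil !mulr1 mulrC. Qed.

Lemma numBE N m : let k := m%:R + epsC TypeB in
  numB q N m = den_factor q TypeB k * pochhammers q TypeB N m k.
Proof.
rewrite /numB /pochhammers epsCB /= -mulrA; congr (_ * (_ * _)).
- by congr (qpow _ _ - qpow _ (- _)); field.
- by congr (qpochs [:: qpow _ _; qpow _ _] _ _); field.
- rewrite qpochs_swap.
  by congr (qpochs [:: qpow _ _; qpow _ _] _ _); field.
Qed.

Lemma numCE N m : let k := m%:R + epsC TypeC in
  numC q N m = den_factor q TypeC k * pochhammers q TypeC N m k.
Proof.
rewrite /numC /pochhammers epsCC /= -mulrA; congr (_ * (_ * _)).
- by congr (qpochs [:: qpow _ _; qpow _ _] _ _); ring.
- rewrite qpochs_swap.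
  by congr (qpochs [:: qpow _ _; qpow _ _] _ _); ring.
Qed.

Lemma numDE N m : let k := m%:R + epsC TypeD in
  numD q N m = (2 - (m == 0%N)%:R) * (den_factor q TypeD k * pochhammers q TypeD N m k).
Proof.
rewrite /numD /pochhammers epsCD /= mul1r -mulrA; congr (_ * (_ * _)).
- by congr (qpochs [:: qpow _ _; qpow _ _] _ _); ring.
- rewrite qpochs_swap.
  by congr (qpochs [:: qpow _ _; qpow _ _] _ _); ring.
Qed.

End Prefactors.

Section Assembly.
Context {R : realType}.
Variable q : R.
Hypotheses (q_gt0 : 0 < q) (q_lt1 : q < 1).
Local Notation K := R[i].
Variables (N m : nat) (mN : (m < N)%N) (lam : 'I_N -> nat).
Hypothesis lam_GT : is_GT lam.
Implicit Types (a b : K).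
Let M := Ordinal mN.

Lemma normalized_chi_residue G (h e p0 k0 : nat) (cp cm : nat -> nat) (omega : 'I_N -> K) :
  let n := (h + 2 * size (support_nodes (ell G lam : 'I_N -> R)))%N in
  let k := m%:R + epsC G in
  (h <= 1)%N -> (forall j, cp j = (p0 + j + 1 + e)%N) -> (p0 + e + N <= n)%N ->
  k0%:R = 2 * (p0%:R - eps G) :> R ->
  (forall j, (j < N)%N ->
    [/\ (e <= 1)%N, (cp j + cm j = n.+1)%N, (0 < cm j)%N & n = (k0 + e).+1] \/
    [/\ e = 0%N, (cp j + cm j = n)%N, n = k0.+2 & sign_of G = - (-1) ^+ h :> K]) ->
  (h = 0%N \/ sign_of G = -1 :> K \/
    sign_of G = 1 :> K /\ exists i0, ell G lam i0 = 0 :> R) ->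
  (forall j, omega j != 0) ->
  (forall j l : 'I_N, (l == j)%:R + sign_of G * (cm j == (p0 + l).+1)%:R
     = omega j * (l == j)%:R) ->
  forall b, den_factor q G b * pochhammers q G N m b != 0 ->
  normalized_chi G q lam m b
  = residue_sum q (ell G lam) (sign_of G) h e p0 (eps G) cp cm m b / omega M *
    ((den_factor q G k * pochhammers q G N m k)
     / (den_factor q G b * pochhammers q G N m b)).
Proof.
move=> n k h1 cpE pN k0E parity middle omega0 omegaE b.
rewrite mulf_eq0 negb_or => /andP[db pb].
have s2 : sign_of G * sign_of G = 1 :> K by case: (G); rewrite /= ?mulrNN mulr1.
have [A0 AE] := core_det q_gt0 q_lt1 (ell_ge0 G lam) (ell_inj lam_GT) h1 erefl cpE pN s2
  k0E parity middle omega0 omegaE.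
exact: (normalized_chiE q_gt0 q_lt1 (m := M) A0 (AE M b) db pb).
Qed.

Lemma value_typeB gz gw a : admissible_contours TypeB q lam gz gw ->
  value_by_continuity (denB q N m)
    (fun b => numB q N m / denB q N m b *
       oint gz (fun z => oint gw (fun w => integrandB q lam m b z w)))
    a (normalized_chi TypeB q lam m a).
Proof.
move=> adm; have e0 i : ell TypeB lam i != 0 :> R by exact: ell_neq0.
have sn : size (support_nodes (ell TypeB lam : 'I_N -> R)) = N by exact: size_support_nodes.
apply: (value_by_continuity_chi q_gt0 q_lt1 (m := M)) => b; first by rewrite denBE.
rewrite denBE => db; rewrite (contour_residueB q_gt0 q_lt1 lam_GT mN b adm).
rewrite (@normalized_chi_residue TypeB 1 1 N (2 * N).-1
  (fun m => N + m + 1 + 1)%N (fun m => N - m)%N (fun=> 1)) //.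
- by rewrite numBE divr1 /= mulrC.
- by rewrite sn; lia.
- by rewrite /eps mulrBr -natrM -subn1 natrB; [field|lia].
- by move=> j jN; left; rewrite sn; split; lia.
- by right; left.
- move=> j l; rewrite mul1r (_ : (N - j == (N + l).+1)%N = false) ?mulr0 ?addr0//.
  by apply/negbTE; lia.
Qed.

Lemma value_typeC gz gw a : admissible_contours TypeC q lam gz gw ->
  value_by_continuity (denC q N m)
    (fun b => numC q N m / denC q N m b *
       oint gz (fun z => oint gw (fun w => integrandC q lam m b z w)))
    a (normalized_chi TypeC q lam m a).
Proof.
move=> adm; have e0 i : ell TypeC lam i != 0 :> R by exact: ell_neq0.
have sn : size (support_nodes (ell TypeC lam : 'I_N -> R)) = N by exact: size_support_nodes.
apply: (value_by_continuity_chi q_gt0 q_lt1 (m := M)) => b; first by rewrite denCE.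
rewrite denCE => db; rewrite (contour_residueC q_gt0 q_lt1 lam_GT mN b adm).
rewrite (@normalized_chi_residue TypeC 0 0 N (2 * N - 2)
  (fun m => N + m + 1 + 0)%N (fun m => N - m - 1)%N (fun=> 1)) //.
- by rewrite numCE divr1 /= mulrC.
- by rewrite sn; lia.
- by rewrite /eps mulrBr mulr1 -natrM natrB//; lia.
- by move=> j jN; right; rewrite sn; split; rewrite ?expr0//; lia.
- by left.
- move=> j l; rewrite mul1r (_ : (N - j - 1 == (N + l).+1)%N = false) ?mulr0 ?addr0//.
  by apply/negbTE; lia.
Qed.

(* In type D the two truncations both contribute to the value at the exponent 0
   if m = 0, which corresponds to v_i(0) = 2. *)
Let omegaD (j : 'I_N) : K := 1 + (j == 0%N :> nat)%:R.

Let omegaD_neq0 j : omegaD j != 0.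
Proof. by rewrite /omegaD nat1r pnatr_eq0. Qed.

Let omegaDE (j l : 'I_N) : (l == j)%:R + 1 * ((N - j)%N == (N.-1 + l).+1)%:R
  = omegaD j * (l == j)%:R :> K.
Proof.
have -> : ((N - j)%N == (N.-1 + l).+1) = (l == j) && (j == 0%N :> nat).
  by rewrite -(inj_eq val_inj) /=; have := ltn_ord j; have := ltn_ord l; lia.
by rewrite /omegaD; case: (l == j); case: (j == 0%N :> nat) => /=; rewrite ?mulr1 ?mulr0 ?addr0.
Qed.

Let numD_ratio : (2 - (m == 0%N)%:R) / 2 = (omegaD M)^-1 :> K.
Proof.
rewrite /omegaD /=; case: (m == 0%N) => /=; last by rewrite subr0 addr0 divff ?invr1// pnatr_eq0.
by rewrite (_ : 2 - 1 = 1 :> K) ?mul1r//; ring.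
Qed.

(** If some l_i is 0, the common factor X - 1 is cancelled first; the two cases lead
to the same quotient of determinants. *)
Lemma value_typeD gz gw a : admissible_contours TypeD q lam gz gw ->
  value_by_continuity (denD q N m)
    (fun b => numD q N m / denD q N m b *
       oint gz (fun z => oint gw (fun w => integrandD q lam m b z w)))
    a (normalized_chi TypeD q lam m a).
Proof.
move=> adm; have n2 : 2 != 0 :> K by rewrite pnatr_eq0.
apply: (value_by_continuity_chi q_gt0 q_lt1 (m := M)) => b.
  by move=> db; rewrite denDE mulf_neq0.
rewrite denDE mulf_eq0 negb_or => /andP[_ db].
suff [h [e [cp [-> ->]]]] : exists h e cp,
    oint gz (fun z => oint gw (fun w => integrandD q lam m b z w))
      = residue_sum q (ell TypeD lam) 1 h e N.-1 0 cp (fun m => N - m)%N m b /\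
    normalized_chi TypeD q lam M b
      = residue_sum q (ell TypeD lam) 1 h e N.-1 0 cp (fun m => N - m)%N m b / omegaD M *
    ((den_factor q TypeD (m%:R + epsC TypeD) * pochhammers q TypeD N m (m%:R + epsC TypeD))
     / (den_factor q TypeD b * pochhammers q TypeD N m b)).
  rewrite numDE /=; set X := 1 * _; set Y := 1 * _.
  by rewrite -numD_ratio invfM; ring.
have [[i0 ei0]|noz] := pselect (exists i0, ell TypeD lam i0 = 0 :> R).
  have sn := size_support_nodes0 lam_GT ei0.
  exists 1%N, 0%N, (fun m => N.-1 + m + 1 + 0)%N; split.
    exact: (contour_residueD0 q_gt0 q_lt1 lam_GT mN b adm ei0).
  apply: (@normalized_chi_residue TypeD 1 0 N.-1 (2 * N.-1)) => //.
  - by rewrite sn; lia.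
  - by rewrite /eps subr0 natrM.
  - by move=> j jN; left; rewrite sn; split; lia.
  - by right; right; split=> //; exists i0.
have e0 i : ell TypeD lam i != 0 :> R.
  by apply/eqP => ei; apply: noz; exists i.
have sn : size (support_nodes (ell TypeD lam : 'I_N -> R)) = N by exact: size_support_nodes.
exists 0%N, 1%N, (fun m => N.-1 + m + 1 + 1)%N; split.
  exact: (contour_residueD q_gt0 q_lt1 lam_GT mN b adm e0).
apply: (@normalized_chi_residue TypeD 0 1 N.-1 (2 * N.-1)) => //.
- by rewrite sn; lia.
- by rewrite /eps subr0 natrM.
- by move=> j jN; left; rewrite sn; split; lia.
- by left.
Qed.

End Assembly.

Unset Implicit Arguments.

Theorem theorem3p14 (R : realType) (q : R) (q_gt0 : 0 < q) (q_lt1 : q < 1)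
    (N m : nat) (hm : (m < N)%N) (lam : 'I_N -> nat) (hlam : is_GT lam)
    (a : R[i]) :
  [/\ forall gz gw : R -> R[i], admissible_contours TypeB q lam gz gw ->
        value_by_continuity (denB q N m)
          (fun b => numB q N m / denB q N m b *
             oint gz (fun z => oint gw (fun w => integrandB q lam m b z w)))
          a (normalized_chi TypeB q lam m a),
      forall gz gw : R -> R[i], admissible_contours TypeC q lam gz gw ->
        value_by_continuity (denC q N m)
          (fun b => numC q N m / denC q N m b *
             oint gz (fun z => oint gw (fun w => integrandC q lam m b z w)))
          a (normalized_chi TypeC q lam m a)
    & forall gz gw : R -> R[i], admissible_contours TypeD q lam gz gw ->
        value_by_continuity (denD q N m)
          (fun b => numD q N m / denD q N m b *
             oint gz (fun z => oint gw (fun w => integrandD q lam m b z w)))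
          a (normalized_chi TypeD q lam m a)].
Proof.
split=> gz gw adm; [exact: value_typeB|exact: value_typeC|exact: value_typeD].
Qed.
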